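(* Let $N\ge2$ be an integer. (i) Let $f\in L^2_1\cap L^N_1$. Then $$\mathbb E\,I_1(f)_T^N=B_N\Big(0,\int_{(0,T]\times\mathbb R}f(z)^2\,\mathbf m(dz),\int_{(0,T]\times\mathbb R_0}f(z)^3\,\mathbf m(dz),\dots,\int_{(0,T]\times\mathbb R_0}f(z)^N\,\mathbf m(dz)\Big),$$ or, in more detail, $$\mathbb E\,I_1(f)_T^N=\sum_{q=1}^N\ \sum_{\substack{\sum_{i=2}^{N-q+1}j_i=q\\ \sum_{i=2}^{N-q+1}i\,j_i=N}} b_{N,(0,j_2,\dots,j_{N-q+1})}\Big(\int_{(0,T]\times\mathbb R}f(z)^2\,\mathbf m(dz)\Big)^{j_2}\prod_{i=3}^{N-q+1}\Big(\int_{(0,T]\times\mathbb R_0}f(z)^i\,\mathbf m(dz)\Big)^{j_i},$$ where the inner sum runs over integers $j_2,\dots,j_{N-q+1}\ge0$. (ii) In the Brownian case $M(dt,dx)=\sigma\,dW_t\,\delta_0(dx)$, writing $f(s):=f(s,0)$, $$\mathbb E\,I_1(f)_T^N=B_N\Big(0,\int_{(0,T]}f(s)^2\sigma^2\,ds,0,\dots,0\Big)=(N-1)!!\,\Big(\int_{(0,T]}f(s)^2\sigma^2\,ds\Big)^{N/2}\mathbf 1_{\{N\in2\mathbb N\}}.$$ (iii) If $f\in L^2_1\cap L^N_1$ for all $N\in\mathbb N$, then the cumulants $\kappa_N$ of $I_1(f)_T$ are given by $$\kappa_1=0,\qquad \kappa_2=\int_{(0,T]\times\mathbb R}f(z)^2\,\mathbf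 m(dz),\qquad \kappa_N=\int_{(0,T]\times\mathbb R_0}f(z)^N\,\mathbf m(dz),\quad N\ge3.$$
   Context: $L$ is a càdlàg one-dimensional Lévy process with characteristic triplet $(\gamma,\sigma^2,\nu)$, $\sigma\ge0$; $T>0$ is fixed. $W$ is the standard Brownian motion and $\tilde{\mathcal N}$ the compensated Poisson random measure of the Lévy–Itô decomposition of $L$. $\mathbb R_0=\mathbb R\setminus\{0\}$, $M(dt,dx)=\sigma\,dW_t\,\delta_0(dx)+\tilde{\mathcal N}(dt,dx)$, $\mathbf m(dt,dx)=dt\,(\sigma^2\delta_0(dx)+\nu(dx))$, $L^p_1=L^p([0,T]\times\mathbb R,\mathcal B([0,T]\times\mathbb R),\mathbf m)$, and $I_1(f)_T=\int_{(0,T]\times\mathbb R}f(t,x)\,M(dt,dx)$ for $f\in L^2_1$. For integers $1\le q\le N$ the partial exponential Bell polynomial is $$B_{N,q}(X_1,\dots,X_{N-q+1})=\sum b_{N,(j_1,\dots,j_{N-q+1})}X_1^{j_1}\cdots X_{N-q+1}^{j_{N-q+1}},\qquad b_{N,(j_1,\dots,j_{N-q+1})}=\frac{N!}{j_1!(1!)^{j_1}\,j_2!(2!)^{j_2}\cdots j_{N-q+1}!((N-q+1)!)^{j_{N-q+1}}},$$ the sum over integers $j_i\ge0$ with $j_1+\dots+j_{N-q+1}=q$ and $j_1+2j_2+\dots+(N-q+1)j_{N-q+1}=N$. The (complete exponential) Bell polynomial is $B_N(X_1,\dots,X_N)=\sum_{q=1}^N B_{N,q}(X_1,\dots,X_{N-q+1})$.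 *)

(* Defs.v *)
From HB Require Import structures.
From mathcomp Require Import all_boot all_order all_algebra.
From mathcomp Require Import all_classical all_reals all_analysis.
From mathcomp Require Import measurable_realfun.

Set Implicit Arguments.
Unset Strict Implicit.
Unset Printing Implicit Defensive.

Import Order.TTheory GRing.Theory Num.Theory.
Import numFieldNormedType.Exports.

Local Open Scope classical_set_scope.
Local Open Scope ring_scope.

(* Bell polynomials.  A multi-index (j_1, ..., j_m) is the sequence s of its
   entries, so that j_i = mult s i for 1 <= i <= m (and mult s i = 0 for i > m).
   The variables X_1, X_2, ... are given by a function x : nat -> R, whose value
   at 0 is never used. *)
Section bell.
Context {R : realType}.

Definition entries (N m : nat) (j : m.-tuple 'I_N) : seq nat :=
  [seq nat_of_ord k | k <- j].

Definition mult (s : seq nat) (i : nat) : nat := nth 0%N s i.-1.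

Definition bell_coef (N : nat) (s : seq nat) : R :=
  N`!%:R / (\prod_(1 <= i < (size s).+1) ((mult s i)`! * i`! ^ mult s i))%N%:R.

(* Each j_i is at most q <= N, whence the bound 'I_N.+1. *)
Definition partial_bell (N q : nat) (x : nat -> R) : R :=
  \sum_(j : (N - q).+1.-tuple 'I_N.+1 |
      ((\sum_(1 <= i < (N - q).+2) mult (entries j) i)%N == q)
      && ((\sum_(1 <= i < (N - q).+2) i * mult (entries j) i)%N == N))
    bell_coef N (entries j)
    * \prod_(1 <= i < (N - q).+2) x i ^+ mult (entries j) i.

Definition bell (N : nat) (x : nat -> R) : R :=
  \sum_(1 <= q < N.+1) partial_bell N q x.

(* n!! *)
Definition double_factorial (n : nat) : nat :=
  \prod_(1 <= i < n.+1 | odd i == odd n) i.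

End bell.

(* (t, x) : plane R is a time t and a jump size x. *)
Notation plane R := (measurableTypeR R * measurableTypeR R)%type.

Section processes.
Context d (Om : measurableType d) (R : realType) (P : probability Om R).

(* Every B i may be the full set, so the product rule for the whole family
   contains the one for each subfamily. *)
Definition independent_family d' (S : measurableType d') (n : nat)
    (X : 'I_n -> Om -> S) : Prop :=
  forall B : 'I_n -> set S, (forall i, measurable (B i)) ->
    P [set w | forall i, B i (X i w)]
    = (\prod_(i < n) fine (P (X i @^-1` B i)))%:E.

(* Processes are indexed by [0, +oo[; their values at negative times are
   never used. *)
Definition independent_increments (X : R -> Om -> R) : Prop :=
  forall (n : nat) (t : nat -> R), 0 <= t 0%N ->
    (forall i, t i <= t i.+1) ->
    independent_family (fun (i : 'I_n) w => X (t i.+1) w - X (t i) w).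

Definition cadlag (x : R -> R) : Prop :=
  forall t, 0 <= t ->
    x s @[s --> t^'+] --> x t /\ (0 < t -> cvg (x s @[s --> t^'-])).

Definition jump (x : R -> R) (t : R) : R := x t - lim (x s @[s --> t^'-]).

Definition levy_process (L : R -> {RV P >-> R}) : Prop :=
  [/\ {ae P, forall w, L 0 w = 0},
      independent_increments L,
      (forall s h (B : set R), 0 <= s -> 0 <= h -> measurable B ->
        P [set w | B (L (s + h) w - L s w)] = P (L h @^-1` B)),
      (forall t eps, 0 <= t -> 0 < eps ->
        P [set w | eps <= `|L s w - L t w|]
          @[s --> within `[0, +oo[%classic (nbhs t)] --> 0%E) &
      {ae P, forall w, cadlag (L ^~ w)}].

Definition brownian_motion (W : R -> {RV P >-> R}) : Prop :=
  [/\ {ae P, forall w, W 0 w = 0},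
      independent_increments W,
      (forall s t (B : set R), 0 <= s -> s < t -> measurable B ->
        P [set w | B (W t w - W s w)] = normal_prob 0 (Num.sqrt (t - s)) B) &
      {ae P, forall w, {within `[0, +oo[, continuous (W ^~ w)}}].

Definition levy_measure (nu : {measure set (measurableTypeR R) -> \bar R}) : Prop :=
  nu [set 0] = 0%E /\ (\int[nu]_x (Num.min (x ^+ 2) 1)%:E < +oo)%E.

(* E exp(i u L_t) = exp (t (i u gamma - sigma^2 u^2 / 2
                  + \int (exp(i u x) - 1 - i u x 1_{|x| <= 1}) nu(dx))),
   separated into real and imaginary parts. *)
Definition characteristic_triplet (gamma sigma : R)
    (nu : {measure set (measurableTypeR R) -> \bar R}) (L : R -> {RV P >-> R}) : Prop :=
  let psi_re u := - (sigma ^+ 2 * u ^+ 2 / 2)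
                  + \int[nu]_x (cos (u * x) - 1) in
  let psi_im u := gamma * u
                  + \int[nu]_x (sin (u * x) - u * x * \1_(`[-1, 1]) x) in
  levy_measure nu /\
  forall t u, 0 <= t ->
    \int[P]_w cos (u * L t w) = expR (t * psi_re u) * cos (t * psi_im u) /\
    \int[P]_w sin (u * L t w) = expR (t * psi_re u) * sin (t * psi_im u).

Definition time_jump_space : set (plane R) := `]0, +oo[ `*` [set~ 0].

(* The intensity is Lebesgue measure times nu.  The product \x^ requires no
   sigma-finiteness of its right factor; a Levy measure is sigma-finite, so
   that this is the usual product measure.  The second argument of poisson_prob
   is idle; poisson_prob 0 is the Dirac measure at 0. *)
Definition poisson_random_measure (nu : {measure set (measurableTypeR R) -> \bar R})
    (N : R.-ker Om ~> plane R) : Prop :=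
  [/\ (forall (A : set (plane R)) (r : R) (k : nat),
        measurable A -> A `<=` time_jump_space ->
        (lebesgue_measure \x^ nu)%E A = r%:E ->
        P [set w | N w A = k%:R%:E] = poisson_prob r k [set k]),
      (forall A : set (plane R),
        measurable A -> A `<=` time_jump_space ->
        (lebesgue_measure \x^ nu)%E A = +oo%E ->
        {ae P, forall w, N w A = +oo%E}) &
      (forall (n : nat) (A : 'I_n -> set (plane R)),
        (forall i, measurable (A i)) ->
        (forall i, A i `<=` time_jump_space) ->
        trivIset setT A ->
        independent_family (fun i w => N w (A i)))].

Definition independent_of_measure (W : R -> {RV P >-> R})
    (N : R.-ker Om ~> plane R) : Prop :=
  forall E F : set Om,
    <<s [set E' | exists t (B : set R),
           [/\ 0 <= t, measurable B & E' = W t @^-1` B]] >> E ->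
    <<s [set F' | exists (A : set (plane R)) (B : set (\bar R)),
           [/\ measurable A, A `<=` time_jump_space, measurable B &
               F' = (N ^~ A) @^-1` B]] >> F ->
    P (E `&` F) = (P E * P F)%E.

(* N counts the jumps of L, and
     L_t = gamma t + sigma W_t + \int_{]0,t] x {|x| > 1}} x N(ds, dx)
           + lim_{eps -> 0} \int_{]0,t] x {eps < |x| <= 1}} x (N(ds, dx) - ds nu(dx)). *)
Definition levy_ito_decomposition (gamma sigma : R)
    (nu : {measure set (measurableTypeR R) -> \bar R}) (L W : R -> {RV P >-> R})
    (N : R.-ker Om ~> plane R) : Prop :=
  [/\ brownian_motion W,
      poisson_random_measure nu N,
      independent_of_measure W N,
      {ae P, forall w, forall A : set (plane R),
        measurable A -> A `<=` time_jump_space ->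
        N w A = counting [set t | 0 < t /\ A (t, jump (L ^~ w) t)]} &
      {ae P, forall w, forall t, 0 <= t ->
        \int[N w]_(z in `]0, t] `*` [set x | eps < `|x| <= 1]) z.2
        - t * \int[nu]_(x in [set x | eps < `|x| <= 1]) x
          @[eps --> 0^'+] -->
        L t w - gamma * t - sigma * W t w
        - \int[N w]_(z in `]0, t] `*` [set x | 1 < `|x|]) z.2}].

End processes.

Section stochastic_integral.
Context d (Om : measurableType d) (R : realType) (P : probability Om R).
Variables (sigma T : R) (nu : {measure set (measurableTypeR R) -> \bar R}).

(* m(dt, dx) = dt (sigma^2 delta_0(dx) + nu(dx)) on the plane; it is only
   evaluated on subsets of [0, T] x R. *)
Definition mm : {measure set (plane R) -> \bar R} :=
  (lebesgue_measure \x^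
    measure_add (mscale (NngNum (sqr_ge0 sigma)) \d_((0%R : R) : measurableTypeR R)) nu)%E.

Definition strip : set (plane R) := `[0, T] `*` setT.

(* f \in L^p([0, T] x R, m) *)
Definition in_Lp (p : nat) (f : plane R -> R) : Prop :=
  measurable_fun strip f /\
  (\int[mm]_(z in strip) (`|f z| ^+ p)%:E < +oo)%E.

Record elementary := Elementary {
  nW : nat;
  coefW : 'I_nW -> R;
  leftW : 'I_nW -> R;
  rightW : 'I_nW -> R;
  boundsW : forall i, 0 <= leftW i <= rightW i /\ rightW i <= T;
  nJ : nat;
  coefJ : 'I_nJ -> R;
  setJ : 'I_nJ -> set (plane R);
  measurable_setJ : forall i, measurable (setJ i);
  setJ_sub : forall i, setJ i `<=` `]0, T] `*` [set~ 0];
  setJ_fin : forall i, ((lebesgue_measure \x^ nu) (setJ i) < +oo)%E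
}.

Definition elementary_fun (e : elementary) (z : plane R) : R :=
  \sum_(i < nW e) coefW i * \1_(`]leftW i, rightW i] `*` [set 0]) z
  + \sum_(i < nJ e) coefJ i * \1_(setJ i) z.

(* \int e dM for M(dt, dx) = sigma dW_t delta_0(dx) + (N - dt nu)(dt, dx) *)
Definition elementary_integral (W : R -> {RV P >-> R})
    (N : R.-ker Om ~> plane R) (e : elementary) (w : Om) : R :=
  sigma * \sum_(i < nW e) coefW i * (W (rightW i) w - W (leftW i) w)
  + \sum_(i < nJ e) coefJ i *
      (fine (N w (setJ i)) - fine ((lebesgue_measure \x^ nu)%E (setJ i))).

(* X is a version of I_1(f)_T, the isometric extension to L^2(m) of the
   integral of elementary functions, which is defined up to null sets. *)
Definition is_I1 (W : R -> {RV P >-> R}) (N : R.-ker Om ~> plane R)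
    (f : plane R -> R) (X : {RV P >-> R}) : Prop :=
  exists e : nat -> elementary,
    (\int[mm]_(z in strip)
       ((elementary_fun (e k) z - f z) ^+ 2)%:E @[k --> \oo] --> 0)%E /\
    (\int[P]_w
       ((elementary_integral W N (e k) w - X w) ^+ 2)%:E @[k --> \oo] --> 0)%E.

End stochastic_integral.

Section cumulants.
Context d (Om : measurableType d) (R : realType) (P : probability Om R).

(* re + i im is the continuous logarithm, near 0, of the characteristic
   function u |-> E exp(i u X). *)
Definition log_characteristic_function (X : Om -> R) (re im : R -> R) : Prop :=
  [/\ re 0 = 0, im 0 = 0,
      (\forall u \near (0 : R),
        {for u, continuous re} /\ {for u, continuous im}) &
      (\forall u \near (0 : R),
        \int[P]_w cos (u * X w) = expR (re u) * cos (im u) /\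
        \int[P]_w sin (u * X w) = expR (re u) * sin (im u))].

Definition n_times_derivable (n : nat) (g : R -> R) : Prop :=
  forall m, (m < n)%N -> \forall u \near (0 : R), derivable (derive1n m g) u 1.

(* kappa_n = i^{-n} (d/du)^n log E exp(i u X) at u = 0.  As X is real, re is
   even and im is odd near 0, so that for even n only re contributes, with
   i^{-n} = (-1)^{n/2}, and for odd n only i im, with
   i^{-n} i = (-1)^{(n-1)/2}. *)
Definition is_cumulant (X : Om -> R) (n : nat) (kappa : R) : Prop :=
  exists re im : R -> R,
    [/\ log_characteristic_function X re im,
        n_times_derivable n re, n_times_derivable n im &
        kappa = (-1) ^+ n./2 * (if odd n then derive1n n im 0 else derive1n n re 0)].

End cumulants.

(* Main.v *)
(** The proof rests on the Stein-Mecke identity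
      E [X h(X)] = E [\int f(z) (h(X + f(z)) - h(X)) m(dz)] + v E [h'(X)],
    where the integral is over ]0, T] x R_0 and v is the integral of f^2 over
    ]0, T] x {0}, for every bounded Lipschitz h with bounded Lipschitz
    derivative.  For an elementary integrand X is a linear combination of
    independent Gaussian increments and centred Poisson variables, for which the
    identity is integration by parts and Mecke's formula; both sides are
    continuous along L^2 approximations.

    With h approximating x^n the identity becomes the recursion
    E X^(n+1) = \sum_k C(n, k) kappa_(k+1) E X^(n-k), which characterizes the Bell
    polynomials of the kappa_k.  With h = cos (u x) and h = sin (u x) it becomes a
    linear differential equation for the characteristic function, whose logarithm is
    thus - v u^2 / 2 + \int (exp (i u f) - 1 - i u f) dm; its derivatives at 0 are
    the cumulants. *)

From HB Require Import structures.
Require Import Defs.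
From mathcomp Require Import all_boot all_order all_algebra.
From mathcomp Require Import all_classical all_reals all_analysis.
From mathcomp Require Import measurable_realfun.
From mathcomp Require Import ring lra zify.

Set Implicit Arguments.
Unset Strict Implicit.
Unset Printing Implicit Defensive.

Import Order.TTheory GRing.Theory Num.Theory.
Import numFieldNormedType.Exports.

Local Open Scope classical_set_scope.
Local Open Scope ring_scope.

(** * Bell polynomials *)

(** Elementary integrals converge to X in L^2 only, so moments of order above two do not pass to the
    limit. The identity for bounded Lipschitz test functions does: its jump term is quadratic in f
    and its other terms grow at most linearly in X. The powers x^n have to be recovered afterwards,
    and finiteness of E |X|^N is not given. It is bootstrapped from the identity itself, two orders
    at a time, because a function that grows like |x|^(k+1) has a derivative that grows like |x|^k.
    Fatou's lemma removes the truncation from these bounds; dominated convergence then removes it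
    from the identity. At the elementary level the intervals and the jump sets may overlap. They are
    cut into disjoint cells, whose contributions are independent, and an operator attached to each
    contribution adds up along the sum. On the combinatorial side, Bell polynomials are compared
    with moments through uniqueness of the solution of the recursion, so that no partitions are
    enumerated. *)

Section bell_recursion.
Context {R : realType}.
Implicit Type x : nat -> R.

(** This is the Leibniz rule at 0 for M' = K' M, where M and K are the exponential generating
    functions of [B] and [x]. *)
Definition bell_rec_at x (B : nat -> R) (n : nat) : Prop :=
  B n.+1 = \sum_(k < n.+1) 'C(n, k)%:R * x k.+1 * B (n - k)%N.

(* [exp_factor x N i] truncates [exp (x i t^i / i!)]: [bell N x] is N! times the
   coefficient of t^N in [exp (\sum_i x i t^i / i!)], and the logarithmic
   derivative of this product gives the recursion. *)
Definition exp_factor x (N i : nat) : {poly R} :=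
  \sum_(j < N.+1) ((x i / i`!%:R) ^+ j / j`!%:R) *: 'X^(i * j).

Definition exp_prod x (N m : nat) : {poly R} := \prod_(i < m) exp_factor x N i.+1.

(** A truncated exponential satisfies E' = g' E up to its last term, whose degree [i.+1 * N] is at
    least N. *)
Lemma deriv_exp_factor x N i :
  deriv (exp_factor x N i.+1) = ((x i.+1 / i`!%:R) *: 'X^i) *
    (exp_factor x N i.+1
     - ((x i.+1 / i.+1`!%:R) ^+ N / N`!%:R) *: 'X^(i.+1 * N)).
Proof.
rewrite /exp_factor [in RHS]big_ord_recr/= addrK linear_sum big_ord_recl/=.
rewrite muln0 expr0 alg_polyC derivC add0r mulr_sumr; apply: eq_bigr => j _.
rewrite linearZ/= derivXn -scalerAl -scalerAr -(scaler_nat _ 'X^_) !scalerA -exprD.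
have -> : bump 0 j = j.+1 by [].
have -> : (i.+1 * j.+1).-1 = (i + i.+1 * j)%N by lia.
congr (_ *: _); rewrite exprS; set y := _ ^+ j; rewrite !factS !natrM.
have h1 k : k`!%:R != 0 :> R by rewrite pnatr_eq0 -lt0n fact_gt0.
have h2 k : k.+1%:R != 0 :> R by rewrite pnatr_eq0.
field.
by rewrite !h1 !nat1r !h2.
Qed.

(** [Q] collects the truncation errors. Only their divisibility by ['X^N] matters: they do not touch
    the coefficients below N. *)
Lemma deriv_exp_prod x N m : exists Q : {poly R},
  deriv (exp_prod x N m) =
    (\sum_(i < m) (x i.+1 / i`!%:R) *: 'X^i) * exp_prod x N m - 'X^N * Q.
Proof.
elim: m => [|m [Q IH]].
  by exists 0; rewrite /exp_prod !big_ord0 mul0r mulr0 subr0 derivC.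
set q := ((x m.+1 / m.+1`!%:R) ^+ N / N`!%:R).
set s := (x m.+1 / m`!%:R) *: 'X^m.
exists (Q * exp_factor x N m.+1 + exp_prod x N m * (s * (q *: 'X^(m * N)))).
have -> : exp_prod x N m.+1 = exp_prod x N m * exp_factor x N m.+1.
  by rewrite /exp_prod big_ord_recr.
rewrite derivM IH deriv_exp_factor big_ord_recr/= -/s -/q.
have -> : q *: 'X^(m.+1 * N) = 'X^N * (q *: 'X^(m * N)).
  by rewrite -scalerAr -exprD mulSn.
ring.
Qed.

Lemma coef_exp_prod_rec x N n : (n < N)%N ->
  bell_rec_at x (fun n => n`!%:R * (exp_prod x N N)`_n) n.
Proof.
move=> nN; rewrite /bell_rec_at.
have [Q HQ] := deriv_exp_prod x N N.
have := congr1 (fun p : {poly R} => p`_n) HQ.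
rewrite coef_deriv coefB coefXnM nN subr0 coefM => H.
have -> : n.+1`!%:R * (exp_prod x N N)`_n.+1 =
    n`!%:R * ((exp_prod x N N)`_n.+1 *+ n.+1).
  by rewrite factS natrM -mulr_natr; ring.
rewrite H mulr_sumr; apply: eq_bigr => k _.
have kn : (k <= n)%N by rewrite -ltnS.
have -> : (\sum_(i < N) (x i.+1 / i`!%:R) *: 'X^i)`_k = x k.+1 / k`!%:R.
  have kN : (k < N)%N by lia.
  rewrite coef_sum (bigD1 (Ordinal kN))//= coefZ coefXn eqxx mulr1 big1 ?addr0// => i.
  move=> ik; rewrite coefZ coefXn; case: eqP => [ki|]; last by rewrite mulr0.
  by case/eqP: ik; apply: val_inj.
rewrite -(bin_fact kn) !natrM.
have h1 : k`!%:R != 0 :> R by rewrite pnatr_eq0 -lt0n fact_gt0.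
by field.
Qed.

Lemma coef_exp_prod0 x N m : (exp_prod x N m)`_0 = 1.
Proof.
rewrite -horner_coef0 /exp_prod horner_prod big1// => i _.
rewrite horner_coef0 coef_sum (bigD1 ord0)//= big1 => [|j j0].
  by rewrite muln0 coefZ coefXn expr0 fact0 divr1 mulr1 addr0.
rewrite coefZ coefXn; case: eqP => [h|]; last by rewrite mulr0.
by move: j0; rewrite -val_eqE/=; lia.
Qed.

Lemma bell_rec_unique x (B C : nat -> R) N : B 0%N = C 0%N ->
  (forall n, (n < N)%N -> bell_rec_at x B n) ->
  (forall n, (n < N)%N -> bell_rec_at x C n) -> B N = C N.
Proof.
move=> BC0 HB HC.
suff: forall n, (n <= N)%N -> B n = C n by apply.
elim/ltn_ind => -[//|n] IH nN.
rewrite (HB n)// (HC n)//; apply: eq_bigr => k _.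
by rewrite IH//; lia.
Qed.

(** Distributing the product over its sums chooses one exponent [j i] per factor, which produces all
    multi-indices of weight N at once, whatever their number of parts. *)
Lemma coef_exp_prod x N : N`!%:R * (exp_prod x N N)`_N =
  \sum_(j : {ffun 'I_N -> 'I_N.+1} | (\sum_(i < N) i.+1 * j i)%N == N)
    N`!%:R * \prod_(i < N) ((x i.+1 / i.+1`!%:R) ^+ j i / (j i)`!%:R).
Proof.
rewrite /exp_prod bigA_distr_bigA/= coef_sum mulr_sumr [RHS]big_mkcond/=.
apply: eq_bigr => j _.
have -> : \prod_(i < N) (((x i.+1 / i.+1`!%:R) ^+ j i / (j i)`!%:R) *: 'X^(i.+1 * j i))
   = (\prod_(i < N) ((x i.+1 / i.+1`!%:R) ^+ j i / (j i)`!%:R)) *: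
     'X^(\sum_(i < N) i.+1 * j i) :> {poly R}.
  by rewrite scaler_prod; congr (_ *: _); rewrite expr_sum.
by rewrite coefZ coefXn eq_sym; case: eqP => _; rewrite ?mulr1// !mulr0.
Qed.

Lemma mult_entries N m (t : m.-tuple 'I_N.+1) i :
  mult (entries t) i.+1 = nth ord0 t i :> nat.
Proof.
rewrite /mult /entries/=; have [im|mi] := ltnP i m.
  by rewrite (nth_map ord0)// size_tuple.
by rewrite !nth_default// ?size_map size_tuple.
Qed.

Lemma bell_termE N m (t : m.-tuple 'I_N.+1) x :
  bell_coef N (entries t) * \prod_(1 <= i < m.+1) x i ^+ mult (entries t) i =
  N`!%:R * \prod_(i < m) ((x i.+1 / i.+1`!%:R) ^+ nth ord0 t i / (nth ord0 t i)`!%:R).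
Proof.
rewrite /bell_coef size_map size_tuple !big_add1/= !big_mkord.
rewrite -mulrA; congr (_ * _); rewrite natr_prod mulrC -prodf_div.
apply: eq_bigr => i _; rewrite mult_entries natrM natrX expr_div_n.
have h1 k : k`!%:R != 0 :> R by rewrite pnatr_eq0 -lt0n fact_gt0.
have h2 k n : k`!%:R ^+ n != 0 :> R by rewrite expf_neq0.
by field; rewrite ?h1 ?h2.
Qed.

(** [partial_bell] sums over tuples of length [(N - q).+1], the expanded product over functions on
    all of ['I_N]; the default [ord0] of [nth] fills the gap with zeros. *)
Definition pad_tuple N m (t : m.-tuple 'I_N.+1) : {ffun 'I_N -> 'I_N.+1} :=
  [ffun i : 'I_N => nth ord0 t i].

Lemma sum_pad_tuple N m (t : m.-tuple 'I_N.+1) (a : nat -> nat -> nat) :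
  (m <= N)%N -> (forall i, a i 0 = 0)%N ->
  (\sum_(i < N) a i (pad_tuple t i))%N =
  (\sum_(1 <= i < m.+1) a i.-1 (mult (entries t) i))%N.
Proof.
move=> mN a0; rewrite big_add1/=.
under eq_bigr do rewrite ffunE.
rewrite -(big_mkord xpredT (fun i => a i (nth ord0 t i))) (big_cat_nat (leq0n m) mN)/=.
rewrite [X in (_ + X)%N]big_nat [X in (_ + X)%N]big1 ?addn0 => [|i /andP[mi _]].
  by apply: eq_bigr => i _; rewrite mult_entries.
by rewrite nth_default ?size_tuple.
Qed.

Lemma prod_pad_tuple N m (t : m.-tuple 'I_N.+1) (a : nat -> nat -> R) :
  (m <= N)%N -> (forall i, a i 0%N = 1) ->
  \prod_(i < N) a i (pad_tuple t i) = \prod_(i < m) a i (nth ord0 t i).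
Proof.
move=> mN a0; under eq_bigr do rewrite ffunE.
rewrite -(big_mkord xpredT (fun i => a i (nth ord0 t i))) (big_cat_nat (leq0n m) mN)/=.
rewrite [X in (_ * X)]big_nat [X in _ * X]big1 ?mulr1 => [|i /andP[mi _]].
  by rewrite big_mkord.
by rewrite nth_default ?size_tuple.
Qed.

(** Subtracting the two constraints leaves N - q as the sum of [i * j i], with i counted from 0. A
    nonzero entry at an index beyond N - q would already exceed it. *)
Lemma multi_index_support N q (j : 'I_N -> nat) (i : 'I_N) :
  (\sum_(i < N) i.+1 * j i)%N = N -> (\sum_(i < N) j i)%N = q ->
  (N - q < i)%N -> j i = 0%N.
Proof.
move=> HN Hq Nqi; case Hj : (j i) => [//|k]; exfalso.
have : (\sum_(k < N | k != i) j k <= \sum_(k < N | k != i) k.+1 * j k)%N.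
  by apply: leq_sum => l _; rewrite mulSn leq_addr.
move: Hq; rewrite (bigD1 i)//= Hj => Hq; move: HN; rewrite (bigD1 i)//= Hj.
move: Hq; set A := bigop _ _ _; set B := bigop _ _ _.
nia.
Qed.

Lemma partial_bellE N q x : (0 < q)%N -> (q <= N)%N ->
  partial_bell N q x =
  \sum_(j : {ffun 'I_N -> 'I_N.+1} | ((\sum_(i < N) i.+1 * j i)%N == N) &&
      ((\sum_(i < N) j i)%N == q))
    N`!%:R * \prod_(i < N) ((x i.+1 / i.+1`!%:R) ^+ j i / (j i)`!%:R).
Proof.
move=> q0 qN; have mN : ((N - q).+1 <= N)%N by lia.
pose h' (j : {ffun 'I_N -> 'I_N.+1}) := [tuple j (widen_ord mN i) | i < (N - q).+1].
(* Padding is inverted by cutting to the first [(N - q).+1] entries; by [multi_index_support]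
   nothing is lost. *)
rewrite /partial_bell [RHS](reindex_onto (@pad_tuple N (N - q).+1) h'); last first.
  move=> j /andP[/eqP HN /eqP Hq]; apply/ffunP => i; rewrite ffunE.
  have [im|mi] := ltnP i (N - q).+1.
    rewrite -[X in nth _ _ X]/(nat_of_ord (Ordinal im)) -tnth_nth tnth_mktuple.
    by congr (j _); exact: val_inj.
  rewrite nth_default ?size_tuple//; apply/val_inj => /=.
  by rewrite (multi_index_support HN Hq).
apply: eq_big => [t|t _].
  have -> : h' (pad_tuple t) == t.
    apply/eqP/eq_from_tnth => i; rewrite tnth_mktuple ffunE/=.
    by rewrite (tnth_nth ord0).
  rewrite andbT andbC.
  rewrite (sum_pad_tuple t (a := fun i k => (i.+1 * k)%N))//; last by move=> ?; lia.
  rewrite (sum_pad_tuple t (a := fun i k => k))//.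
  congr ((_ == _) && _); apply: eq_big_nat => i /andP[i0 _].
  by rewrite prednK.
rewrite bell_termE.
rewrite (prod_pad_tuple t (a := fun i k => (x i.+1 / i.+1`!%:R) ^+ k / k`!%:R))//.
by move=> i; rewrite expr0 fact0 divr1.
Qed.

Lemma bellE N x : (0 < N)%N -> bell N x = N`!%:R * (exp_prod x N N)`_N.
Proof.
move=> N0; rewrite coef_exp_prod /bell.
rewrite (eq_big_nat _ _ (F2 := fun q =>
  \sum_(j : {ffun 'I_N -> 'I_N.+1} | (\sum_(i < N) i.+1 * j i)%N == N)
    if (\sum_(i < N) j i)%N == q then
    N`!%:R * \prod_(i < N) ((x i.+1 / i.+1`!%:R) ^+ j i / (j i)`!%:R) else 0));
  last first.
  by move=> q /andP[q0 qN]; rewrite partial_bellE// -big_mkcondr.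
rewrite exchange_big/=; apply: eq_bigr => j /eqP Hj.
(* A multi-index of weight N occurs for exactly one q, its number of parts s, and s lies between 1
   and N; the sum over q therefore collapses. *)
set s := (\sum_(i < N) j i)%N.
have s0 : (0 < s)%N.
  rewrite lt0n; apply/eqP => /eqP; rewrite sum_nat_eq0 => /forallP/= H.
  by move: N0; rewrite -Hj big1// => i _; have /eqP -> := H i; rewrite muln0.
have sN : (s < N.+1)%N.
  by rewrite ltnS -[X in (_ <= X)%N]Hj; apply: leq_sum => i _; rewrite mulSn leq_addr.
under eq_bigr do rewrite eq_sym.
by rewrite -big_mkcond/= big_nat1_eq s0 sN.
Qed.

(** [bell 0 x] is an empty sum, hence the restriction to positive N; the initial value 1 is the
    constant coefficient of the generating product. *)
Lemma bell_unique x (B : nat -> R) N : (0 < N)%N -> B 0%N = 1 ->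
  (forall n, (n < N)%N -> bell_rec_at x B n) -> B N = bell N x.
Proof.
move=> N0 B0 HB; rewrite bellE//.
apply: (bell_rec_unique (C := fun n => n`!%:R * (exp_prod x N N)`_n) _ HB) => [|n].
  by rewrite B0 coef_exp_prod0 mulr1.
exact: coef_exp_prod_rec.
Qed.

(** A positive first entry brings a factor [x 1 = 0], so only the tuples with head [ord0] survive,
    and these are given by their tails. *)
Lemma partial_bell_x1_eq0 n q x : x 1%N = 0 -> (0 < q)%N ->
  partial_bell n q x =
  \sum_(j : (n - q).-tuple 'I_n.+1 |
      ((\sum_(2 <= i < (n - q).+2) mult (0%N :: entries j) i)%N == q)
      && ((\sum_(2 <= i < (n - q).+2) i * mult (0%N :: entries j) i)%N == n))
    bell_coef n (0%N :: entries j)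
    * x 2 ^+ mult (0%N :: entries j) 2
    * \prod_(3 <= i < (n - q).+2) x i ^+ mult (0%N :: entries j) i.
Proof.
move=> x10 q0; rewrite /partial_bell; set m := (n - q)%N.
rewrite (bigID (fun t : m.+1.-tuple 'I_n.+1 => thead t == ord0))/=.
rewrite [X in _ + X]big1 ?addr0 => [|t /andP[_ t0]]; last first.
  rewrite big_ltn// x10 mult_entries -[nth _ _ _]/(nth ord0 t (@ord0 m)) -tnth_nth.
  by rewrite expr0n (_ : (tnth t ord0 == 0%N :> nat) = false) ?mul0r ?mulr0//; apply/negbTE.
rewrite (reindex_onto (fun j : m.-tuple 'I_n.+1 => [tuple of ord0 :: j])
  (fun t : m.+1.-tuple 'I_n.+1 => [tuple of behead t])); last first.
  by move=> t /andP[_ /eqP t0]; rewrite -t0 [RHS](tuple_eta t).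
have mE (j : m.-tuple 'I_n.+1) : entries [tuple of ord0 :: j] = 0%N :: entries j by [].
apply: eq_big => [j|j].
  rewrite mE (_ : thead _ == ord0) ?theadE// andbT.
  have -> : [tuple of behead [tuple of ord0 :: j]] == j by apply/eqP/val_inj.
  by rewrite andbT big_ltn// [X in _ && (X == n)]big_ltn// !add0n.
rewrite mE => /andP[/andP[/andP[/eqP Hq _] _] _].
rewrite -mulrA big_ltn//= expr0 mul1r; congr (_ * _).
rewrite big_ltn//.
(* The factor with index 2 can be split off only if the tail is nonempty; an empty tail would force
   q = 0. *)
have [m0|m0] := posnP m; last by rewrite !ltnS.
by move: q0; rewrite -Hq big_ltn// add0n [X in (0 < X)%N]big_geq ?m0.
Qed.

Lemma bell_x1_eq0 n x : x 1%N = 0 ->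
  bell n x = \sum_(1 <= q < n.+1)
  \sum_(j : (n - q).-tuple 'I_n.+1 |
      ((\sum_(2 <= i < (n - q).+2) mult (0%N :: entries j) i)%N == q)
      && ((\sum_(2 <= i < (n - q).+2) i * mult (0%N :: entries j) i)%N == n))
    bell_coef n (0%N :: entries j)
    * x 2 ^+ mult (0%N :: entries j) 2
    * \prod_(3 <= i < (n - q).+2) x i ^+ mult (0%N :: entries j) i.
Proof.
move=> x10; apply: eq_big_nat => q /andP[q0 _]; exact: partial_bell_x1_eq0.
Qed.

Definition gaussian_moment (v : R) (n : nat) : R :=
  if odd n then 0 else (double_factorial n.-1)%:R * v ^+ n./2.

Lemma double_factorialSS n : double_factorial n.+2 = (n.+2 * double_factorial n)%N.
Proof.
rewrite /double_factorial big_mkcond/= [in RHS]big_mkcond/=.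
rewrite big_nat_recr//= big_nat_recr//= negbK eqxx.
rewrite (_ : ~~ odd n == odd n = false) ?muln1 1?mulnC//; last by case: odd.
Qed.

(** With only the second variable nonzero, the recursion keeps the single term k = 1: the moment of
    order n + 1 is n v times the one of order n - 1. *)
Lemma gaussian_moment_rec v n :
  bell_rec_at (fun i => if i == 2%N then v else 0) (gaussian_moment v) n.
Proof.
case: n => [|n]; rewrite /bell_rec_at.
  by rewrite big_ord_recl big_ord0/= mulr0 mul0r addr0.
rewrite big_ord_recl/= mulr0 mul0r add0r big_ord_recl/= bin1 big1 ?addr0; last first.
  by move=> i _; rewrite mulr0 mul0r.
rewrite subn1/= /gaussian_moment/= negbK; case: ifP => on; first by rewrite mulr0.
case: n on => [|n on].
  rewrite /double_factorial/= => _.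
  rewrite (_ : \prod_(1 <= i < 2 | _) i = 1)%N; last by rewrite big_mkcond big_nat1.
  rewrite [X in _ = _ * (X%:R * _)]big_geq//; ring.
rewrite double_factorialSS natrM exprS /=; ring.
Qed.

Lemma bell_gaussian (v : R) n : (2 <= n)%N ->
  bell n (fun i => if i == 2%N then v else 0) = gaussian_moment v n.
Proof.
move=> n2; symmetry; apply: bell_unique; first by lia.
  by rewrite /gaussian_moment/= /double_factorial big_geq// mulr1.
by move=> k _; exact: gaussian_moment_rec.
Qed.

End bell_recursion.

(** * Real-valued integrals *)

Section real_integrals.
Context d (T : measurableType d) (R : realType) (mu : {measure set T -> \bar R}).
Variables (D : set T) (mD : measurable D).
Local Notation itg f := (mu.-integrable D (EFin \o f)).

Lemma rintegrable_measurable (f : T -> R) : itg f -> measurable_fun D f.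
Proof. by move=> /measurable_int/measurable_EFinP. Qed.

Lemma le_rintegrable (f g : T -> R) : measurable_fun D f -> itg g ->
  (forall x, D x -> `|f x| <= g x) -> itg f.
Proof.
move=> mf ig fg; apply: (le_integrable mD _ _ ig); first exact/measurable_EFinP.
by move=> x Dx; rewrite lee_fin (le_trans (fg _ Dx))// ler_norm.
Qed.

Lemma eq_rintegrable (f g : T -> R) : (forall x, D x -> f x = g x) -> itg f -> itg g.
Proof. by move=> fg; apply: eq_integrable => // x /set_mem Dx/=; rewrite fg. Qed.

Lemma rintegrableD (f g : T -> R) : itg f -> itg g -> itg (fun x => f x + g x).
Proof. by move=> h1 h2; have := integrableD mD h1 h2. Qed.

Lemma rintegrableB (f g : T -> R) : itg f -> itg g -> itg (fun x => f x - g x).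
Proof. by move=> h1 h2; have := integrableB mD h1 h2. Qed.

Lemma rintegrableZ (k : R) (f : T -> R) : itg f -> itg (fun x => k * f x).
Proof. by move=> h1; have := integrableZl mD k h1. Qed.

Lemma rintegrable_norm (f : T -> R) : itg f -> itg (fun x => `|f x|).
Proof. exact: integrable_norm. Qed.

Lemma rintegrable_sum I (s : seq I) (f : I -> T -> R) :
  (forall i, itg (f i)) -> itg (fun x => \sum_(i <- s) f i x).
Proof.
move=> h; elim: s => [|i s IH].
  by under [X in EFin \o X]eq_fun do rewrite big_nil; exact: integrable0.
by under [X in EFin \o X]eq_fun do rewrite big_cons; exact: rintegrableD.
Qed.

Lemma Rintegral_sum I (s : seq I) (f : I -> T -> R) :
  (forall i, itg (f i)) ->
  \int[mu]_(x in D) (\sum_(i <- s) f i x) = \sum_(i <- s) \int[mu]_(x in D) f i x.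
Proof.
move=> h; elim: s => [|i s IH].
  rewrite big_nil; under eq_Rintegral do rewrite big_nil.
  by rewrite Rintegral_cst// mul0r.
rewrite big_cons -IH -RintegralD//; last exact: rintegrable_sum.
by apply: eq_Rintegral => x _; rewrite big_cons.
Qed.

Lemma normr_Rintegral_le (f g : T -> R) : itg f -> itg g ->
  (forall x, D x -> `|f x| <= g x) ->
  `|\int[mu]_(x in D) f x| <= \int[mu]_(x in D) g x.
Proof.
move=> h1 h2 fg; apply: (le_trans (le_normr_Rintegral mD h1)).
exact: le_Rintegral (rintegrable_norm h1) h2 fg.
Qed.

Lemma ge0_rintegrable (f : T -> R) : measurable_fun D f ->
  (forall x, D x -> 0 <= f x) -> (\int[mu]_(x in D) (f x)%:E < +oo)%E -> itg f.
Proof.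
move=> mf f0 h; apply/integrableP; split; first exact/measurable_EFinP.
under eq_integral => x /set_mem Dx do rewrite /= ger0_norm ?f0//.
exact: h.
Qed.

Lemma EFin_Rintegral (f : T -> R) : itg f ->
  (\int[mu]_(x in D) f x)%:E = (\int[mu]_(x in D) (f x)%:E)%E.
Proof. by move=> h; rewrite fineK//; exact: integrable_fin_num. Qed.

Lemma rintegrableM_sqr (f g : T -> R) :
  measurable_fun D f -> measurable_fun D g ->
  itg (fun x => f x ^+ 2) -> itg (fun x => g x ^+ 2) -> itg (fun x => f x * g x).
Proof.
move=> mf mg h1 h2.
apply: (le_rintegrable (g := fun x => f x ^+ 2 + g x ^+ 2)).
- exact: measurable_funM.
- exact: rintegrableD.
- move=> x _; rewrite ler_norml; apply/andP; split; nra.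
Qed.

(** Integrating (|f| - s |g|)^2 >= 0 gives an inequality quadratic in s, which is then used at its
    optimum s = c / b. *)
Lemma Rintegral_cauchy_schwarz (f g : T -> R) :
  measurable_fun D f -> measurable_fun D g ->
  itg (fun x => f x ^+ 2) -> itg (fun x => g x ^+ 2) ->
  \int[mu]_(x in D) `|f x * g x| <=
  Num.sqrt (\int[mu]_(x in D) f x ^+ 2) * Num.sqrt (\int[mu]_(x in D) g x ^+ 2).
Proof.
move=> mf mg h1 h2.
set a := \int[mu]_(x in D) f x ^+ 2; set b := \int[mu]_(x in D) g x ^+ 2.
have fg := rintegrable_norm (rintegrableM_sqr mf mg h1 h2).
set c := Rintegral _ _ _.
have a0 : 0 <= a by apply: Rintegral_ge0 => x _; exact: sqr_ge0.
have b0 : 0 <= b by apply: Rintegral_ge0 => x _; exact: sqr_ge0.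
have c0 : 0 <= c by apply: Rintegral_ge0 => x _; exact: normr_ge0.
have H (s : R) : 2 * s * c <= a + s ^+ 2 * b.
  rewrite /c -RintegralZl// -(RintegralZl (s ^+ 2))// -RintegralD//; last exact: rintegrableZ.
  apply: le_Rintegral => //.
  - exact: rintegrableZ.
  - by apply: rintegrableD => //; exact: rintegrableZ.
  move=> x _; have := sqr_ge0 (`|f x| - s * `|g x|).
  have := real_normK (num_real (f x)); have := real_normK (num_real (g x)).
  rewrite normrM; nra.
rewrite -sqrtrM// -[leLHS]ger0_norm// -sqrtr_sqr ler_wsqrtr// -subr_le0.
have [b00|b_neq0] := eqVneq b 0.
  suff -> : c = 0 by rewrite b00 mulr0 expr0n/= subrr.
  apply/eqP/negP => /negP cn0; have cp : 0 < c by rewrite lt_neqAle eq_sym cn0 c0.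
  (* For b = 0 the inequality is 2 s c <= a, and this s is large enough to contradict it. *)
  have := H ((a + 1) / c); rewrite b00 mulr0 addr0 -mulrA mulfVK//; nra.
have bp : 0 < b by rewrite lt_neqAle eq_sym b_neq0 b0.
have := H (c / b); have : c = c / b * b by rewrite divfK.
move: (c / b) => s -> Hs; nra.
Qed.

Lemma dominated_cvg_Rintegral (f_ : nat -> T -> R) (f g : T -> R) :
  (forall n, measurable_fun D (f_ n)) -> itg g ->
  (forall n x, D x -> `|f_ n x| <= g x) ->
  (forall x, D x -> f_ n x @[n --> \oo] --> f x) ->
  itg f /\ \int[mu]_(x in D) f_ n x @[n --> \oo] --> \int[mu]_(x in D) f x.
Proof.
move=> mf ig fg ff.
have mf' : measurable_fun D f by apply: (measurable_fun_cvg mf).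
have [] := @dominated_convergence _ _ _ mu D mD (fun n => EFin \o f_ n) (EFin \o f)
   (EFin \o g).
- by move=> n; exact/measurable_EFinP.
- exact/measurable_EFinP.
- by apply: aeW => x Dx; apply/cvg_EFin; [exact: nearW|exact: ff].
- exact: ig.
- by apply: aeW => x n Dx; rewrite lee_fin fg.
move=> h1 _ h3; split => //.
apply: fine_cvg; rewrite fineK//; exact: integrable_fin_num.
Qed.

End real_integrals.

Section probability_integrals.
Context d (Om : measurableType d) (R : realType) (P : probability Om R).

Lemma Rintegral_probability_cst (c : R) : \int[P]_(w in setT) c = c.
Proof.
by rewrite Rintegral_cst// [X in fine X](_ : _ = 1%E) ?mulr1//; exact: probability_setT.
Qed.

Lemma rintegrable_cst (c : R) : P.-integrable setT (EFin \o (fun=> c)).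
Proof. exact: finite_measure_integrable_cst. Qed.

Lemma bounded_rintegrable (f : Om -> R) (K : R) : measurable_fun setT f ->
  (forall w, `|f w| <= K) -> P.-integrable setT (EFin \o f).
Proof.
move=> mf fK; apply: (le_rintegrable measurableT mf (rintegrable_cst K)).
by move=> w _.
Qed.

Lemma sqr_rintegrable (f : Om -> R) : measurable_fun setT f ->
  P.-integrable setT (EFin \o (fun w => f w ^+ 2)) -> P.-integrable setT (EFin \o f).
Proof.
move=> mf f2; apply: (le_rintegrable measurableT (g := fun w => 1 + f w ^+ 2)) => //.
  by apply: rintegrableD => //; exact: rintegrable_cst.
move=> w _; rewrite -(real_normK (num_real (f w))); have := normr_ge0 (f w); nra.
Qed.

Lemma Rintegral_norm_le_sqrt (f : Om -> R) : measurable_fun setT f ->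
  P.-integrable setT (EFin \o (fun w => f w ^+ 2)) ->
  \int[P]_w `|f w| <= Num.sqrt (\int[P]_w f w ^+ 2).
Proof.
move=> mf f2.
have := Rintegral_cauchy_schwarz measurableT mf (measurable_cst (1 : R)) f2 (rintegrable_cst (1 ^+ 2)).
rewrite (@eq_Rintegral _ _ _ _ _ (fun w => `|f w|)); last by move=> w _; rewrite mulr1.
by rewrite (Rintegral_probability_cst (1 ^+ 2)) expr1n sqrtr1 mulr1.
Qed.

End probability_integrals.

(** * The Stein identity *)

Section test_functions.
Context {R : realType}.
Implicit Types h : R -> R.

Definition bounded_lipschitz h := exists2 K : R, 0 <= K &
  (forall x, `|h x| <= K) /\ (forall x y, `|h x - h y| <= K * `|x - y|).

(** The Lipschitz bound on [h'] plays the role of a bounded second derivative, which is what makes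
    both sides of the identity continuous in L^2. *)
Definition test_pair h h' :=
  [/\ bounded_lipschitz h, bounded_lipschitz h' & forall x : R, is_derive x 1 h (h' x)].

Lemma bounded_derive_lipschitz (h h' : R -> R) (K : R) :
  (forall x : R, is_derive x 1 h (h' x)) -> (forall x, `|h' x| <= K) ->
  forall x y, `|h x - h y| <= K * `|x - y|.
Proof.
move=> dh hK x y; wlog xy : x y / y <= x => [H|].
  have [/H//|/ltW/H] := leP y x.
  by rewrite distrC [X in _ -> _ <= _ * X]distrC.
have ch : {within `[y, x], continuous h}.
  by apply: derivable_within_continuous => z _; exact: ex_derive.
have [c _ ->] := MVT_segment xy (fun z _ => dh z) ch.
by rewrite normrM ler_wpM2r.
Qed.

Lemma lipschitz_measurable (h : R -> R) (K : R) :
  (forall x y, `|h x - h y| <= K * `|x - y|) -> measurable_fun setT h.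
Proof.
move=> hK; apply: continuous_measurable_fun => x.
have K1 : 0 < `|K| + 1 by rewrite ltr_wpDl.
apply/cvgrPdist_le => /= e e0.
near=> y.
rewrite (le_trans (hK _ _))// (@le_trans _ _ ((`|K| + 1) * `|x - y|))//.
  by apply: ler_wpM2r => //; rewrite ler_wpDr// ler_norm.
rewrite mulrC -ler_pdivlMr//.
near: y; apply: cvgr_dist_le; first exact: cvg_id.
by rewrite divr_gt0.
Unshelve. all: by end_near. Qed.

Lemma bounded_lipschitz_measurable h : bounded_lipschitz h -> measurable_fun setT h.
Proof. by move=> [K _ [_ /lipschitz_measurable]]. Qed.

(** The last estimate bounds a second difference. Once multiplied by the integrand, it leaves only
    products of two square-integrable functions. *)
Lemma test_pair_increment h h' : test_pair h h' -> exists2 K : R, 0 <= K &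
  [/\ forall x, `|h x| <= K, forall x y, `|h x - h y| <= K * `|x - y|,
      forall x, `|h' x| <= K, forall x y, `|h' x - h' y| <= K * `|x - y| &
      forall x y a b, `|(h (x + a) - h x) - (h (y + b) - h y)|
                   <= K * `|a - b| + K * `|x - y| * `|b| ].
Proof.
move=> [[K1 K10 [hb hl]] [K2 K20 [h'b h'l]] dh].
have K12 : K1 <= K1 + K2 by rewrite lerDl.
have K21 : K2 <= K1 + K2 by rewrite lerDr.
exists (K1 + K2); first exact: addr_ge0.
split.
- by move=> x; exact: le_trans (hb x) _.
- by move=> x y; rewrite (le_trans (hl x y))// ler_wpM2r.
- by move=> x; exact: le_trans (h'b x) _.
- by move=> x y; rewrite (le_trans (h'l x y))// ler_wpM2r.
move=> x y a b.
(* The mean value theorem for the difference of two translates turns the Lipschitz bound on [h']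
   into a bound by |x - y| |b|. *)
pose g t := h (t + x) - h (t + y).
have dg (t : R) : is_derive t 1 g (h' (t + x) - h' (t + y)).
  have dhx z : is_derive t 1 (fun t => h (t + z)) (h' (t + z)).
    rewrite -[h' _]mulr1; apply: (@is_derive1_comp _ h (fun t => t + z)).
    by apply: is_derive_eq; rewrite addr0.
  exact: is_deriveB.
have gl := @bounded_derive_lipschitz g (fun t => h' (t + x) - h' (t + y)) (K2 * `|x - y|) dg.
have {}gl : `|g b - g 0| <= K2 * `|x - y| * `|b - 0|.
  apply: gl => t; apply: le_trans (h'l _ _) _.
  by rewrite opprD addrACA subrr add0r.
have -> : h (x + a) - h x - (h (y + b) - h y) =
   (h (x + a) - h (x + b)) + (g b - g 0).
  rewrite /g !add0r !(addrC b); ring.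
rewrite (le_trans (ler_normD _ _))// lerD//.
  apply: le_trans (hl _ _) _.
  by rewrite opprD addrACA subrr add0r ler_wpM2r.
apply: le_trans gl _; rewrite subr0.
by rewrite ler_wpM2r// ler_wpM2r.
Qed.

End test_functions.

Lemma cvg_to_0_le {R : realType} (a_ u_ : nat -> R) (a : R) :
  (forall n, `|a_ n - a| <= u_ n) -> u_ n @[n --> \oo] --> 0 ->
  a_ n @[n --> \oo] --> a.
Proof.
move=> au u0; apply/cvgrPdist_le => /= e e0.
near=> n; rewrite distrC (le_trans (au n))//.
by near: n; exact: (cvgr_le _ u0).
Unshelve. all: by end_near. Qed.

Section stein.
Context d (Om : measurableType d) (R : realType) (P : probability Om R).
Context dz (Z : measurableType dz) (m : {measure set Z -> \bar R}).
Variables (D : set Z) (mD : measurable D).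
Implicit Types (f e : Z -> R) (X : Om -> R) (h : R -> R).

(** The factor [f z] together with the increment of a Lipschitz [h] makes the integrand O(f^2): it
    is integrable for square-integrable [f], even if [f] itself is not integrable. *)
Definition jump_increment f h (x : R) : R :=
  \int[m]_(z in D) (f z * (h (x + f z) - h x)).

Definition stein_identity X f (v : R) := forall h h', test_pair h h' ->
  \int[P]_w (X w * h (X w)) =
  \int[P]_w jump_increment f h (X w) + v * \int[P]_w h' (X w).

Definition sqr_integrable f :=
  measurable_fun D f /\ m.-integrable D (EFin \o (fun z => f z ^+ 2)).

Lemma sqr_integrableM f e : sqr_integrable f -> sqr_integrable e ->
  m.-integrable D (EFin \o (fun z => f z * e z)).
Proof. by move=> [? ?] [? ?]; exact: rintegrableM_sqr. Qed.

Lemma sqr_integrableB f e : sqr_integrable f -> sqr_integrable e ->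
  sqr_integrable (fun z => f z - e z).
Proof.
move=> [mf f2] [me e2]; split; first exact: measurable_funB.
apply: (le_rintegrable mD (g := fun z => 2 * f z ^+ 2 + 2 * e z ^+ 2)).
- by apply: measurable_funX; exact: measurable_funB.
- by apply: rintegrableD => //; exact: rintegrableZ.
- move=> z _; rewrite ger0_norm ?sqr_ge0//; have := sqr_ge0 (f z + e z); nra.
Qed.

Lemma jump_integrable f h h' x : sqr_integrable f -> test_pair h h' ->
  m.-integrable D (EFin \o (fun z => f z * (h (x + f z) - h x))).
Proof.
move=> [mf f2] hh; have [K K0 [hb hl _ _ _]] := test_pair_increment hh.
have mh : measurable_fun setT h by have [/bounded_lipschitz_measurable] := hh.
apply: (le_rintegrable mD (g := fun z => K * f z ^+ 2)).
- apply: measurable_funM => //; apply: measurable_funB => //.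
  by apply: measurableT_comp => //; exact: measurable_funD.
- exact: rintegrableZ.
- move=> z _; rewrite normrM (le_trans (ler_wpM2l _ (hl _ _)))//.
  by rewrite addrAC subrr add0r mulrCA -normrM -expr2 ger0_norm ?sqr_ge0.
Qed.

(** One estimate covers a change of the integrand and a change of the point: the first gives
    convergence along approximations, the case [e = f] gives Lipschitz continuity in x. *)
Lemma jump_increment_dist h h' : test_pair h h' ->
  exists2 K : R, 0 <= K & forall f e x y, sqr_integrable f -> sqr_integrable e ->
  `|jump_increment e h x - jump_increment f h y| <=
   K * (\int[m]_(z in D) (e z - f z) ^+ 2 + 2 * \int[m]_(z in D) `|(e z - f z) * f z|)
   + K * `|x - y| * \int[m]_(z in D) f z ^+ 2.
Proof.
move=> hh; have [K K0 [hb hl _ _ hd]] := test_pair_increment hh.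
exists K => // f e x y sf se; have [mf f2] := sf; have [me e2] := se.
have sef := sqr_integrableB se sf; have [mef ef2] := sef.
have i1 := rintegrable_norm (sqr_integrableM sef sf).
rewrite /jump_increment -RintegralB//; [|exact: jump_integrable hh..].
rewrite -(RintegralZl 2)// -RintegralD//; last exact: rintegrableZ.
rewrite -RintegralZl//; last by apply: rintegrableD => //; exact: rintegrableZ.
rewrite -RintegralZl// -RintegralD//; first last.
- exact: rintegrableZ.
- by apply: rintegrableZ => //; apply: rintegrableD => //; exact: rintegrableZ.
apply: normr_Rintegral_le => //.
- by apply: rintegrableB => //; exact: jump_integrable hh.
- apply: rintegrableD => //; last exact: rintegrableZ.
  by apply: rintegrableZ => //; apply: rintegrableD => //; exact: rintegrableZ.
(* The change of the prefactor is separated from the change of the increment; the latter is the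
   second difference of [test_pair_increment]. *)
move=> z _; have -> : e z * (h (x + e z) - h x) - f z * (h (y + f z) - h y) =
  (e z - f z) * (h (x + e z) - h x) +
  f z * ((h (x + e z) - h x) - (h (y + f z) - h y)) by ring.
have h1 : `|h (x + e z) - h x| <= K * (`|e z - f z| + `|f z|).
  apply: le_trans (hl _ _) _; rewrite addrAC subrr add0r.
  by apply: ler_wpM2l => //; rewrite -{1}(subrK (f z) (e z)) ler_normD.
rewrite (le_trans (ler_normD _ _))// !normrM.
have h2 := hd x y (e z) (f z).
have n0 := normr_ge0 (e z - f z); have n1 := normr_ge0 (f z).
have n2 := ler_wpM2l n0 h1; have n3 := ler_wpM2l n1 h2.
rewrite -(real_normK (num_real (e z - f z))) -(real_normK (num_real (f z))).
lra.
Qed.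

Lemma jump_increment_bounded_lipschitz f h h' : sqr_integrable f ->
  test_pair h h' -> bounded_lipschitz (jump_increment f h).
Proof.
move=> sf hh; have [K K0 [hb hl _ _ _]] := test_pair_increment hh.
have [K' K'0 hd] := jump_increment_dist hh.
pose F := \int[m]_(z in D) f z ^+ 2.
have F0 : 0 <= F by apply: Rintegral_ge0 => z _; exact: sqr_ge0.
have [mf f2] := sf.
exists (K * F + K' * F); first by rewrite addr_ge0// mulr_ge0.
split=> [x|x y].
  apply: (@le_trans _ _ (K * F)); last by rewrite lerDl mulr_ge0.
  rewrite -RintegralZl//; apply: normr_Rintegral_le => //.
  - exact: jump_integrable hh.
  - exact: rintegrableZ.
  move=> z _; rewrite normrM (le_trans (ler_wpM2l _ (hl _ _)))//.
  by rewrite addrAC subrr add0r mulrCA -normrM -expr2 ger0_norm ?sqr_ge0.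
apply: (@le_trans _ _ (K' * F * `|x - y|)); last first.
  by rewrite ler_wpM2r// lerDr mulr_ge0.
apply: le_trans (hd _ _ x y sf sf) _.
rewrite (@eq_Rintegral _ _ _ _ _ (fun=> 0)) => [|z _]; last by rewrite subrr expr0n.
rewrite (@eq_Rintegral _ _ _ _ _ (fun=> 0) (fun z => `|(f z - f z) * f z|)) => [|z _]; last first.
  by rewrite subrr mul0r normr0.
by rewrite !Rintegral_cst// !(mul0r, mulr0, add0r) mulrAC.
Qed.

(** Each of the three terms is continuous along L^2 convergence. Cauchy-Schwarz treats X h(X) and
    the dependence of the jump term on the integrand; elsewhere Lipschitz continuity reduces the
    error to E |X_n - X|. *)
Lemma stein_limit (X_ : nat -> Om -> R) (e_ : nat -> Z -> R) (v_ : nat -> R)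
    (X : Om -> R) f (v : R) :
  (forall n, measurable_fun setT (X_ n)) -> measurable_fun setT X ->
  (forall n, P.-integrable setT (EFin \o (fun w => X_ n w ^+ 2))) ->
  P.-integrable setT (EFin \o (fun w => X w ^+ 2)) ->
  (forall n, sqr_integrable (e_ n)) -> sqr_integrable f ->
  \int[P]_w (X_ n w - X w) ^+ 2 @[n --> \oo] --> 0 ->
  \int[m]_(z in D) (e_ n z - f z) ^+ 2 @[n --> \oo] --> 0 ->
  v_ n @[n --> \oo] --> v ->
  (forall n, stein_identity (X_ n) (e_ n) (v_ n)) -> stein_identity X f v.
Proof.
move=> mX_ mX X_2 X2 e_2 f2 XX ef vv hS h h' hh.
have [K K0 [hb hl h'b h'l _]] := test_pair_increment hh.
have [mh mh'] : measurable_fun setT h /\ measurable_fun setT h'.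
  by case: hh => /bounded_lipschitz_measurable ? /bounded_lipschitz_measurable ?.
pose dl n := Num.sqrt (\int[P]_w (X_ n w - X w) ^+ 2).
pose et n := Num.sqrt (\int[m]_(z in D) (e_ n z - f z) ^+ 2).
have dl0 : dl n @[n --> \oo] --> 0.
  by rewrite -[0](@sqrtr0 R); apply: continuous_cvg => //; exact: sqrt_continuous.
have et0 : et n @[n --> \oo] --> 0.
  by rewrite -[0](@sqrtr0 R); apply: continuous_cvg => //; exact: sqrt_continuous.
have mXX n : measurable_fun setT (fun w => X_ n w - X w) by exact: measurable_funB.
have sXX n : P.-integrable setT (EFin \o (fun w => (X_ n w - X w) ^+ 2)).
  apply: (le_rintegrable measurableT (g := fun z => 2 * X_ n z ^+ 2 + 2 * X z ^+ 2)).
  - exact: measurable_funX.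
  - by apply: rintegrableD => //; exact: rintegrableZ.
  - move=> z _; rewrite ger0_norm ?sqr_ge0//; have := sqr_ge0 (X_ n z + X z); nra.
have L1 n : \int[P]_w `|X_ n w - X w| <= dl n by exact: Rintegral_norm_le_sqrt.
have iXX n : P.-integrable setT (EFin \o (fun w => `|X_ n w - X w|)).
  exact: rintegrable_norm (sqr_rintegrable (mXX n) (sXX n)).
have iXh (Y : Om -> R) : measurable_fun setT Y -> P.-integrable setT (EFin \o (fun w => Y w ^+ 2)) ->
    P.-integrable setT (EFin \o (fun w => Y w * h (Y w))).
  move=> mY Y2; apply: (le_rintegrable measurableT (g := fun w => Y w ^+ 2 + K ^+ 2)).
  - by apply: measurable_funM => //; exact: measurableT_comp.
  - by apply: rintegrableD => //; exact: finite_measure_integrable_cst.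
  - move=> w _; rewrite normrM; have := hb (Y w).
    rewrite -(real_normK (num_real (Y w))); have := normr_ge0 (h (Y w)).
    have := normr_ge0 (Y w); have := sqr_ge0 (`|Y w| - K).
    move: (`|Y w|) (`|h (Y w)|) => a b; nra.
have ih' (Y : Om -> R) : measurable_fun setT Y -> P.-integrable setT (EFin \o (fun w => h' (Y w))).
  move=> mY; apply: (le_rintegrable measurableT (g := fun w => K)).
  - exact: measurableT_comp.
  - exact: finite_measure_integrable_cst.
  - by move=> w _.
have cA : \int[P]_w (X_ n w * h (X_ n w)) @[n --> \oo] --> \int[P]_w (X w * h (X w)).
  apply: (@cvg_to_0_le _ _ (fun n => K * dl n + K * (dl n * Num.sqrt (\int[P]_w X w ^+ 2)))).
    move=> n; rewrite -RintegralB//; [|exact: iXh..].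
    have iM := rintegrable_norm (rintegrableM_sqr measurableT (mXX n) mX (sXX n) X2).
    apply: (@le_trans _ _ (\int[P]_w (K * `|X_ n w - X w| + K * `|(X_ n w - X w) * X w|))).
      apply: normr_Rintegral_le => //.
      - by apply: rintegrableB => //; exact: iXh.
      - by apply: rintegrableD => //; exact: rintegrableZ.
      move=> w _; have -> : X_ n w * h (X_ n w) - X w * h (X w) =
        (X_ n w - X w) * h (X_ n w) + X w * (h (X_ n w) - h (X w)) by ring.
      rewrite (le_trans (ler_normD _ _))// !normrM.
      have n0 := normr_ge0 (X w); have n1 := normr_ge0 (X_ n w - X w).
      have := ler_wpM2l n0 (hl (X_ n w) (X w)); have := ler_wpM2l n1 (hb (X_ n w)); lra.
    rewrite RintegralD//; [|exact: rintegrableZ..].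
    rewrite !RintegralZl// lerD// ler_wpM2l//.
    exact: Rintegral_cauchy_schwarz.
  rewrite [X in _ --> X](_ : 0 = K * 0 + K * (0 * Num.sqrt (\int[P]_w X w ^+ 2))); last by ring.
  apply: cvgD; first by apply: cvgM => //; exact: cvg_cst.
  by apply: cvgM; [exact: cvg_cst|apply: cvgM => //; exact: cvg_cst].
have cC : v_ n * \int[P]_w h' (X_ n w) @[n --> \oo] --> v * \int[P]_w h' (X w).
  apply: cvgM => //; apply: (@cvg_to_0_le _ _ (fun n => K * dl n)) => [n|].
    rewrite -RintegralB//; [|exact: ih'..].
    apply: (@le_trans _ _ (\int[P]_w (K * `|X_ n w - X w|))); last first.
      by rewrite RintegralZl// ler_wpM2l.
    apply: normr_Rintegral_le => //; last exact: rintegrableZ.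
    by apply: rintegrableB => //; exact: ih'.
  by rewrite -(mulr0 K); apply: cvgM => //; exact: cvg_cst.
have cB : \int[P]_w jump_increment (e_ n) h (X_ n w) @[n --> \oo] -->
    \int[P]_w jump_increment f h (X w).
  have [K' K'0 hd] := jump_increment_dist hh.
  pose F := \int[m]_(z in D) f z ^+ 2.
  have iJ e Y : sqr_integrable e -> measurable_fun setT Y ->
      P.-integrable setT (EFin \o (fun w => jump_increment e h (Y w))).
    move=> se mY; have [C _ [Cb Cl]] := jump_increment_bounded_lipschitz se hh.
    apply: (@bounded_rintegrable _ _ _ _ _ C) => //.
    exact: measurableT_comp (lipschitz_measurable Cl) mY.
  have sef n := sqr_integrableB (e_2 n) f2.
  apply: (@cvg_to_0_le _ _ (fun n => K' * (\int[m]_(z in D) (e_ n z - f z) ^+ 2 +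
      2 * (et n * Num.sqrt F)) + K' * (dl n * F))).
    move=> n; rewrite -RintegralB//; [|exact: iJ..].
    set c := \int[m]_(z in D) (e_ n z - f z) ^+ 2.
    set r := \int[m]_(z in D) `|(e_ n z - f z) * f z|.
    apply: (@le_trans _ _ (\int[P]_w (K' * (c + 2 * r) + K' * F * `|X_ n w - X w|))).
      apply: normr_Rintegral_le => //.
      - by apply: rintegrableB => //; exact: iJ.
      - by apply: rintegrableD => //; [exact: rintegrable_cst|exact: rintegrableZ].
      by move=> w _; apply: le_trans (hd _ _ _ _ f2 (e_2 n)) _; rewrite [_ * F]mulrAC.
    rewrite RintegralD//; [|exact: rintegrable_cst|exact: rintegrableZ].
    rewrite Rintegral_probability_cst RintegralZl//; apply: lerD.
      rewrite ler_wpM2l// lerD2l ler_wpM2l//.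
      by have [? ?] := sef n; have [? ?] := f2; exact: Rintegral_cauchy_schwarz.
    rewrite -mulrA ler_wpM2l// mulrC ler_wpM2r//.
    by apply: Rintegral_ge0 => z _; exact: sqr_ge0.
  rewrite [X in _ --> X](_ : 0 = K' * (0 + 2 * (0 * Num.sqrt F)) + K' * (0 * F)); last by ring.
  apply: cvgD; apply: cvgM; [exact: cvg_cst| |exact: cvg_cst|].
    apply: cvgD => //; apply: cvgM; first exact: cvg_cst.
    by apply: cvgM => //; exact: cvg_cst.
  by apply: cvgM => //; exact: cvg_cst.
have cBC : \int[P]_w jump_increment (e_ n) h (X_ n w) + v_ n * \int[P]_w h' (X_ n w)
    @[n --> \oo] --> \int[P]_w jump_increment f h (X w) + v * \int[P]_w h' (X w).
  exact: cvgD.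
rewrite (_ : (fun n => _) = (fun n => \int[P]_w jump_increment (e_ n) h (X_ n w) +
    v_ n * \int[P]_w h' (X_ n w))) in cA.
  by rewrite -(cvg_lim _ cA)// (cvg_lim _ cBC)//.
by apply/funext => n; exact: hS hh.
Qed.

End stein.

(** * Moments from the Stein identity *)

Section derivatives.
Context {R : realType}.
Implicit Types f g : R -> R.

Lemma derive_mul f g (x a b : R) : is_derive x 1 f a -> is_derive x 1 g b ->
  is_derive x 1 (fun y => f y * g y) (a * g x + f x * b).
Proof.
move=> fa gb; have := is_deriveM fa gb.
by rewrite -![_ *: _]/(_ * _) addrC (mulrC (g x)).
Qed.

Lemma derive_exp f n (x a : R) : is_derive x 1 f a ->
  is_derive x 1 (fun y => f y ^+ n) (n%:R * f x ^+ n.-1 * a).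
Proof. by move=> fa; have := is_deriveX n fa; rewrite fctE. Qed.

Lemma derive_ext f g (x a b : R) : is_derive x 1 f a -> f =1 g -> a = b ->
  is_derive x 1 g b.
Proof. by move=> fa /funext <- <-. Qed.

End derivatives.

(** * Bounded smooth truncations of powers and of absolute powers *)

Section truncation.
Context {R : realType}.
Implicit Types (f g : R -> R) (eps x y : R).

Lemma bounded_lipschitz_cst (c : R) : bounded_lipschitz (fun=> c).
Proof.
by exists `|c| => //; split => // x y; rewrite subrr normr0 mulr_ge0.
Qed.

Lemma bounded_lipschitzD f g : bounded_lipschitz f -> bounded_lipschitz g ->
  bounded_lipschitz (fun x => f x + g x).
Proof.
move=> [K K0 [fb fl]] [L L0 [gb gl]]; exists (K + L); first exact: addr_ge0.
split=> [x|x y]; first by rewrite (le_trans (ler_normD _ _))// lerD.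
by rewrite opprD addrACA (le_trans (ler_normD _ _))// mulrDl lerD.
Qed.

Lemma bounded_lipschitzM f g : bounded_lipschitz f -> bounded_lipschitz g ->
  bounded_lipschitz (fun x => f x * g x).
Proof.
move=> [K K0 [fb fl]] [L L0 [gb gl]].
exists (K * L + K * L); first by rewrite addr_ge0// mulr_ge0.
split=> [x|x y].
  apply: (@le_trans _ _ (K * L)); last by rewrite lerDl mulr_ge0.
  by rewrite normrM ler_pM.
have -> : f x * g x - f y * g y = (f x - f y) * g x + f y * (g x - g y) by ring.
apply: (le_trans (ler_normD _ _)); rewrite [leRHS]mulrDl !normrM; apply: lerD.
  by rewrite mulrAC ler_pM.
by rewrite -mulrA ler_pM.
Qed.

Lemma bounded_lipschitzX f n : bounded_lipschitz f ->
  bounded_lipschitz (fun x => f x ^+ n).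
Proof.
move=> bf; elim: n => [|n IH].
  by under eq_fun do rewrite expr0; exact: bounded_lipschitz_cst.
by under eq_fun do rewrite exprS; exact: bounded_lipschitzM.
Qed.

(* Powers of [trunc eps] are admissible test functions, and tend to the powers
   of x as eps tends to 0. *)
Definition damp eps x : R := (1 + eps * x ^+ 2)^-1.
Definition trunc eps x : R := x * damp eps x.
(** Since [eps * x ^+ 2 * damp eps x = 1 - damp eps x], the derivative (1 - eps x^2) damp^2 is a
    polynomial in [damp], and so inherits its bounds and its Lipschitz property. *)
Definition dtrunc eps x : R := 2 * damp eps x ^+ 2 - damp eps x.

Section positive_eps.
Variable eps : R.
Hypothesis eps0 : 0 < eps.

Lemma damp_den_gt0 x : 0 < 1 + eps * x ^+ 2.
Proof. by rewrite ltr_wpDr// mulr_ge0 ?sqr_ge0// ltW. Qed.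

Lemma damp_gt0 x : 0 < damp eps x.
Proof. by rewrite invr_gt0 damp_den_gt0. Qed.

Lemma damp_le1 x : damp eps x <= 1.
Proof. by rewrite invf_le1 ?damp_den_gt0// lerDl mulr_ge0 ?sqr_ge0// ltW. Qed.

Lemma dampK x : damp eps x * (1 + eps * x ^+ 2) = 1.
Proof. by rewrite mulVf// gt_eqF ?damp_den_gt0. Qed.

Lemma trunc_norm x : `|trunc eps x| <= `|x|.
Proof.
by rewrite normrM (gtr0_norm (damp_gt0 x)) ler_piMr// damp_le1.
Qed.

Lemma dtrunc_norm x : `|dtrunc eps x| <= 1.
Proof.
have := damp_gt0 x; have := damp_le1 x; rewrite /dtrunc ler_norml.
move: (damp _ _) => r r1 r0; apply/andP; split; nra.
Qed.

Lemma bounded_lipschitz_damp : bounded_lipschitz (damp eps).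
Proof.
exists (1 + eps); first by rewrite addr_ge0// ltW.
split=> [x|x y].
  by rewrite (gtr0_norm (damp_gt0 x)) (le_trans (damp_le1 x))// lerDl ltW.
have := damp_gt0 x; have := damp_gt0 y; have := dampK x; have := dampK y.
set r := damp eps x; set s := damp eps y => hs hr s0 r0.
(* Each inverse is multiplied by the other one times its denominator, that is by 1; this exhibits
   the factor y - x. *)
have -> : r - s = (y - x) * (eps * (x + y) * r * s).
  rewrite -{1}[r]mulr1 -{1}hs -[X in _ - X]mulr1 -[X in _ - _ * X]hr; ring.
rewrite normrM distrC mulrC ler_wpM2r//.
rewrite !normrM (gtr0_norm eps0) (gtr0_norm r0) (gtr0_norm s0).
have xy : `|x + y| <= 1 + (x ^+ 2 + y ^+ 2) / 2.
  have := sqr_ge0 (x - 1); have := sqr_ge0 (x + 1).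
  have := sqr_ge0 (y - 1); have := sqr_ge0 (y + 1).
  by rewrite ler_norml => *; apply/andP; split; nra.
have h : eps * `|x + y| <= (1 + eps) * ((1 + eps * x ^+ 2) * (1 + eps * y ^+ 2)).
  have := ler_wpM2l (ltW eps0) xy; have := sqr_ge0 x; have := sqr_ge0 y.
  move: (x ^+ 2) (y ^+ 2) => a b b0 a0 h.
  have ea : 0 <= eps * a by rewrite mulr_ge0// ltW.
  have eb : 0 <= eps * b by rewrite mulr_ge0// ltW.
  have eab := mulr_ge0 ea eb; have e1 := ltW eps0.
  have := mulr_ge0 e1 ea; have := mulr_ge0 e1 eb; have := mulr_ge0 e1 eab.
  lra.
have -> : 1 + eps =
    (1 + eps) * ((1 + eps * x ^+ 2) * (1 + eps * y ^+ 2)) * r * s.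
  transitivity ((1 + eps) * (r * (1 + eps * x ^+ 2)) * (s * (1 + eps * y ^+ 2))).
    by rewrite hr hs !mulr1.
  ring.
by rewrite !ler_wpM2r// ltW.
Qed.

Lemma bounded_lipschitz_trunc : bounded_lipschitz (trunc eps).
Proof.
exists (1 + eps^-1); first by rewrite addr_ge0// invr_ge0 ltW.
split=> [x|x y].
  have := damp_gt0 x; have := dampK x; rewrite /trunc.
  set r := damp eps x => hr r0.
  have h : `|x| <= (1 + eps^-1) * (1 + eps * x ^+ 2).
    have -> : (1 + eps^-1) * (1 + eps * x ^+ 2) = 1 + eps^-1 + eps * x ^+ 2 + x ^+ 2.
      by field; rewrite gt_eqF.
    have : 0 <= eps * x ^+ 2 by rewrite mulr_ge0 ?sqr_ge0// ltW.
    have : 0 < eps^-1 by rewrite invr_gt0.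
    by have := sqr_ge0 (x - 1); have := sqr_ge0 (x + 1);
      rewrite ler_norml => *; apply/andP; split; nra.
  rewrite normrM (gtr0_norm r0); apply: le_trans (ler_wpM2r (ltW r0) h) _.
  by rewrite -mulrA [X in _ * X]mulrC hr mulr1.
have := damp_gt0 x; have := damp_gt0 y; have := dampK x; have := dampK y.
rewrite /trunc; set r := damp eps x; set s := damp eps y => hs hr s0 r0.
have -> : x * r - y * s = (x - y) * ((1 - eps * x * y) * (r * s)).
  rewrite -{1}[r]mulr1 -{1}hs -[X in _ - _ * X]mulr1 -[X in _ - _ * (_ * X)]hr; ring.
rewrite normrM mulrC ler_wpM2r//.
apply: (@le_trans _ _ 1); last by rewrite lerDl invr_ge0 ltW.
rewrite normrM (gtr0_norm (mulr_gt0 r0 s0)).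
(* With 1 written as both denominators times both inverses, it remains to bound |1 - eps x y| by the
   product of the denominators, a matter of nonnegative squares. *)
have e1 : 1 = (1 + eps * x ^+ 2) * (1 + eps * y ^+ 2) * (r * s) :> R.
  transitivity ((r * (1 + eps * x ^+ 2)) * (s * (1 + eps * y ^+ 2))).
    by rewrite hr hs !mulr1.
  ring.
rewrite [leRHS]e1; apply: ler_wpM2r; first by rewrite ltW// mulr_gt0.
have := mulr_ge0 (ltW eps0) (sqr_ge0 (x - y)).
have := mulr_ge0 (ltW eps0) (sqr_ge0 (x + y)).
have := sqr_ge0 (eps * x * y).
by rewrite ler_norml => *; apply/andP; split; nra.
Qed.

Lemma derive_trunc x : is_derive x 1 (trunc eps) (dtrunc eps x).
Proof.
have d1 : is_derive x 1 (fun y => 1 + eps * y ^+ 2) (2 * eps * x).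
  have dx := derive_exp 2 (@is_derive_id _ _ x (1 : R)).
  apply: (derive_ext (is_deriveD (is_derive_cst (1 : R) x 1)
    (derive_mul (is_derive_cst eps x 1) dx))) => //.
  by rewrite mul0r !add0r /=; ring.
have d2 := @is_deriveV _ (fun y => 1 + eps * y ^+ 2) _ _ _ (lt0r_neq0 (damp_den_gt0 x)) d1.
apply: (derive_ext (derive_mul (@is_derive_id _ _ x (1 : R)) d2)) => //.
rewrite -[_ *: _]/(_ * _) -exprVn -/(damp eps x) /dtrunc.
have := dampK x; set r := damp eps x => hr.
have -> : x * (- r ^+ 2 * (2 * eps * x)) = 2 * r ^+ 2 - 2 * r * (r * (1 + eps * x ^+ 2)).
  by ring.
by rewrite hr; ring.
Qed.

Lemma bounded_lipschitz_dtrunc : bounded_lipschitz (dtrunc eps).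
Proof.
have bd := bounded_lipschitz_damp.
have := bounded_lipschitzD
  (bounded_lipschitzM (bounded_lipschitz_cst 2) (bounded_lipschitzX 2 bd))
  (bounded_lipschitzM (bounded_lipschitz_cst (-1)) bd).
by congr bounded_lipschitz; apply/funext => x; rewrite mulN1r.
Qed.

Lemma test_pair_truncX n : test_pair (fun x => trunc eps x ^+ n)
  (fun x => n%:R * trunc eps x ^+ n.-1 * dtrunc eps x).
Proof.
split; first exact: bounded_lipschitzX bounded_lipschitz_trunc.
  apply: bounded_lipschitzM bounded_lipschitz_dtrunc.
  apply: bounded_lipschitzM (bounded_lipschitz_cst _) _.
  exact: bounded_lipschitzX bounded_lipschitz_trunc.
by move=> x; exact: derive_exp (derive_trunc x).
Qed.

End positive_eps.
End truncation.

Section soft_absolute_value.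
Context {R : realType}.
Implicit Types (x y : R).

Definition soft x : R := Num.sqrt (1 + x ^+ 2).

Lemma soft_arg_gt0 x : 0 < 1 + x ^+ 2.
Proof. by rewrite ltr_wpDr ?sqr_ge0. Qed.

Lemma soft_ge1 x : 1 <= soft x.
Proof. by rewrite -[leLHS]sqrtr1 ler_wsqrtr// lerDl sqr_ge0. Qed.

Lemma soft_gt0 x : 0 < soft x.
Proof. exact: lt_le_trans (soft_ge1 x). Qed.

Lemma soft_norm x : `|x| <= soft x.
Proof. by rewrite -sqrtr_sqr ler_wsqrtr// lerDr. Qed.

Lemma sqr_soft x : soft x ^+ 2 = 1 + x ^+ 2.
Proof. by rewrite sqr_sqrtr// ltW// soft_arg_gt0. Qed.

Lemma soft_le x : soft x <= 1 + `|x|.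
Proof.
rewrite -[leRHS]ger0_norm ?addr_ge0// -sqrtr_sqr ler_wsqrtr//.
by rewrite sqrrD expr1n mul1r real_normK ?num_real// addrAC lerDl mulrn_wge0.
Qed.

Lemma soft_lipschitz x y : `|soft x - soft y| <= `|x - y|.
Proof.
have h : (soft x - soft y) * (soft x + soft y) = (x - y) * (x + y).
  by rewrite -!subr_sqr !sqr_soft; ring.
have s0 : 0 < soft x + soft y by rewrite addr_gt0 ?soft_gt0.
rewrite -(ler_pM2r s0) -{1}(gtr0_norm s0) -normrM h normrM.
rewrite ler_wpM2l// (le_trans (ler_normD _ _))// lerD ?soft_norm//.
Qed.

Lemma derive_soft x : is_derive x 1 soft (x / soft x).
Proof.
have dx := derive_exp 2 (@is_derive_id _ _ x (1 : R)).
have d1 : is_derive x 1 (fun y : R => 1 + y ^+ 2) (2 * x).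
  apply: (derive_ext (is_deriveD (is_derive_cst (1 : R) x 1) dx)) => //.
  by rewrite add0r /=; ring.
have d2 := is_derive1_sqrt (soft_arg_gt0 x).
apply: (derive_ext (@is_derive1_comp _ Num.sqrt (fun y : R => 1 + y ^+ 2) _ _ _ d2 d1)) => //.
by rewrite -/(soft x); have := soft_gt0 x => /lt0r_neq0 ?; field.
Qed.

End soft_absolute_value.

Section soft_power.
Context {R : realType}.
Variables (eps : R) (k : nat).
Hypothesis eps0 : 0 < eps.
Implicit Types x : R.

Let t := trunc eps.
Let s x := soft (t x).

(* A smooth substitute for [sign t * |t| ^ k.+1], whose Stein identity bounds
   the absolute moment of order [k.+2] by lower ones. *)
Definition soft_power x : R := t x * s x ^+ k.
Definition dsoft_power x : R :=
  dtrunc eps x * s x ^+ k + t x * (k%:R * s x ^+ k.-1 * (t x / s x * dtrunc eps x)).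

Let bl_t : bounded_lipschitz t. Proof. exact: bounded_lipschitz_trunc. Qed.

Let bl_s : bounded_lipschitz s.
Proof.
have [K K0 [tb tl]] := bl_t; exists (1 + K); first exact: addr_ge0.
split=> [x|x y].
  by rewrite (gtr0_norm (soft_gt0 _)) (le_trans (soft_le _))// lerD2l.
rewrite (le_trans (soft_lipschitz _ _))// (le_trans (tl _ _))// ler_wpM2r//.
by rewrite lerDr.
Qed.

Let bl_sV : bounded_lipschitz (fun x => (s x)^-1).
Proof.
have [K K0 [sb sl]] := bl_s; exists (1 + K); first exact: addr_ge0.
have s0 x : 0 < s x by exact: soft_gt0.
split=> [x|x y].
  rewrite gtr0_norm ?invr_gt0// (@le_trans _ _ 1) ?lerDl//.
  by rewrite invf_le1// soft_ge1.
have -> : (s x)^-1 - (s y)^-1 = (s y - s x) * ((s x)^-1 * (s y)^-1).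
  by have := lt0r_neq0 (s0 x); have := lt0r_neq0 (s0 y) => ? ?; field; apply/andP.
have i0 z : 0 <= (s z)^-1 by rewrite invr_ge0 ltW.
have i1 z : (s z)^-1 <= 1 by rewrite invf_le1// soft_ge1.
have n1 : `|(s x)^-1 * (s y)^-1| <= 1 by rewrite ger0_norm ?mulr_ge0// mulr_ile1.
rewrite normrM distrC; apply: (@le_trans _ _ (K * `|x - y| * 1)).
  by apply: ler_pM.
by rewrite mulr1 ler_wpM2r// lerDr.
Qed.

Lemma test_pair_soft_power : test_pair soft_power dsoft_power.
Proof.
split.
- exact: bounded_lipschitzM (bounded_lipschitzX _ bl_s).
- apply: bounded_lipschitzD.
    apply: bounded_lipschitzM (bounded_lipschitz_dtrunc eps0) _.
    exact: bounded_lipschitzX.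
  apply: bounded_lipschitzM => //; apply: bounded_lipschitzM.
    by apply: bounded_lipschitzM; [exact: bounded_lipschitz_cst|exact: bounded_lipschitzX].
  apply: bounded_lipschitzM (bounded_lipschitz_dtrunc eps0).
  exact: bounded_lipschitzM.
- move=> x; have dt := derive_trunc eps0 x.
  apply: derive_mul => //; apply: derive_exp.
  exact: is_derive1_comp (derive_soft _) dt.
Qed.

(** The bound is free of [eps], which is what later allows [eps] to tend to 0. Both terms are at
    most multiples of [s x ^+ k] because |t x| <= s x, and s x <= 1 + |x|. *)
Lemma dsoft_power_growth x : `|dsoft_power x| <= k.+1%:R * (1 + `|x|) ^+ k.
Proof.
have s1 : 1 <= s x by exact: soft_ge1.
have s0 : 0 < s x by exact: soft_gt0.
have ts : `|t x| <= s x by exact: soft_norm.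
have sx : s x <= 1 + `|x|.
  by rewrite (le_trans (soft_le _))// lerD2l trunc_norm.
have d1 := dtrunc_norm eps0 x.
apply: (@le_trans _ _ (k.+1%:R * s x ^+ k)); last first.
  by rewrite ler_wpM2l// lerXn2r ?nnegrE// ?addr_ge0// ltW.
rewrite -natr1 mulrDl mul1r addrC (le_trans (ler_normD _ _))// lerD//.
  have sk0 : 0 <= s x ^+ k by rewrite exprn_ge0// ltW.
  by rewrite normrM (ger0_norm sk0) ler_piMl.
case: (k) => [|j]; first by rewrite !mul0r mulr0 normr0.
move: (t x) (s x) s0 ts => tx y s0 ts.
rewrite /= !normrM (ger0_norm (ler0n _ _)) (ger0_norm (exprn_ge0 _ (ltW s0))).
rewrite normfV (gtr0_norm s0) exprSr.
have tsV : `|tx| / y <= 1 by rewrite ler_pdivrMr// mul1r.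
have e0 : 0 <= y ^+ j by rewrite exprn_ge0// ltW.
have i0 : 0 <= `|tx| / y by rewrite divr_ge0// ltW.
have n1 : `|tx| / y * `|dtrunc eps x| <= 1 by rewrite mulr_ile1.
rewrite mulrCA -!mulrA ler_wpM2l// ler_wpM2l//.
rewrite -[leRHS]mulr1; apply: ler_pM => //.
  by rewrite !mulr_ge0// invr_ge0 ltW.
by rewrite mulrA.
Qed.

(** [trunc] preserves the sign, so that x t(x) = |x| |t(x)|, and the soft absolute value dominates
    |t(x)|. *)
Lemma soft_power_sign x : `|x| * `|t x| ^+ k.+1 <= x * soft_power x.
Proof.
have d0 := damp_gt0 eps0 x.
have ts : `|t x| <= s x by exact: soft_norm.
have -> : x * soft_power x = `|x| * `|t x| * s x ^+ k.
  rewrite /soft_power mulrA; congr (_ * _).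
  rewrite /t /trunc normrM (gtr0_norm d0) !mulrA; congr (_ * _).
  by rewrite -expr2 -normrM -expr2 ger0_norm// sqr_ge0.
rewrite exprS mulrA ler_wpM2l ?mulr_ge0// lerXn2r ?nnegrE//.
exact: ltW (soft_gt0 _).
Qed.

End soft_power.

Section growth.
Context {R : realType}.

(** The sum is at most three times the largest of its terms. *)
Lemma expr_add3_le (a b c : R) k : 0 <= a -> 0 <= b -> 0 <= c ->
  (a + b + c) ^+ k <= 3 ^+ k * (a ^+ k + b ^+ k + c ^+ k).
Proof.
move=> a0 b0 c0.
have H (m : R) : 0 <= m -> a <= m -> b <= m -> c <= m ->
    (a + b + c) ^+ k <= 3 ^+ k * m ^+ k.
  move=> m0 am bm cm; rewrite -exprMn lerXn2r ?nnegrE ?addr_ge0 ?mulr_ge0//; lra.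
have [ab|/ltW ba] := leP a b; have [bc|/ltW cb] := leP b c; have [ac|/ltW ca] := leP a c.
all: have a' := exprn_ge0 k a0; have b' := exprn_ge0 k b0; have c' := exprn_ge0 k c0.
all: first [apply: le_trans (H a _ _ _ _) _ => //; [lra..|]
  | apply: le_trans (H b _ _ _ _) _ => //; [lra..|]
  | apply: le_trans (H c _ _ _ _) _ => //; [lra..|]].
all: apply: ler_wpM2l; [by rewrite exprn_ge0|lra].
Qed.

Lemma increment_growth (h h' : R -> R) (C : R) k : 0 <= C ->
  (forall x : R, is_derive x 1 h (h' x)) ->
  (forall x, `|h' x| <= C * (1 + `|x|) ^+ k) ->
  forall x a, `|h (x + a) - h x| <= C * 3 ^+ k * (1 + `|x| ^+ k + `|a| ^+ k) * `|a|.
Proof.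
move=> C0 dh hC x a.
(* Stated for ordered endpoints, the mean value bound serves both signs of [a]. *)
have key (lo hi : R) : lo <= hi -> `|lo| <= `|x| + `|a| -> `|hi| <= `|x| + `|a| ->
    `|h hi - h lo| <= C * (1 + `|x| + `|a|) ^+ k * `|hi - lo|.
  move=> lohi lob hib.
  have ch : {within `[lo, hi], continuous h}.
    by apply: derivable_within_continuous => z _; exact: ex_derive.
  have [c cI ->] := MVT_segment lohi (fun z _ => dh z) ch.
  rewrite normrM ler_wpM2r// (le_trans (hC c))// ler_wpM2l//.
  rewrite lerXn2r ?nnegrE ?addr_ge0// -addrA lerD2l.
  move: cI; rewrite in_itv/= => /andP[lc ch'].
  move: lob hib; rewrite !ler_norml => /andP[l1 l2] /andP[h1 h2].
  by apply/andP; split; lra.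
have {key} : `|h (x + a) - h x| <= C * (1 + `|x| + `|a|) ^+ k * `|a|.
  have xa : `|x + a| <= `|x| + `|a| by exact: ler_normD.
  have x' : `|x| <= `|x| + `|a| by rewrite lerDl.
  have [a0|/ltW a0] := leP 0 a.
    have -> : `|a| = `|(x + a) - x| by rewrite addrAC subrr add0r.
    by rewrite {1}[_ - x]addrAC subrr add0r; apply: key; rewrite ?lerDl.
  have -> : C * (1 + `|x| + `|a|) ^+ k * `|a| = C * (1 + `|x| + `|a|) ^+ k * `|x - (x + a)|.
    by rewrite opprD addrA subrr add0r normrN.
  by rewrite distrC; apply: key; rewrite ?gerDl.
move=> /le_trans; apply; rewrite ler_wpM2r// -mulrA ler_wpM2l//.
by apply: le_trans (expr_add3_le _ _ _ _) _ => //; rewrite expr1n.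
Qed.

End growth.

Section trunc_limits.
Context {R : realType}.
Local Notation eps n := (n.+1%:R^-1 : R).

Lemma cvg_eq_lim (u : nat -> R) (a b : R) : u n @[n --> \oo] --> a -> a = b ->
  u n @[n --> \oo] --> b.
Proof. by move=> + <-. Qed.

Lemma cvg_damp (x : R) : damp (eps n) x @[n --> \oo] --> (1 : R).
Proof.
apply: (@cvg_eq_lim _ (1 + 0 * x ^+ 2)^-1); last by rewrite mul0r addr0 invr1.
apply: cvgV; first by rewrite mul0r addr0 oner_neq0.
apply: cvgD; first exact: cvg_cst.
by apply: cvgM; [exact: cvg_harmonic|exact: cvg_cst].
Qed.

Lemma cvg_trunc (x : R) : trunc (eps n) x @[n --> \oo] --> x.
Proof.
apply: (@cvg_eq_lim _ (x * 1)); last by rewrite mulr1.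
by apply: cvgM; [exact: cvg_cst|exact: cvg_damp].
Qed.

Lemma cvg_dtrunc (x : R) : dtrunc (eps n) x @[n --> \oo] --> (1 : R).
Proof.
apply: (@cvg_eq_lim _ (2 * (1 * 1) - 1)); last by ring.
apply: cvgB; last exact: cvg_damp.
apply: cvgM; first exact: cvg_cst.
by under eq_fun do rewrite expr2; apply: cvgM; exact: cvg_damp.
Qed.

Lemma cvg_exp (u : nat -> R) (a : R) k : u n @[n --> \oo] --> a ->
  u n ^+ k @[n --> \oo] --> a ^+ k.
Proof.
move=> ua; elim: k => [|k IH]; first by under eq_fun do rewrite expr0; exact: cvg_cst.
by under eq_fun do rewrite exprS; rewrite exprS; exact: cvgM.
Qed.

End trunc_limits.

Section fatou_bound.
Context d (T : measurableType d) (R : realType) (mu : {measure set T -> \bar R}).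
Variables (D : set T) (mD : measurable D).

(** Fatou's lemma as a criterion: integrability of the limit is a conclusion, so it can produce
    moments not known to exist. *)
Lemma bounded_Rintegral_integrable (g_ : nat -> T -> R) (g : T -> R) (M : R) :
  (forall n, mu.-integrable D (EFin \o g_ n)) ->
  (forall n x, D x -> 0 <= g_ n x) ->
  (forall n, \int[mu]_(x in D) g_ n x <= M) ->
  (forall x, D x -> g_ n x @[n --> \oo] --> g x) ->
  mu.-integrable D (EFin \o g).
Proof.
move=> ig g0 gM gg.
have mg_ n : measurable_fun D (g_ n) by exact: rintegrable_measurable (ig n).
have mg : measurable_fun D g by exact: measurable_fun_cvg gg.
have gg0 x : D x -> 0 <= g x.
  by move=> Dx; apply: (cvgr_to_ge (gg _ Dx)); apply: nearW => n; exact: g0.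
apply: ge0_rintegrable => //.
apply: (@le_lt_trans _ _ M%:E); last by rewrite ltry.
have := @fatou _ _ _ mu D mD (fun n => EFin \o g_ n).
have -> : (\int[mu]_(x in D) limn_einf ((fun n => EFin \o g_ n)^~ x) =
   \int[mu]_(x in D) (g x)%:E)%E.
  apply: eq_integral => x /set_mem Dx.
  have cg : (g_ n x)%:E @[n --> \oo] --> (g x)%:E.
    by apply/cvg_EFin; [exact: nearW|exact: gg].
  by have [-> _] := cvg_limn_einf_sup cg.
move=> H; apply: le_trans (H _ _) _.
- by move=> n; exact/measurable_EFinP.
- by move=> n x Dx; rewrite lee_fin g0.
- rewrite limn_einf_lim; apply: lime_le; first exact: is_cvg_einfs.
  apply: nearW => n; apply: (@le_trans _ _ (\int[mu]_(x in D) (g_ n x)%:E)%E).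
    by apply: ereal_inf_lbound; exists n => //=.
  by rewrite -(EFin_Rintegral mD)// lee_fin.
Qed.

End fatou_bound.

Section moments.
Context d (Om : measurableType d) (R : realType) (P : probability Om R).
Context dz (Z : measurableType dz) (m : {measure set Z -> \bar R}).
Variables (D : set Z) (mD : measurable D) (f : Z -> R) (v : R) (X : Om -> R).
Hypothesis f2 : sqr_integrable m D f.
Hypothesis mX : measurable_fun setT X.
Hypothesis X2 : P.-integrable setT (EFin \o (fun w => X w ^+ 2)).
Hypothesis steinX : stein_identity P m D X f v.
Local Notation eps n := (n.+1%:R^-1 : R).
Let eps0 n : 0 < eps n. Proof. by rewrite invr_gt0. Qed.

Let mf : measurable_fun D f. Proof. by case: f2. Qed.

Definition abs_power_integrable k := m.-integrable D (EFin \o (fun z => `|f z| ^+ k)).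

(** A derivative of growth k bounds the jump integrand by a constant times f^2 (1 + |x|^k + |f|^k);
    here the powers of f are sorted into the two whose integrals are available. *)
Definition jump_majorant (C : R) k (x : R) : Z -> R :=
  fun z => C * 3 ^+ k * ((1 + `|x| ^+ k) * f z ^+ 2 + `|f z| ^+ k.+2).

Lemma jump_majorantP (h h' : R -> R) (C : R) k : 0 <= C ->
  (forall x : R, is_derive x 1 h (h' x)) ->
  (forall x, `|h' x| <= C * (1 + `|x|) ^+ k) ->
  forall x z, `|f z * (h (x + f z) - h x)| <= jump_majorant C k x z.
Proof.
move=> C0 dh hC x z; rewrite normrM.
apply: le_trans (ler_wpM2l (normr_ge0 _) (increment_growth C0 dh hC x (f z))) _.
rewrite /jump_majorant -[f z ^+ 2](real_normK (num_real _)) le_eqVlt.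
by apply/orP; left; apply/eqP; rewrite !exprS; ring.
Qed.

Lemma jump_majorant_integrable C k x : abs_power_integrable k.+2 ->
  m.-integrable D (EFin \o jump_majorant C k x).
Proof.
move=> fk; apply: rintegrableZ => //; apply: rintegrableD => //.
by apply: rintegrableZ => //; case: f2.
Qed.

Lemma Rintegral_jump_majorant C k x : abs_power_integrable k.+2 ->
  \int[m]_(z in D) jump_majorant C k x z =
  C * 3 ^+ k * ((1 + `|x| ^+ k) * \int[m]_(z in D) f z ^+ 2
     + \int[m]_(z in D) `|f z| ^+ k.+2).
Proof.
move=> fk; have [_ f2'] := f2.
rewrite RintegralZl//; last by apply: rintegrableD => //; exact: rintegrableZ.
by rewrite RintegralD//; [rewrite RintegralZl|exact: rintegrableZ].
Qed.

Definition abs_moment k := P.-integrable setT (EFin \o (fun w => `|X w| ^+ k)).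

Lemma abs_moment0 : abs_moment 0.
Proof.
by rewrite /abs_moment; under [X in EFin \o X]eq_fun do rewrite expr0; exact: rintegrable_cst.
Qed.

Lemma abs_moment1 : abs_moment 1.
Proof.
rewrite /abs_moment; under [X in EFin \o X]eq_fun do rewrite expr1.
exact: rintegrable_norm (sqr_rintegrable mX X2).
Qed.

Lemma moment_integrable k : abs_moment k ->
  P.-integrable setT (EFin \o (fun w => X w ^+ k)).
Proof.
move=> h; apply: (le_rintegrable measurableT _ h); first exact: measurable_funX.
by move=> w _; rewrite normrX.
Qed.

Lemma jump_increment_integrable (h h' : R -> R) : test_pair h h' ->
  P.-integrable setT (EFin \o (fun w => jump_increment m D f h (X w))).
Proof.
move=> hh; have [C _ [Cb Cl]] := jump_increment_bounded_lipschitz mD f2 hh.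
apply: (@bounded_rintegrable _ _ _ _ _ C) => //.
exact: measurableT_comp (lipschitz_measurable Cl) mX.
Qed.

Lemma derivative_integrable (h h' : R -> R) : test_pair h h' ->
  P.-integrable setT (EFin \o (fun w => h' (X w))).
Proof.
move=> [_ [C _ [Cb Cl]] _]; apply: (@bounded_rintegrable _ _ _ _ _ C) => //.
exact: measurableT_comp (lipschitz_measurable Cl) mX.
Qed.

(** The Stein identity for [soft_power] bounds the expectation of |X| |trunc X|^(k+1) by moments of
    order k, uniformly in the truncation, since the derivative of the test function has growth k.
    Fatou's lemma concludes. *)
Lemma abs_moment_step k : abs_moment k -> abs_power_integrable k.+2 ->
  abs_moment k.+2.
Proof.
move=> Xk fk.
pose F2 := \int[m]_(z in D) f z ^+ 2.
pose Fk := \int[m]_(z in D) `|f z| ^+ k.+2.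
(* [B] will dominate the jump term of the identity, [B'] the derivative term. *)
pose B w := k.+1%:R * 3 ^+ k * ((1 + `|X w| ^+ k) * F2 + Fk).
pose B' w := k.+1%:R * (3 ^+ k * (1 + `|X w| ^+ k + 1)).
have iB : P.-integrable setT (EFin \o B).
  apply: rintegrableZ => //; apply: rintegrableD => //; last exact: rintegrable_cst.
  under [X in EFin \o X]eq_fun do rewrite mulrC.
  by apply: rintegrableZ => //; apply: rintegrableD => //; exact: rintegrable_cst.
have iB' : P.-integrable setT (EFin \o B').
  do 2 apply: rintegrableZ => //; apply: rintegrableD => //; last exact: rintegrable_cst.
  by apply: rintegrableD => //; exact: rintegrable_cst.
pose g n w := `|X w| * `|trunc (eps n) (X w)| ^+ k.+1.
have ig n : P.-integrable setT (EFin \o g n).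
  have [K K0 [tb tl]] := bounded_lipschitz_trunc (eps0 n).
  apply: (le_rintegrable measurableT (g := fun w => K ^+ k.+1 * `|X w|)).
  - apply: measurable_funM; first exact: measurableT_comp.
    apply: measurable_funX; do 2 apply: measurableT_comp => //.
    exact: lipschitz_measurable tl.
  - by apply: rintegrableZ => //; exact: rintegrable_norm (sqr_rintegrable mX X2).
  - move=> w _; rewrite /g ger0_norm ?mulr_ge0// mulrC ler_wpM2r//.
    by rewrite lerXn2r ?nnegrE.
apply: (@bounded_Rintegral_integrable _ _ _ _ _ measurableT g _
  (\int[P]_w B w + `|v| * \int[P]_w B' w) ig).
- by move=> n w _; rewrite mulr_ge0.
- move=> n; have hh := test_pair_soft_power k (eps0 n); have [bl bl' dh] := hh.
  set h := soft_power _ _ in hh bl dh; set h' := dsoft_power _ _ in hh bl' dh.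
  have gr := dsoft_power_growth k (eps0 n); rewrite -/h' in gr.
  have iXh : P.-integrable setT (EFin \o (fun w => X w * h (X w))).
    have [K K0 [hb hl]] := bl.
    apply: (le_rintegrable measurableT (g := fun w => K * `|X w|)).
    + apply: measurable_funM => //; apply: measurableT_comp => //.
      exact: lipschitz_measurable hl.
    + by apply: rintegrableZ => //; exact: rintegrable_norm (sqr_rintegrable mX X2).
    + by move=> w _; rewrite normrM mulrC ler_wpM2r.
  apply: (@le_trans _ _ (\int[P]_w (X w * h (X w)))).
    apply: le_Rintegral => //.
    by move=> w _; exact: soft_power_sign.
  rewrite (steinX hh); apply: lerD.
    apply: le_Rintegral => //; first exact: jump_increment_integrable hh.
    move=> w _; apply: le_trans (ler_norm _) _.
    rewrite /B -Rintegral_jump_majorant//; apply: normr_Rintegral_le => //.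
    + exact: jump_integrable hh.
    + exact: jump_majorant_integrable.
    + by move=> z _; apply: jump_majorantP gr _ _.
  apply: le_trans (ler_norm _) _; rewrite normrM ler_wpM2l//.
  apply: normr_Rintegral_le => //; first exact: derivative_integrable hh.
  move=> w _; apply: le_trans (gr _) _; rewrite ler_wpM2l//.
  (* The three-term bound is used with third term 0; as [0 ^+ 0 = 1], this accounts for the second 1
     in [B']. *)
  rewrite -[1 + `|X w|]addr0; apply: le_trans (expr_add3_le k _ _ _) _ => //.
  rewrite expr1n ler_wpM2l// lerD2l; case: (k) => [|j]; first by rewrite expr0.
  by rewrite expr0n.
- move=> w _; rewrite exprS; apply: cvgM; first exact: cvg_cst.
  by apply: cvg_exp; apply: cvg_norm; exact: cvg_trunc.
Qed.

(** Where |f| <= 1 the power is at most f^2, elsewhere at most |f|^N; this is how L^2 and L^N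
    together control all orders between. *)
Lemma abs_power_interpolation k N : (2 <= k <= N)%N ->
  abs_power_integrable N -> abs_power_integrable k.
Proof.
move=> /andP[k2 kN] fN; have [_ f2'] := f2.
apply: (le_rintegrable mD (g := fun z => f z ^+ 2 + `|f z| ^+ N)).
- by apply: measurable_funX; exact: measurableT_comp.
- exact: rintegrableD.
move=> z _; rewrite normrX normr_id -[f z ^+ 2](real_normK (num_real _)).
have [f1|/ltW f1] := leP `|f z| 1.
  by rewrite (le_trans (ler_wiXn2l _ _ k2))// lerDl exprn_ge0.
by rewrite (le_trans (ler_weXn2l f1 kN))// lerDr exprn_ge0.
Qed.

Lemma abs_moments N : abs_power_integrable N -> forall k, (k <= N)%N -> abs_moment k.
Proof.
move=> fN.
(* One step raises the order by two, so the induction carries two consecutive orders. *)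
suff H k : ((k <= N)%N -> abs_moment k) /\ ((k.+1 <= N)%N -> abs_moment k.+1).
  by move=> k kN; have [/(_ kN)] := H k.
elim: k => [|k [IH1 IH2]]; first by split=> _; [exact: abs_moment0|exact: abs_moment1].
split=> // kN; apply: abs_moment_step.
  by apply: IH1; lia.
by apply: abs_power_interpolation fN; lia.
Qed.

(** The zeroth binomial term cancels against x^n. With the prefactor, the powers of f therefore
    start at 2, where integrability is available. *)
Lemma jump_moment_expand n x :
  (forall k, (2 <= k <= n.-1.+2)%N -> abs_power_integrable k) ->
  \int[m]_(z in D) (f z * ((x + f z) ^+ n - x ^+ n)) =
  \sum_(i < n) 'C(n, i.+1)%:R * (\int[m]_(z in D) f z ^+ i.+2) * x ^+ (n - i.+1).
Proof.
move=> fk; have if_ i : (i < n)%N -> m.-integrable D (EFin \o (fun z => f z ^+ i.+2)).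
  move=> i_n; apply: (le_rintegrable mD _ (fk i.+2 _)).
  - exact: measurable_funX.
  - by lia.
  - by move=> z _; rewrite normrX.
pose F (i : 'I_n) z := ('C(n, i.+1)%:R * x ^+ (n - i.+1)) * f z ^+ i.+2.
rewrite (@eq_Rintegral _ _ _ _ _ (fun z => \sum_(i < n) F i z)) => [|z _].
  rewrite Rintegral_sum//; last by move=> i; apply: rintegrableZ => //; exact: if_.
  apply: eq_bigr => i _; rewrite RintegralZl//; last exact: if_.
  by rewrite mulrAC.
rewrite exprDn big_ord_recl/= subn0 bin0 expr0 mulr1 mulr1n addrAC subrr add0r.
rewrite mulr_sumr; apply: eq_bigr => i _; rewrite /F -mulr_natl.
rewrite (_ : bump 0 i = i.+1)// [f z ^+ i.+2]exprS; ring.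
Qed.

(** This is the Stein identity for powers of [trunc], with the truncation removed by dominated
    convergence in all three terms. The absolute moments and the power [n.-1.+2] of f supply the
    dominating functions. *)
Lemma moment_identity n : abs_moment n.+1 -> abs_moment n.-1 ->
  abs_power_integrable n.-1.+2 ->
  \int[P]_w X w ^+ n.+1 =
  \int[P]_w (\int[m]_(z in D) (f z * ((X w + f z) ^+ n - X w ^+ n)))
  + v * \int[P]_w (n%:R * X w ^+ n.-1).
Proof.
move=> Xn Xn1 fn; set k := n.-1 in Xn1 fn *.
have hh j := test_pair_truncX (eps0 j) n.
pose h j : R -> R := fun x => trunc (eps j) x ^+ n.
pose h' j : R -> R := fun x => n%:R * trunc (eps j) x ^+ n.-1 * dtrunc (eps j) x.
have mtr j : measurable_fun setT (trunc (eps j)).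
  exact: bounded_lipschitz_measurable (bounded_lipschitz_trunc (eps0 j)).
have h'1 j x : `|h' j x| <= n%:R * `|x| ^+ k.
  rewrite /h' !normrM (ger0_norm (ler0n _ _)) -mulrA ler_wpM2l// -[leRHS]mulr1.
  by rewrite ler_pM// ?dtrunc_norm// normrX lerXn2r ?nnegrE// trunc_norm.
have gr j x : `|h' j x| <= n%:R * (1 + `|x|) ^+ k.
  by apply: le_trans (h'1 j x) _; rewrite ler_wpM2l// lerXn2r ?nnegrE// ?addr_ge0// lerDr.
have chx (x : R) : h j x @[j --> \oo] --> x ^+ n by apply: cvg_exp; exact: cvg_trunc.
have A1 j w : `|X w * h j (X w)| <= `|X w| ^+ n.+1.
  by rewrite normrM exprS ler_wpM2l// normrX lerXn2r ?nnegrE// trunc_norm.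
have A2 w : X w * h j (X w) @[j --> \oo] --> X w ^+ n.+1.
  by rewrite exprS; apply: cvgM => //; exact: cvg_cst.
have [_ cA] := @dominated_cvg_Rintegral _ _ _ P _ measurableT
  (fun j w => X w * h j (X w)) (fun w => X w ^+ n.+1) _
  (fun j => measurable_funM mX (measurable_funX _ (measurableT_comp (mtr j) mX)))
  Xn (fun j w _ => A1 j w) (fun w _ => A2 w).
have C2 w : h' j (X w) @[j --> \oo] --> n%:R * X w ^+ k.
  apply: (@cvg_eq_lim _ _ (n%:R * X w ^+ k * 1)); last by rewrite mulr1.
  apply: cvgM; last exact: cvg_dtrunc.
  by apply: cvgM; [exact: cvg_cst|apply: cvg_exp; exact: cvg_trunc].
have [_ cC] := @dominated_cvg_Rintegral _ _ _ P _ measurableT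
  (fun j w => h' j (X w)) (fun w => n%:R * X w ^+ k) (fun w => n%:R * `|X w| ^+ k)
  (fun j => rintegrable_measurable (derivative_integrable (hh j)))
  (rintegrableZ measurableT _ Xn1) (fun j w _ => h'1 j (X w)) (fun w _ => C2 w).
pose B w := n%:R * 3 ^+ k * ((1 + `|X w| ^+ k) * \int[m]_(z in D) f z ^+ 2
     + \int[m]_(z in D) `|f z| ^+ k.+2).
have iB : P.-integrable setT (EFin \o B).
  apply: rintegrableZ => //; apply: rintegrableD => //; last exact: rintegrable_cst.
  under [X in EFin \o X]eq_fun do rewrite mulrC.
  by apply: rintegrableZ => //; apply: rintegrableD => //; exact: rintegrable_cst.
have jb j x z : `|f z * (h j (x + f z) - h j x)| <= jump_majorant n%:R k x z.
  by have [_ _ dh] := hh j; apply: jump_majorantP dh (gr j) _ _.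
have cJ x : jump_increment m D f (h j) x @[j --> \oo] -->
    \int[m]_(z in D) (f z * ((x + f z) ^+ n - x ^+ n)).
  have [] // := @dominated_cvg_Rintegral _ _ _ m D mD
    (fun j z => f z * (h j (x + f z) - h j x)) (fun z => f z * ((x + f z) ^+ n - x ^+ n))
    (jump_majorant n%:R k x) _ (jump_majorant_integrable _ _ fn) (fun j z _ => jb j x z).
  - by move=> j; exact: rintegrable_measurable (jump_integrable mD x f2 (hh j)).
  - by move=> z _; apply: cvgM; [exact: cvg_cst|apply: cvgB].
have B1 j w : `|jump_increment m D f (h j) (X w)| <= B w.
  rewrite /B -Rintegral_jump_majorant//; apply: normr_Rintegral_le => //.
  + exact: jump_integrable (hh j).
  + exact: jump_majorant_integrable.
have [_ cB] := @dominated_cvg_Rintegral _ _ _ P _ measurableT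
  (fun j w => jump_increment m D f (h j) (X w)) _ B
  (fun j => rintegrable_measurable (jump_increment_integrable (hh j)))
  iB (fun j w _ => B1 j w) (fun w _ => cJ (X w)).
have cBC : \int[P]_w jump_increment m D f (h j) (X w) + v * \int[P]_w h' j (X w)
   @[j --> \oo] --> \int[P]_w (\int[m]_(z in D) (f z * ((X w + f z) ^+ n - X w ^+ n)))
  + v * \int[P]_w (n%:R * X w ^+ k).
  by apply: cvgD => //; apply: cvgM => //; exact: cvg_cst.
rewrite (_ : (fun j => _) = (fun j => \int[P]_w jump_increment m D f (h j) (X w) +
    v * \int[P]_w h' j (X w))) in cA.
  by rewrite -(cvg_lim _ cA)// (cvg_lim _ cBC)//.
by apply/funext => j; exact: steinX (hh j).
Qed.

(** The Gaussian part enters at order two only. Order one is set to 0 and not to the integral of f,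
    which need not exist. *)
Definition stein_cumulant i : R :=
  if i == 1%N then 0 else if i == 2%N then v + \int[m]_(z in D) f z ^+ 2
  else \int[m]_(z in D) f z ^+ i.

Lemma stein_moment_rec N n : (n < N)%N -> abs_power_integrable N ->
  bell_rec_at stein_cumulant (fun n => \int[P]_w X w ^+ n) n.
Proof.
move=> nN fN; have XN := abs_moments fN.
(* For n = 0 the order [n.-1.+2] equals 2 even if N = 1, and is then taken from the L^2 hypothesis;
   otherwise interpolation applies. *)
have fk k : (2 <= k <= n.-1.+2)%N -> abs_power_integrable k.
  case: n nN => [|n] nN /= k2; last by apply: abs_power_interpolation fN; lia.
  have -> : k = 2%N by lia.
  by have [_ f2'] := f2; apply: (eq_rintegrable mD _ f2') => z _; rewrite real_normK// num_real.
rewrite /bell_rec_at moment_identity//; first last.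
- by apply: fk; lia.
- by apply: XN; lia.
- exact: XN.
rewrite big_ord_recl/= mulr0 mul0r add0r.
under eq_Rintegral do rewrite jump_moment_expand//.
rewrite Rintegral_sum//; last first.
  move=> i; apply: rintegrableZ => //; apply: moment_integrable; apply: XN; lia.
rewrite RintegralZl//; last by apply: moment_integrable; apply: XN; lia.
rewrite (eq_bigr (fun i : 'I_n => 'C(n, i.+1)%:R * (\int[m]_(z in D) f z ^+ i.+2) *
    \int[P]_w X w ^+ (n - i.+1))); last first.
  by move=> i _; rewrite /= RintegralZl//; apply: moment_integrable; apply: XN; lia.
under [in RHS]eq_bigr => i _ do rewrite (_ : bump 0 i = i.+1)//.
case: n nN fk => [|n] nN fk; first by rewrite !big_ord0 mul0r mulr0 addr0.
(* The leading terms are isolated: the one with f^2 combines with the derivative term, which carries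
   [v], into the second cumulant. *)
rewrite !big_ord_recl/= bin1 subn1 /stein_cumulant/=.
under [in RHS]eq_bigr => i _ do rewrite (_ : bump 0 i = i.+1)//=.
under [in LHS]eq_bigr => i _ do rewrite (_ : bump 0 i = i.+1)//=.
ring.
Qed.

Lemma stein_moments N : (0 < N)%N -> abs_power_integrable N ->
  P.-integrable setT (EFin \o (fun w => X w ^+ N)) /\
  \int[P]_w X w ^+ N = bell N stein_cumulant.
Proof.
move=> N0 fN; split; first by apply: moment_integrable; exact: abs_moments fN _ _.
apply: (bell_unique (B := fun n => \int[P]_w X w ^+ n)) => //.
  by under eq_Rintegral do rewrite expr0; rewrite Rintegral_probability_cst.
by move=> n nN; exact: stein_moment_rec fN.
Qed.

End moments.

(** Domination is asked for only on |u - a| <= 1, because some majorants depend on the point; for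
    the exponents below they are (|a| + 1) f^2. *)
Lemma derive_under_integral (R : realType) d (Y : measurableType d)
    (mu : {measure set Y -> \bar R}) (D : set Y) (G G' : R -> Y -> R) (B : Y -> R) (a : R) :
  measurable D -> (forall u, mu.-integrable D (EFin \o G u)) ->
  (forall (u : R) y, D y -> is_derive u 1 (G^~ y) (G' u y)) ->
  (forall y, 0 <= B y) -> mu.-integrable D (EFin \o B) ->
  (forall u y, `|u - a| <= 1 -> D y -> `|G' u y| <= B y) ->
  is_derive a 1 (fun u => \int[mu]_(y in D) G u y) (\int[mu]_(y in D) G' a y).
Proof.
move=> mD iG dG B0 iB GB.
have ua : `]a - 1, a + 1[%classic a by rewrite /= in_itv/=; apply/andP; split; lra.
have dI u y : `]a - 1, a + 1[%classic u -> D y -> derivable (G^~ y) u 1.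
  by move=> _ Dy; have := dG u y Dy => -[].
have bI u y : `]a - 1, a + 1[%classic u -> D y -> `|partial1of2 G u y| <= B y.
  move=> uI Dy; rewrite partial1of2E (@derive_val _ _ _ _ _ _ _ (dG u y Dy)).
  apply: GB => //; move: uI; rewrite /= in_itv/= ler_norml => /andP[? ?].
  by apply/andP; split; lra.
apply: DeriveDef.
  exact: (@derivable_under_integral _ _ _ mu G D mD a _ _ ua (fun u _ => iG u) dI B).
rewrite -derive1E (@differentiation_under_integral _ _ _ mu G D mD a _ _ ua
  (fun u _ => iG u) dI B)//.
apply: eq_Rintegral => y /set_mem Dy.
by rewrite partial1of2E (@derive_val _ _ _ _ _ _ _ (dG a y Dy)).
Qed.

(** * Cumulants from the Stein identity *)

Section trigonometry.
Context {R : realType}.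

Lemma derive_scaled (h : R -> R) (u y b : R) : is_derive (u * y) 1 h b ->
  is_derive u 1 (fun u => h (u * y)) (y * b).
Proof.
move=> dh; rewrite mulrC; apply: (@is_derive1_comp _ h (fun u => u * y)).
apply: (derive_ext (derive_mul (@is_derive_id _ _ u (1 : R)) (is_derive_cst y u 1))) => //.
by rewrite mul1r mulr0 addr0.
Qed.

Lemma derive_scaled_l (h : R -> R) (u y b : R) : is_derive (u * y) 1 h b ->
  is_derive y 1 (fun y => h (u * y)) (u * b).
Proof.
move=> dh; apply: (derive_ext (@derive_scaled h y u b _)) => //.
  by rewrite mulrC.
by move=> x; rewrite mulrC.
Qed.

Lemma cos_norm_le1 (x : R) : `|cos x| <= 1.
Proof. by rewrite ler_norml cos_geN1 cos_le1. Qed.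

Lemma sin_norm_le1 (x : R) : `|sin x| <= 1.
Proof. by rewrite ler_norml sin_geN1 sin_le1. Qed.

Lemma sin_norm_le (x : R) : `|sin x| <= `|x|.
Proof.
have := @bounded_derive_lipschitz _ sin cos 1 (fun x => is_derive_sin x) cos_norm_le1 x 0.
by rewrite sin0 !subr0 mul1r.
Qed.

Lemma cosB1_norm_le (x : R) : `|cos x - 1| <= `|x|.
Proof.
have dc := fun x : R => is_derive_cos x.
have sb (y : R) : `|- sin y| <= 1 by rewrite normrN sin_norm_le1.
have := bounded_derive_lipschitz dc sb x 0.
by rewrite cos0 !subr0 mul1r.
Qed.

Lemma test_pair_sin (u : R) : test_pair (fun x => sin (u * x)) (fun x => u * cos (u * x)).
Proof.
have d1 (x : R) : is_derive x 1 (fun x => sin (u * x)) (u * cos (u * x)).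
  by apply: derive_scaled_l.
have d2 (x : R) : is_derive x 1 (fun x => u * cos (u * x)) (0 * cos (u * x) + u * (u * - sin (u * x))).
  exact: (derive_mul (is_derive_cst u x 1) (derive_scaled_l (is_derive_cos (u * x)))).
split=> //.
- exists (1 + `|u|); first exact: addr_ge0.
  split=> [x|]; first by rewrite (le_trans (sin_norm_le1 _))// lerDl.
  apply: (bounded_derive_lipschitz d1) => x.
  by rewrite normrM -[leLHS]add0r lerD// -[leRHS]mulr1 ler_wpM2l// cos_norm_le1.
- exists (`|u| + `|u| ^+ 2); first by rewrite addr_ge0.
  split=> [x|].
    by rewrite normrM -[leLHS]addr0 lerD// -[leRHS]mulr1 ler_wpM2l// cos_norm_le1.
  apply: (bounded_derive_lipschitz d2) => x.
  rewrite mul0r add0r mulrA -expr2 mulrN normrN normrM normrX -[leLHS]add0r lerD//.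
  by rewrite -[leRHS]mulr1 ler_wpM2l// sin_norm_le1.
Qed.

Lemma test_pair_cos (u : R) : test_pair (fun x => cos (u * x)) (fun x => u * - sin (u * x)).
Proof.
have d1 (x : R) : is_derive x 1 (fun x => cos (u * x)) (u * - sin (u * x)).
  by apply: derive_scaled_l.
have d2 (x : R) : is_derive x 1 (fun x => u * - sin (u * x)) (0 * - sin (u * x) + u * - (u * cos (u * x))).
  exact: (derive_mul (is_derive_cst u x 1) (is_deriveN (derive_scaled_l (is_derive_sin (u * x))))).
split=> //.
- exists (1 + `|u|); first exact: addr_ge0.
  split=> [x|]; first by rewrite (le_trans (cos_norm_le1 _))// lerDl.
  apply: (bounded_derive_lipschitz d1) => x.
  by rewrite mulrN normrN normrM -[leLHS]add0r lerD// -[leRHS]mulr1 ler_wpM2l// sin_norm_le1.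
- exists (`|u| + `|u| ^+ 2); first by rewrite addr_ge0.
  split=> [x|].
    by rewrite mulrN normrN normrM -[leLHS]addr0 lerD// -[leRHS]mulr1 ler_wpM2l// sin_norm_le1.
  apply: (bounded_derive_lipschitz d2) => x.
  rewrite mul0r add0r mulrN mulrA -expr2 normrN normrM normrX -[leLHS]add0r lerD//.
  by rewrite -[leRHS]mulr1 ler_wpM2l// cos_norm_le1.
Qed.

(** The p-th derivative of cos in closed form. As sin = - cos', it serves the imaginary part as
    well. *)
Definition dcos (p : nat) (x : R) : R :=
  (-1) ^+ uphalf p * (if odd p then sin x else cos x).

Lemma derive_dcos p (x : R) : is_derive x 1 (dcos p) (dcos p.+1 x).
Proof.
rewrite /dcos uphalf_half /=; case: (odd p) => /=.
  have := derive_mul (is_derive_cst ((-1) ^+ (1 + p./2) : R) x 1) (is_derive_sin x).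
  by rewrite mul0r add0r.
have := derive_mul (is_derive_cst ((-1) ^+ (0 + p./2) : R) x 1) (is_derive_cos x).
by rewrite mul0r add0r add0n exprS mulN1r mulrN mulNr.
Qed.

Lemma dcos_norm_le1 p (x : R) : `|dcos p x| <= 1.
Proof.
rewrite /dcos normrM normrX normrN1 expr1n mul1r.
by case: ifP => _; [exact: sin_norm_le1|exact: cos_norm_le1].
Qed.

Lemma dcos0 p : dcos p 0 = if odd p then 0 else (-1) ^+ p./2 :> R.
Proof.
rewrite /dcos uphalf_half; case: ifP => op; first by rewrite sin0 mulr0.
by rewrite cos0 mulr1 add0n.
Qed.

End trigonometry.

Lemma is_derive_derivable {R : realType} (g : R -> R) (x a : R) :
  is_derive x 1 g a -> derivable g x 1.
Proof. by case. Qed.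

Lemma is_derive_continuous {R : realType} (g : R -> R) (x a : R) :
  is_derive x 1 g a -> {for x, continuous g}.
Proof.
by move=> /is_derive_derivable/derivable1_diffP; exact: differentiable_continuous.
Qed.

Lemma near0W {R : realType} (Q : R -> Prop) : (forall u, Q u) -> \forall u \near (0 : R), Q u.
Proof. by move=> q; near=> u. Unshelve. all: by end_near. Qed.

Section log_characteristic.
Context d (Om : measurableType d) (R : realType) (P : probability Om R).
Context dz (Z : measurableType dz) (m : {measure set Z -> \bar R}).
Variables (D : set Z) (mD : measurable D) (f : Z -> R) (v : R) (X : Om -> R).
Hypothesis f2 : sqr_integrable m D f.
Hypothesis mX : measurable_fun setT X.
Hypothesis X2 : P.-integrable setT (EFin \o (fun w => X w ^+ 2)).
Hypothesis steinX : stein_identity P m D X f v.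

Let mf : measurable_fun D f. Proof. by case: f2. Qed.
Let if2 : m.-integrable D (EFin \o (fun z => f z ^+ 2)). Proof. by case: f2. Qed.

Lemma measurable_trig (h : R -> R) (u : R) : continuous h ->
  measurable_fun D (fun z => h (u * f z)).
Proof.
move=> ch; apply: (measurableT_comp (f := h)); first exact: continuous_measurable_fun.
by apply: measurable_funM.
Qed.

Lemma le_sqr_integrable (g : Z -> R) (C : R) : measurable_fun D g ->
  (forall z, `|g z| <= C * f z ^+ 2) -> m.-integrable D (EFin \o g).
Proof.
by move=> mg gC; apply: (le_rintegrable mD mg (rintegrableZ mD C if2)) => z _.
Qed.

Definition re_exponent (u : R) : R :=
  - (v * u ^+ 2 / 2) + \int[m]_(z in D) (cos (u * f z) - 1).
Definition im_exponent (u : R) : R := \int[m]_(z in D) (sin (u * f z) - u * f z).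
(** The derivatives of the two exponents are [- (v * u) - sin_moment u] and [cos_moment u]; the same
    quantities appear when the Stein identity is applied to sin (u x) and cos (u x). *)
Definition sin_moment (u : R) : R := \int[m]_(z in D) (f z * sin (u * f z)).
Definition cos_moment (u : R) : R := \int[m]_(z in D) (f z * (cos (u * f z) - 1)).

Let msin u : measurable_fun D (fun z => sin (u * f z)).
Proof. exact: measurable_trig (@continuous_sin R). Qed.
Let mcos u : measurable_fun D (fun z => cos (u * f z)).
Proof. exact: measurable_trig (@continuous_cos R). Qed.

Lemma sin_moment_integrable u :
  m.-integrable D (EFin \o (fun z => f z * sin (u * f z))).
Proof.
apply: (@le_sqr_integrable _ `|u|); first exact: measurable_funM.
move=> z; rewrite normrM (le_trans (ler_wpM2l _ (sin_norm_le _)))//.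
by rewrite normrM mulrCA -normrM -expr2 (ger0_norm (sqr_ge0 _)).
Qed.

Lemma cos_moment_integrable u :
  m.-integrable D (EFin \o (fun z => f z * (cos (u * f z) - 1))).
Proof.
apply: (@le_sqr_integrable _ `|u|).
  by apply: measurable_funM => //; exact: measurable_funB.
move=> z; rewrite normrM (le_trans (ler_wpM2l _ (cosB1_norm_le _)))//.
by rewrite normrM mulrCA -normrM -expr2 (ger0_norm (sqr_ge0 _)).
Qed.

(** By the half-angle formula, 1 - cos x = 2 sin^2 (x / 2). *)
Lemma cosB1_norm_le_sqr (x : R) : `|cos x - 1| <= x ^+ 2.
Proof.
have := cosD (x / 2) (x / 2); rewrite -splitr => ->.
have := cos2Dsin2 (x / 2); have h := sin_norm_le (x / 2).
have : sin (x / 2) ^+ 2 <= (x / 2) ^+ 2.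
  by rewrite -(real_normK (num_real (sin _))) -[leRHS](real_normK (num_real _)) lerXn2r ?nnegrE.
rewrite exprMn => h1 h2; rewrite ler_norml; have := sqr_ge0 x.
have := sqr_ge0 (sin (x / 2)); move: h1 h2.
move: (sin _) (cos _) => s c; rewrite -!expr2 exprVn.
have -> : (2 ^+ 2)^-1 = 1 / 4 :> R by field.
by move=> *; apply/andP; split; nra.
Qed.

(** The mean value theorem for y |-> sin (x y) - x y on [0, 1] reduces this to the bound |cos y - 1|
    <= |y|. *)
Lemma sin_sub_norm_le_sqr (x : R) : `|sin x - x| <= x ^+ 2.
Proof.
pose h (y : R) := sin (x * y) - x * y.
have dh (y : R) : is_derive y 1 h (x * cos (x * y) - (0 * y + x * 1)).
  apply: is_deriveB; first exact: (derive_scaled_l (is_derive_sin (x * y))).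
  exact: (derive_mul (is_derive_cst x y 1) (@is_derive_id _ _ y (1 : R))).
have ch : {within `[0, 1], continuous h}.
  by apply: derivable_within_continuous => z _; exact: ex_derive.
have [c cI] := MVT_segment ler01 (fun z _ => dh z) ch.
rewrite /h !mulr0 sin0 subrr !subr0 !mulr1 mul0r add0r => ->.
rewrite -[X in _ - X]mulr1 -mulrBr normrM (le_trans (ler_wpM2l _ (cosB1_norm_le _)))//.
rewrite normrM mulrA -normrM -expr2 (ger0_norm (sqr_ge0 _)) -[leRHS]mulr1.
rewrite ler_wpM2l ?sqr_ge0//; move: cI; rewrite in_itv/= => /andP[c0 c1].
by rewrite ger0_norm.
Qed.

Lemma re_exponent_integrable u :
  m.-integrable D (EFin \o (fun z => cos (u * f z) - 1)).
Proof.
apply: (@le_sqr_integrable _ (u ^+ 2)); first exact: measurable_funB.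
by move=> z; rewrite -exprMn cosB1_norm_le_sqr.
Qed.

Lemma im_exponent_integrable u :
  m.-integrable D (EFin \o (fun z => sin (u * f z) - u * f z)).
Proof.
apply: (@le_sqr_integrable _ (u ^+ 2)).
  by apply: measurable_funB => //; exact: measurable_funM.
by move=> z; rewrite -exprMn sin_sub_norm_le_sqr.
Qed.

Lemma derive_re_exponent (u : R) :
  is_derive u 1 re_exponent (- (v * u) - sin_moment u).
Proof.
have -> : - sin_moment u = \int[m]_(z in D) (f z * - sin (u * f z)).
  rewrite /sin_moment -mulN1r -RintegralZl//; last exact: sin_moment_integrable.
  by apply: eq_Rintegral => z _; rewrite mulN1r mulrN.
apply: is_deriveD.
  have dx := derive_exp 2 (@is_derive_id _ _ u (1 : R)).
  have := derive_mul (is_derive_cst (- (v / 2)) u 1) dx.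
  move=> h; apply: (derive_ext h) => [y|]; first by rewrite /=; ring.
  by rewrite mul0r add0r /=; field.
(* For |w - u| <= 1 the factor |w| is at most |u| + 1, whence the constant in [B]. *)
apply: (derive_under_integral (B := fun z => (`|u| + 1) * f z ^+ 2)
    (G := fun u z => cos (u * f z) - 1) (G' := fun u z => f z * - sin (u * f z))) => //.
- exact: re_exponent_integrable.
- move=> w z _; rewrite -[X in is_derive _ _ _ X]subr0.
  by apply: is_deriveB; exact: derive_scaled.
- by move=> z; rewrite mulr_ge0 ?addr_ge0 ?sqr_ge0.
- exact: rintegrableZ.
- move=> w z wu _; rewrite mulrN normrN normrM (le_trans (ler_wpM2l _ (sin_norm_le _)))//.
  rewrite normrM mulrCA -normrM -expr2 (ger0_norm (sqr_ge0 _)) ler_wpM2r ?sqr_ge0//.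
  by rewrite -lerBlDl (le_trans (lerB_dist _ _)).
Qed.

Lemma derive_im_exponent (u : R) : is_derive u 1 im_exponent (cos_moment u).
Proof.
apply: (derive_under_integral (B := fun z => (`|u| + 1) * f z ^+ 2)
    (G := fun u z => sin (u * f z) - u * f z) (G' := fun u z => f z * (cos (u * f z) - 1))) => //.
- exact: im_exponent_integrable.
- move=> w z _; rewrite mulrBr; apply: is_deriveB; first exact: derive_scaled.
  by apply: (derive_scaled (h := id)).
- by move=> z; rewrite mulr_ge0 ?addr_ge0 ?sqr_ge0.
- exact: rintegrableZ.
- move=> w z wu _; rewrite normrM (le_trans (ler_wpM2l _ (cosB1_norm_le _)))//.
  rewrite normrM mulrCA -normrM -expr2 (ger0_norm (sqr_ge0 _)) ler_wpM2r ?sqr_ge0//.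
  by rewrite -lerBlDl (le_trans (lerB_dist _ _)).
Qed.

Definition cos_transform (u : R) : R := \int[P]_w cos (u * X w).
Definition sin_transform (u : R) : R := \int[P]_w sin (u * X w).

Let mXsin u : measurable_fun setT (fun w => sin (u * X w)).
Proof. exact: measurableT_comp (continuous_measurable_fun (@continuous_sin R)) (measurable_funM _ mX). Qed.
Let mXcos u : measurable_fun setT (fun w => cos (u * X w)).
Proof. exact: measurableT_comp (continuous_measurable_fun (@continuous_cos R)) (measurable_funM _ mX). Qed.
Let iXsin u : P.-integrable setT (EFin \o (fun w => sin (u * X w))).
Proof. by apply: (bounded_rintegrable _ (K := 1)) => // w; exact: sin_norm_le1. Qed.
Let iXcos u : P.-integrable setT (EFin \o (fun w => cos (u * X w))).
Proof. by apply: (bounded_rintegrable _ (K := 1)) => // w; exact: cos_norm_le1. Qed.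
Let iX : P.-integrable setT (EFin \o X).
Proof. exact: sqr_rintegrable. Qed.

Lemma derive_cos_transform (u : R) :
  is_derive u 1 cos_transform (- (\int[P]_w (X w * sin (u * X w)))).
Proof.
have -> : - (\int[P]_w (X w * sin (u * X w))) = \int[P]_w (X w * - sin (u * X w)).
  rewrite -mulN1r -RintegralZl//.
    by apply: eq_Rintegral => w _; rewrite mulN1r mulrN.
  apply: (le_rintegrable measurableT _ (rintegrable_norm iX)); first exact: measurable_funM.
  by move=> w _; rewrite normrM ler_piMr// sin_norm_le1.
apply: (derive_under_integral (B := fun w => `|X w|) (G := fun u w => cos (u * X w))
   (G' := fun u w => X w * - sin (u * X w))) => //.
- by move=> w z _; exact: derive_scaled.
- exact: rintegrable_norm.
- by move=> w z _ _; rewrite mulrN normrN normrM ler_piMr// sin_norm_le1.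
Qed.

Lemma derive_sin_transform (u : R) :
  is_derive u 1 sin_transform (\int[P]_w (X w * cos (u * X w))).
Proof.
apply: (derive_under_integral (B := fun w => `|X w|) (G := fun u w => sin (u * X w))
   (G' := fun u w => X w * cos (u * X w))) => //.
- by move=> w z _; exact: derive_scaled.
- exact: rintegrable_norm.
- by move=> w z _ _; rewrite normrM ler_piMr// cos_norm_le1.
Qed.

(** By the addition formula, sin (u (x + f)) - sin (u x) is a combination of sin (u x) and cos (u x)
    whose coefficients depend on z alone, so the jump integral factors. *)
Lemma stein_sin (u : R) : \int[P]_w (X w * sin (u * X w)) =
  cos_moment u * sin_transform u - (- (v * u) - sin_moment u) * cos_transform u.
Proof.
rewrite (steinX (test_pair_sin u)) RintegralZl//.
rewrite (@eq_Rintegral _ _ _ _ _ (fun w =>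
   cos_moment u * sin (u * X w) + sin_moment u * cos (u * X w))) => [|w _].
  rewrite RintegralD//; [|exact: rintegrableZ..].
  by rewrite !RintegralZl// -/(sin_transform u) -/(cos_transform u); ring.
rewrite /jump_increment /cos_moment /sin_moment -RintegralZr//; last exact: cos_moment_integrable.
rewrite -RintegralZr//; last exact: sin_moment_integrable.
rewrite -RintegralD//; first last.
- apply: eq_rintegrable (rintegrableZ mD (cos (u * X w)) (sin_moment_integrable u)) => //.
  by move=> z _; rewrite mulrC.
- apply: eq_rintegrable (rintegrableZ mD (sin (u * X w)) (cos_moment_integrable u)) => //.
  by move=> z _; rewrite mulrC.
by apply: eq_Rintegral => z _; rewrite (mulrDr u) sinD; ring.
Qed.

Lemma stein_cos (u : R) : \int[P]_w (X w * cos (u * X w)) =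
  cos_moment u * cos_transform u + (- (v * u) - sin_moment u) * sin_transform u.
Proof.
have iXNsin : P.-integrable setT (EFin \o (fun w => - sin (u * X w))).
  by apply: eq_rintegrable (rintegrableZ measurableT (-1) (iXsin u)) => // w _; rewrite mulN1r.
rewrite (steinX (test_pair_cos u)) RintegralZl//.
have -> : \int[P]_w (- sin (u * X w)) = - sin_transform u.
  rewrite -mulN1r -RintegralZl//.
  by apply: eq_Rintegral => w _; rewrite mulN1r.
rewrite (@eq_Rintegral _ _ _ _ _ (fun w =>
   cos_moment u * cos (u * X w) + (- sin_moment u) * sin (u * X w))) => [|w _].
  rewrite RintegralD//; [|exact: rintegrableZ..].
  by rewrite !RintegralZl// -/(sin_transform u) -/(cos_transform u); ring.
rewrite /jump_increment /cos_moment /sin_moment mulNr -mulrN.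
rewrite -RintegralZr//; last exact: cos_moment_integrable.
rewrite -RintegralZr//; last exact: sin_moment_integrable.
rewrite -RintegralD//; first last.
- apply: eq_rintegrable (rintegrableZ mD (- sin (u * X w)) (sin_moment_integrable u)) => //.
  by move=> z _; rewrite mulrC.
- apply: eq_rintegrable (rintegrableZ mD (cos (u * X w)) (cos_moment_integrable u)) => //.
  by move=> z _; rewrite mulrC.
by apply: eq_Rintegral => z _; rewrite (mulrDr u) cosD; ring.
Qed.

Lemma exponents0 : re_exponent 0 = 0 /\ im_exponent 0 = 0.
Proof.
split.
  rewrite /re_exponent expr0n/= mulr0 mul0r oppr0 add0r.
  rewrite (@eq_Rintegral _ _ _ _ _ (fun=> 0)) => [|z _]; last by rewrite mul0r cos0 subrr.
  by rewrite Rintegral_cst// mul0r.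
rewrite /im_exponent (@eq_Rintegral _ _ _ _ _ (fun=> 0)) => [|z _]; last first.
  by rewrite mul0r sin0 subrr.
by rewrite Rintegral_cst// mul0r.
Qed.

(* With phi = cos_transform + i sin_transform and psi = re_exponent + i im_exponent,
   the identities stein_sin and stein_cos say phi' = psi' phi, so that the real
   and imaginary parts of exp(- psi) phi are constant. *)
Lemma characteristic_function_exponent (u : R) :
  cos_transform u = expR (re_exponent u) * cos (im_exponent u) /\
  sin_transform u = expR (re_exponent u) * sin (im_exponent u).
Proof.
pose re' (u : R) := - (v * u) - sin_moment u.
have de (x : R) : is_derive x 1 (fun x => expR (- re_exponent x))
    (- re' x * expR (- re_exponent x)).
  have dre := is_deriveN (derive_re_exponent x).
  have := @is_derive1_comp _ expR (fun x => - re_exponent x) x _ _ (is_derive_expR _) dre.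
  by rewrite mulrC.
have dc (x : R) : is_derive x 1 (fun x => cos (im_exponent x))
    (- sin (im_exponent x) * cos_moment x).
  exact: (@is_derive1_comp _ cos im_exponent x _ _ (is_derive_cos _) (derive_im_exponent x)).
have ds (x : R) : is_derive x 1 (fun x => sin (im_exponent x))
    (cos (im_exponent x) * cos_moment x).
  exact: (@is_derive1_comp _ sin im_exponent x _ _ (is_derive_sin _) (derive_im_exponent x)).
pose A (x : R) := expR (- re_exponent x) *
  (cos_transform x * cos (im_exponent x) + sin_transform x * sin (im_exponent x)).
pose B (x : R) := expR (- re_exponent x) *
  (sin_transform x * cos (im_exponent x) - cos_transform x * sin (im_exponent x)).
have dct (x : R) : is_derive x 1 cos_transform
    (re' x * cos_transform x - cos_moment x * sin_transform x).
  by have := derive_cos_transform x; rewrite stein_sin opprB.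
have dst (x : R) : is_derive x 1 sin_transform
    (cos_moment x * cos_transform x + re' x * sin_transform x).
  by have := derive_sin_transform x; rewrite stein_cos.
have dA (x : R) : is_derive x 1 A 0.
  apply: (derive_ext (derive_mul (de x) (is_deriveD (derive_mul (dct x) (dc x))
    (derive_mul (dst x) (ds x))))) => //.
  rewrite !fctE; ring.
have dB (x : R) : is_derive x 1 B 0.
  apply: (derive_ext (derive_mul (de x) (is_deriveB (derive_mul (dst x) (dc x))
    (derive_mul (dct x) (ds x))))) => //.
  rewrite !fctE; ring.
have [re0 im0] := exponents0.
have c0 : cos_transform 0 = 1.
  rewrite /cos_transform (@eq_Rintegral _ _ _ _ _ (fun=> 1)) => [|w _]; last by rewrite mul0r cos0.
  exact: Rintegral_probability_cst.
have s0 : sin_transform 0 = 0.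
  rewrite /sin_transform (@eq_Rintegral _ _ _ _ _ (fun=> 0)) => [|w _]; last by rewrite mul0r sin0.
  exact: Rintegral_probability_cst.
have A1 : A u = 1.
  rewrite (is_derive_0_is_cst u 0 dA) /A re0 im0 c0 s0 oppr0 expR0 cos0 sin0.
  by rewrite !(mulr1, mulr0, mul0r, addr0).
have B0 : B u = 0.
  rewrite (is_derive_0_is_cst u 0 dB) /B re0 im0 c0 s0 oppr0 expR0 cos0 sin0.
  by rewrite !(mulr1, mulr0, mul0r, subrr).
have ee : expR (re_exponent u) * expR (- re_exponent u) = 1 by rewrite -expRD subrr expR0.
(* The constants 1 and 0 are the coordinates of the transform after a rotation and a scaling;
   undoing the rotation uses cos^2 + sin^2 = 1. *)
have cs := cos2Dsin2 (im_exponent u).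
rewrite -[cos_transform u]mul1r -[sin_transform u]mul1r -ee.
move: A1 B0 cs; rewrite /A /B.
move: (expR (re_exponent u)) (expR (- re_exponent u)) (cos (im_exponent u))
  (sin (im_exponent u)) (cos_transform u) (sin_transform u) => e e' c s p q A1 B0 cs.
split.
  transitivity (e * (c * (e' * (p * c + q * s)) - s * (e' * (q * c - p * s)))).
    by rewrite -[LHS]mulr1 -cs; ring.
  by rewrite A1 B0 mulr1 mulr0 subr0.
transitivity (e * (s * (e' * (p * c + q * s)) + c * (e' * (q * c - p * s)))).
  by rewrite -[LHS]mulr1 -cs; ring.
by rewrite A1 B0 mulr1 mulr0 addr0.
Qed.

Lemma log_characteristic_exponent :
  log_characteristic_function P X re_exponent im_exponent.
Proof.
have [re0 im0] := exponents0; split => //; apply: near0W => u.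
- split.
    exact: is_derive_continuous (derive_re_exponent u).
  exact: is_derive_continuous (derive_im_exponent u).
- exact: characteristic_function_exponent.
Qed.

Section cumulants.
Hypothesis fN : forall n, (2 <= n)%N ->
  m.-integrable D (EFin \o (fun z => `|f z| ^+ n)).

Definition dcos_moment (n p : nat) (u : R) : R :=
  \int[m]_(z in D) (f z ^+ n * dcos p (u * f z)).

Lemma dcos_continuous p : continuous (@dcos R p).
Proof.
by move=> x; exact: is_derive_continuous (derive_dcos p x).
Qed.

Lemma derive_dcos_moment n p (u : R) : (2 <= n)%N ->
  is_derive u 1 (dcos_moment n p) (dcos_moment n.+1 p.+1 u).
Proof.
move=> n2.
apply: (derive_under_integral (B := fun z => `|f z| ^+ n.+1)
   (G := fun u z => f z ^+ n * dcos p (u * f z))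
   (G' := fun u z => f z ^+ n.+1 * dcos p.+1 (u * f z))) => //.
- move=> w; apply: (le_rintegrable mD _ (fN n2)).
    apply: measurable_funM; first exact: measurable_funX.
    exact: measurable_trig (@dcos_continuous p).
  by move=> z _; rewrite normrM normrX ler_piMr ?exprn_ge0// dcos_norm_le1.
- move=> w z _; have := derive_mul (is_derive_cst (f z ^+ n) w 1)
    (derive_scaled (derive_dcos p (w * f z))).
  by rewrite mul0r add0r mulrA -exprSr.
- by apply: fN; lia.
- by move=> w z _ _; rewrite normrM normrX ler_piMr ?exprn_ge0// dcos_norm_le1.
Qed.

Lemma derive1_fun (g g' : R -> R) : (forall u : R, is_derive u 1 g (g' u)) -> derive1 g = g'.
Proof. by move=> dg; apply/funext => u; rewrite derive1E (@derive_val _ _ _ _ _ _ _ (dg u)). Qed.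

(** The first derivatives contain f to the power one, which is integrable only together with the
    smallness of sin (u f) or of cos (u f) - 1. The passage to order two is therefore separate; from
    there on all derivatives belong to the family [dcos_moment]. *)
Let d_re1 (u : R) : is_derive u 1 (fun u => - (v * u) - sin_moment u) (- v + dcos_moment 2 2 u).
Proof.
have -> : - v + dcos_moment 2 2 u = - (0 * u + v * 1) - \int[m]_(z in D) (f z * (f z * cos (u * f z))).
  rewrite mul0r add0r mulr1; congr (_ + _).
  rewrite -mulN1r -RintegralZl//.
    apply: eq_Rintegral => z _.
    by rewrite /dcos/=; ring.
  apply: (@le_sqr_integrable _ 1); first by do 2 apply: measurable_funM => //.
  move=> z; rewrite mulrA -expr2 normrM (ger0_norm (sqr_ge0 _)) mul1r.
  by rewrite ler_piMr ?sqr_ge0// cos_norm_le1.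
apply: is_deriveB.
  exact: is_deriveN (derive_mul (is_derive_cst v u 1) (@is_derive_id _ _ u (1 : R))).
apply: (derive_under_integral (B := fun z => f z ^+ 2) (G := fun u z => f z * sin (u * f z))
   (G' := fun u z => f z * (f z * cos (u * f z)))) => //.
- exact: sin_moment_integrable.
- move=> w z _; have := derive_mul (is_derive_cst (f z) w 1)
    (derive_scaled (is_derive_sin (w * f z))).
  by rewrite mul0r add0r.
- by move=> z; exact: sqr_ge0.
- move=> w z _ _; rewrite mulrA -expr2 normrM (ger0_norm (sqr_ge0 _)).
  by rewrite ler_piMr ?sqr_ge0// cos_norm_le1.
Qed.

Let d_im1 (u : R) : is_derive u 1 cos_moment (- dcos_moment 2 3 u).
Proof.
have -> : - dcos_moment 2 3 u = \int[m]_(z in D) (f z * (f z * - sin (u * f z))).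
  rewrite -mulN1r -RintegralZl//.
    apply: eq_Rintegral => z _.
    by rewrite /dcos/=; ring.
  apply: (@le_sqr_integrable _ 1).
    by apply: measurable_funM; [exact: measurable_funX|exact: measurable_trig (@dcos_continuous 3)].
  move=> z; rewrite normrM (ger0_norm (sqr_ge0 _)) mul1r.
  by rewrite ler_piMr ?sqr_ge0// dcos_norm_le1.
apply: (derive_under_integral (B := fun z => f z ^+ 2) (G := fun u z => f z * (cos (u * f z) - 1))
   (G' := fun u z => f z * (f z * - sin (u * f z)))) => //.
- exact: cos_moment_integrable.
- move=> w z _; have := derive_mul (is_derive_cst (f z) w 1)
    (is_deriveB (derive_scaled (is_derive_cos (w * f z))) (is_derive_cst (1 : R) w 1)).
  by rewrite mul0r add0r subr0.
- by move=> z; exact: sqr_ge0.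
- move=> w z _ _; rewrite mulrA -expr2 normrM (ger0_norm (sqr_ge0 _)).
  by rewrite normrN ler_piMr ?sqr_ge0// sin_norm_le1.
Qed.

Lemma derive1n_re_exponent n : derive1n n.+2 re_exponent =
  fun u => (if n == 0%N then - v else 0) + dcos_moment n.+2 n.+2 u.
Proof.
elim: n => [|n IH].
  rewrite 2!derive1nS derive1n0 (derive1_fun derive_re_exponent).
  exact: derive1_fun d_re1.
rewrite derive1nS IH; apply: derive1_fun => u.
apply: (derive_ext (is_deriveD (is_derive_cst (if n == 0%N then - v else 0) u 1)
  (derive_dcos_moment n.+2 u (n := n.+2) isT))) => //.
Qed.

(** The sign and the second index, one above the order, both come from sin = - cos'. *)
Lemma derive1n_im_exponent n : derive1n n.+2 im_exponent =
  fun u => - dcos_moment n.+2 n.+3 u.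
Proof.
elim: n => [|n IH].
  rewrite 2!derive1nS derive1n0 (derive1_fun derive_im_exponent).
  exact: derive1_fun d_im1.
rewrite derive1nS IH; apply: derive1_fun => u.
by apply: is_deriveN; exact: derive_dcos_moment.
Qed.

Lemma n_times_derivable_exponents n :
  n_times_derivable n re_exponent /\ n_times_derivable n im_exponent.
Proof.
split=> k _; apply: near0W => u; case: k => [|[|k]].
- by rewrite derive1n0; exact: is_derive_derivable (derive_re_exponent u).
- by rewrite derive1n1 (derive1_fun derive_re_exponent); exact: is_derive_derivable (d_re1 u).
- rewrite derive1n_re_exponent; apply: derivableD; first exact: derivable_cst.
  exact: is_derive_derivable (derive_dcos_moment k.+2 u (n := k.+2) isT).
- by rewrite derive1n0; exact: is_derive_derivable (derive_im_exponent u).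
- by rewrite derive1n1 (derive1_fun derive_im_exponent); exact: is_derive_derivable (d_im1 u).
- rewrite derive1n_im_exponent; apply: derivableN.
  exact: is_derive_derivable (derive_dcos_moment k.+3 u (n := k.+2) isT).
Qed.

Lemma dcos_moment0 n p : (2 <= n)%N -> dcos_moment n p 0 =
  (if odd p then 0 else (-1) ^+ p./2) * \int[m]_(z in D) f z ^+ n.
Proof.
move=> n2; rewrite -RintegralZl//.
  by apply: eq_Rintegral => z _; rewrite mul0r dcos0 mulrC.
apply: (le_rintegrable mD _ (fN n2)); first exact: measurable_funX.
by move=> z _; rewrite normrX.
Qed.

Lemma stein_cumulants n : (0 < n)%N ->
  is_cumulant P X n (stein_cumulant m D f v n).
Proof.
move=> n0; exists re_exponent, im_exponent.
have [dre dim] := n_times_derivable_exponents n.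
split=> //; first exact: log_characteristic_exponent.
(* Order 1 is the derivative of the imaginary exponent at 0, [cos_moment 0 = 0]; the higher orders
   use the closed forms. *)
case: n n0 {dre dim} => [//|[|n]] _.
  rewrite derive1n1 (derive1_fun derive_im_exponent) /= expr0 mul1r /stein_cumulant/=.
  rewrite /cos_moment (@eq_Rintegral _ _ _ _ _ (fun=> 0)) => [|z _]; last first.
    by rewrite mul0r cos0 subrr mulr0.
  by rewrite Rintegral_cst// mul0r.
rewrite derive1n_re_exponent derive1n_im_exponent !dcos_moment0//.
(* The power of -1 in [is_cumulant] meets the one from [dcos] at 0: they cancel at even orders, and
   at odd orders they do so together with the minus sign of the imaginary part. *)
have sq k : (-1) ^+ k * (-1) ^+ k = 1 :> R.
  by rewrite -exprD addnn -mul2n exprM sqrrN !expr1n.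
rewrite /= negbK; case: ifP => on.
  rewrite /stein_cumulant/= (_ : (n.+2 == 2%N) = false); last by case: n on.
  rewrite (_ : uphalf n = n./2.+1); last by rewrite uphalf_half on.
  by rewrite on /= [X in - (X * _)]exprS mulN1r mulNr opprK mulrA sq mul1r.
rewrite /stein_cumulant/= ?on; case: n on => [|n] on /=.
  by rewrite expr1; ring.
by rewrite add0r mulrA ?sq ?mul1r.
Qed.

End cumulants.

End log_characteristic.

(** * Stein operators and independence *)

Section joint_law.
Context d (Om : measurableType d) (R : realType) (P : probability Om R).
Local Open Scope ereal_scope.

Lemma RV_of (Y : Om -> R) : measurable_fun setT Y -> exists Y' : {RV P >-> R}, Y' = Y :> (Om -> R).
Proof.
move=> mY.
pose Y' : {mfun Om >-> R} := HB.pack Y (isMeasurableFun.Build _ _ _ _ Y mY).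
by exists Y'.
Qed.

(** Rectangles are stable under intersection and generate the product sigma-algebra, so two finite
    measures that agree on them coincide. The event [E] will hold the variables not yet summed. *)
Lemma pair_law (Y Z : {RV P >-> R}) (E : set Om) : measurable E ->
  (forall A B, measurable A -> measurable B ->
    P ((Y @^-1` A `&` Z @^-1` B) `&` E) = P (Y @^-1` A) * P (Z @^-1` B) * P E) ->
  forall C, measurable C ->
    P ([set w | C (Y w, Z w)] `&` E) =
    (distribution P Y \x distribution P Z) C * P E.
Proof.
move=> mE h C mC.
have YZE : measurable_fun setT (fun w => (Y w, Z w)) by exact: measurable_fun_pair.
pose YZ : {mfun Om >-> (R * R)%type} :=
  HB.pack (fun w => (Y w, Z w)) (isMeasurableFun.Build _ _ _ _ (fun w => (Y w, Z w)) YZE).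
have PE0 : (0 <= fine (P E))%R by exact: fine_ge0.
have PEE : (fine (P E))%:E = P E by rewrite fineK// fin_num_measure.
pose c : {nonneg R} := NngNum PE0.
pose m1' : {measure set (R * R) -> \bar R} := pushforward (mrestr P mE) YZ.
pose m1 := m1' YZE.
pose m2 : {measure set (R * R) -> \bar R} := mscale c (distribution P Y \x distribution P Z).
suff: m1 C = m2 C by rewrite /m1 /m1' /m2 /= /pushforward /mrestr /mscale/= PEE muleC.
pose G : set (set (R * R)) :=
  [set A `*` B | A in @measurable _ R & B in @measurable _ R].
apply: (measure_unique G (fun=> setT)) => //.
- by rewrite measurable_prod_measurableType.
- move=> _ _ [A mA [B mB <-]] [A' mA' [B' mB' <-]].
  rewrite -setXI; exists (A `&` A'); first exact: measurableI.
  by exists (B `&` B') => //; exact: measurableI.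
- by move=> n; exists setT => //; exists setT => //; rewrite setXTT.
- by rewrite bigcup_const.
- move=> _ [A mA [B mB <-]].
  rewrite /m1 /m1' /m2 /= /pushforward /mrestr /mscale/= product_measure1E//= PEE muleC.
  by rewrite -h.
- move=> n; rewrite /m1 /m1'/= /pushforward /mrestr preimage_setT setTI.
  by rewrite (le_lt_trans (probability_le1 P mE))// ltry.
Qed.

Definition independent_pair (Y Z : Om -> R) := forall A B, measurable A -> measurable B ->
  P (Y @^-1` A `&` Z @^-1` B) = P (Y @^-1` A) * P (Z @^-1` B).

Lemma independent_pair_sym (Y Z : Om -> R) : independent_pair Y Z -> independent_pair Z Y.
Proof. by move=> h A B mA mB; rewrite setIC h// muleC. Qed.

Lemma independent_pair_law (Y Z : {RV P >-> R}) : independent_pair Y Z ->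
  forall C, measurable C ->
  P [set w | C (Y w, Z w)] = (distribution P Y \x distribution P Z) C.
Proof.
move=> h C mC; have := @pair_law Y Z setT measurableT _ C mC.
rewrite setIT (@probability_setT _ _ _ P) mule1; apply => A B mA mB.
by rewrite setIT h// mule1.
Qed.

End joint_law.

(** Independence makes the joint law a product, and Fubini integrates over Y first, with Z frozen.
    The growth bound, uniform in z, gives integrability. *)
Lemma independent_Rintegral_eq0 d (Om : measurableType d) (R : realType)
    (P : probability Om R) (Y Z : Om -> R) (F : R * R -> R) (K : R) :
  measurable_fun setT Y -> measurable_fun setT Z -> independent_pair P Y Z ->
  P.-integrable setT (EFin \o Y) -> measurable_fun setT F ->
  (forall y z, `|F (y, z)| <= K * (1 + `|y|)) ->
  (forall z, \int[P]_w F (Y w, z) = 0) -> \int[P]_w F (Y w, Z w) = 0.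
Proof.
move=> mY mZ + iY mF FK F0.
have [Y' YE] := RV_of P mY; have [Z' ZE] := RV_of P mZ.
rewrite -YE -ZE => hYZ; rewrite -{}YE in mY iY F0; rewrite -{}ZE in mZ.
have mYZ : measurable_fun setT (fun w => (Y' w, Z' w)) by exact: measurable_fun_pair.
pose YZ : {mfun Om >-> (R * R)%type} :=
  HB.pack (fun w => (Y' w, Z' w)) (isMeasurableFun.Build _ _ _ _ (fun w => (Y' w, Z' w)) mYZ).
have iF : P.-integrable setT (EFin \o (fun w => F (Y' w, Z' w))).
  apply: (le_rintegrable measurableT (g := fun w => K * (1 + `|Y' w|))).
  - exact: measurableT_comp.
  - apply: rintegrableZ => //; apply: rintegrableD => //; first exact: rintegrable_cst.
    exact: rintegrable_norm.
  - by move=> w _.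
pose m12 := (distribution P Y' \x distribution P Z')%E.
have lawE (A : set (R * R)) : measurable A -> A `<=` setT -> m12 A = distribution P YZ A.
  by move=> mA _; rewrite /m12 -(independent_pair_law hYZ).
have mEF : measurable_fun setT (EFin \o F) by exact/measurable_EFinP.
have e1 : (\int[P]_w (F (Y' w, Z' w))%:E = \int[m12]_x (F x)%:E)%E.
  rewrite (eq_measure_integral (distribution P YZ))//.
  by rewrite integral_pushforward.
have i12 : m12.-integrable setT (EFin \o F).
  apply/integrableP; split => //.
  rewrite (eq_measure_integral (distribution P YZ))//.
  rewrite ge0_integral_pushforward//; last exact: measurableT_comp.
  by have /integrableP[] := iF.
rewrite /Rintegral e1 -(integral21_prod_meas1 i12).
rewrite (eq_integral (fun=> 0%E)) ?integral0// => z _; rewrite /fubini_G.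
have mFz : measurable_fun setT (fun y => (F (y, z))%:E).
  apply/measurable_EFinP; apply: measurableT_comp => //.
have iFz : P.-integrable setT (EFin \o (fun w => F (Y' w, z))).
  apply: (le_rintegrable measurableT (g := fun w => K * (1 + `|Y' w|))).
  - apply: (measurableT_comp (f := fun y => F (y, z))) => //.
    by apply: measurableT_comp => //.
  - apply: rintegrableZ => //; apply: rintegrableD => //; first exact: rintegrable_cst.
    exact: rintegrable_norm.
  - by move=> w _.
by rewrite integral_distribution// -(EFin_Rintegral measurableT)// F0.
Qed.

Section stein_operators.
Context d (Om : measurableType d) (R : realType) (P : probability Om R).
Implicit Types (op : (R -> R) -> (R -> R) -> R -> R) (Y Z : Om -> R).

(* Translation invariance is what lets Stein operators be added along sums of
   independent variables, by freezing one of them. *)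
Definition stein_op op :=
  (forall h h', test_pair h h' -> bounded_lipschitz (op h h')) /\
  (forall h h' z x, op (fun y => h (y + z)) (fun y => h' (y + z)) x = op h h' (x + z)).

Definition has_stein_op Y op := [/\ measurable_fun setT Y,
  P.-integrable setT (EFin \o (fun w => Y w ^+ 2)), stein_op op &
  forall h h', test_pair h h' -> \int[P]_w (Y w * h (Y w) - op h h' (Y w)) = 0].

Definition op_add op1 op2 (h h' : R -> R) (x : R) := op1 h h' x + op2 h h' x.
Definition op_zero (h h' : R -> R) (x : R) : R := 0.
Definition op_jump (a lambda : R) (h h' : R -> R) (x : R) := lambda * a * (h (x + a) - h x).
Definition op_gauss (v : R) (h h' : R -> R) (x : R) := v * h' x.

Lemma bounded_lipschitz_shift (h : R -> R) z : bounded_lipschitz h ->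
  bounded_lipschitz (fun x => h (x + z)).
Proof.
move=> [K K0 [hb hl]]; exists K => //; split => // x y.
by apply: le_trans (hl _ _) _; rewrite opprD addrACA subrr addr0.
Qed.

Lemma test_pair_shift (h h' : R -> R) z : test_pair h h' ->
  test_pair (fun x => h (x + z)) (fun x => h' (x + z)).
Proof.
move=> [h1 h2 dh]; split; [exact: bounded_lipschitz_shift..|move=> x].
rewrite -[h' _]mulr1; apply: (@is_derive1_comp _ h (fun t => t + z)).
by apply: is_derive_eq; rewrite addr0.
Qed.

Lemma stein_op_add op1 op2 : stein_op op1 -> stein_op op2 -> stein_op (op_add op1 op2).
Proof.
move=> [b1 s1] [b2 s2]; split=> [h h' hh|h h' z x].
  by apply: bounded_lipschitzD; [exact: b1|exact: b2].
by rewrite /op_add s1 s2.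
Qed.

Lemma stein_op_zero : stein_op op_zero.
Proof. by split=> // h h' _; exact: bounded_lipschitz_cst. Qed.

Lemma stein_op_jump a lambda : stein_op (op_jump a lambda).
Proof.
split=> [h h' [h1 _ _]|h h' z x]; last by rewrite /op_jump addrAC.
apply: bounded_lipschitzM; first exact: bounded_lipschitz_cst.
apply: bounded_lipschitzD; first exact: bounded_lipschitz_shift.
have := bounded_lipschitzM (bounded_lipschitz_cst (-1)) h1.
by congr bounded_lipschitz; apply/funext => x; rewrite mulN1r.
Qed.

Lemma stein_op_gauss v : stein_op (op_gauss v).
Proof.
split=> [h h' [_ h2 _]|//].
by apply: bounded_lipschitzM => //; exact: bounded_lipschitz_cst.
Qed.

Lemma sqr_integrable_add Y Z : measurable_fun setT Y -> measurable_fun setT Z ->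
  P.-integrable setT (EFin \o (fun w => Y w ^+ 2)) ->
  P.-integrable setT (EFin \o (fun w => Z w ^+ 2)) ->
  P.-integrable setT (EFin \o (fun w => (Y w + Z w) ^+ 2)).
Proof.
move=> mY mZ Y2 Z2.
apply: (le_rintegrable measurableT (g := fun w => 2 * Y w ^+ 2 + 2 * Z w ^+ 2)).
- by apply: measurable_funX; exact: measurable_funD.
- by apply: rintegrableD => //; exact: rintegrableZ.
- by move=> w _; rewrite ger0_norm ?sqr_ge0//; have := sqr_ge0 (Y w - Z w); nra.
Qed.

Lemma stein_shifted Y Z op h h' : measurable_fun setT Z -> independent_pair P Y Z ->
  has_stein_op Y op -> test_pair h h' ->
  \int[P]_w (Y w * h (Y w + Z w) - op h h' (Y w + Z w)) = 0.
Proof.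
move=> mZ YZ [mY Y2 [b s] hY] hh.
have [K K0 [ob ol]] := b _ _ hh; have [L L0 [hb hl _ _ _]] := test_pair_increment hh.
have mh := lipschitz_measurable hl; have mo := lipschitz_measurable ol.
apply: (@independent_Rintegral_eq0 _ _ _ P Y Z
  (fun p => p.1 * h (p.1 + p.2) - op h h' (p.1 + p.2)) (K + L)) => //.
- exact: sqr_rintegrable.
- have mp : measurable_fun setT (fun p : R * R => p.1 + p.2) by exact: measurable_funD.
  apply: measurable_funB; last exact: measurableT_comp mo mp.
  by apply: measurable_funM => //; exact: measurableT_comp mh mp.
- move=> y z /=; apply: le_trans (ler_normB _ _) _; rewrite normrM.
  have := ler_wpM2l (normr_ge0 y) (hb (y + z)); have := ob (y + z).
  have := normr_ge0 y; nra.
- move=> z /=; rewrite -[RHS](hY _ _ (test_pair_shift z hh)).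
  by apply: eq_Rintegral => w _; rewrite s.
Qed.

Lemma has_stein_op_add Y Z op1 op2 : independent_pair P Y Z ->
  has_stein_op Y op1 -> has_stein_op Z op2 ->
  has_stein_op (fun w => Y w + Z w) (op_add op1 op2).
Proof.
move=> YZ hY hZ; have [mY Y2 s1 _] := hY; have [mZ Z2 s2 _] := hZ.
split.
- exact: measurable_funD.
- exact: sqr_integrable_add.
- exact: stein_op_add.
move=> h h' hh.
have iS (U V : Om -> R) op : measurable_fun setT U -> measurable_fun setT V ->
    P.-integrable setT (EFin \o (fun w => U w ^+ 2)) -> stein_op op ->
    P.-integrable setT (EFin \o (fun w => U w * h (V w) - op h h' (V w))).
  move=> mU mV U2 [b s].
  have [K K0 [ob ol]] := b _ _ hh; have [L L0 [hb hl _ _ _]] := test_pair_increment hh.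
  have mh := lipschitz_measurable hl; have mo := lipschitz_measurable ol.
  apply: rintegrableB => //; last first.
    by apply: (@bounded_rintegrable _ _ _ _ _ K) => //; exact: measurableT_comp.
  apply: (le_rintegrable measurableT (g := fun w => L * `|U w|)).
  - by apply: measurable_funM => //; exact: measurableT_comp.
  - by apply: rintegrableZ => //; exact: rintegrable_norm (sqr_rintegrable mU U2).
  - by move=> w _; rewrite normrM mulrC ler_wpM2r.
have mS : measurable_fun setT (fun w => Y w + Z w) by exact: measurable_funD.
have e1 := stein_shifted mZ YZ hY hh.
have e2' : \int[P]_w (Z w * h (Y w + Z w) - op2 h h' (Y w + Z w)) = 0.
  by rewrite -[RHS](stein_shifted mY (independent_pair_sym YZ) hZ hh);
    apply: eq_Rintegral => w _; rewrite (addrC (Z w)).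
(* The identity with Z frozen and the one with Y frozen add up to the identity of the sum. *)
rewrite -[RHS]addr0 -{1}e1 -e2' -RintegralD//; [|exact: iS..].
by apply: eq_Rintegral => w _; rewrite /op_add; ring.
Qed.

Lemma has_stein_op_zero : has_stein_op (fun=> 0) op_zero.
Proof.
split.
- exact: measurable_cst.
- exact: rintegrable_cst.
- exact: stein_op_zero.
- move=> h h' _; rewrite (@eq_Rintegral _ _ _ _ _ (fun=> 0)) => [|w _].
    exact: Rintegral_probability_cst.
  by rewrite mul0r subrr.
Qed.

Definition independent_sequence n (Y : nat -> Om -> R) := forall B : nat -> set R,
  (forall i, measurable (B i)) ->
  P [set w | forall i, (i < n)%N -> B i (Y i w)] = (\prod_(i < n) P (Y i @^-1` B i))%E.

Definition tail_event n (Y : nat -> Om -> R) k (B : nat -> set R) : set Om :=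
  [set w | forall i, (k <= i < n)%N -> B i (Y i w)].

Lemma tail_event_recl n (Y : nat -> Om -> R) k B : (k < n)%N ->
  tail_event n Y k B = Y k @^-1` B k `&` tail_event n Y k.+1 B.
Proof.
move=> kn; apply/seteqP; split=> w /=.
  move=> h; split=> [|i /andP[ki i_n]]; first by apply: h; rewrite leqnn.
  by apply: h; rewrite i_n ltnW.
move=> [h1 h2] i /andP[]; rewrite leq_eqVlt => /predU1P[<- //|ki i_n].
by apply: h2; rewrite ki.
Qed.

Lemma measurable_tail_event n (Y : nat -> Om -> R) k B :
  (forall i, measurable_fun setT (Y i)) -> (forall i, measurable (B i)) ->
  measurable (tail_event n Y k B).
Proof.
move=> mY mB; have [kn|nk] := leqP k n; last first.
  rewrite (_ : tail_event _ _ _ _ = setT)//; apply/seteqP; split => // w _ i /andP[ki i_n].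
  by move: (leq_ltn_trans ki (ltn_trans i_n nk)); rewrite ltnn.
rewrite -(subKn kn); elim: (n - k)%N (leq_subr k n) => [_|j IH jn].
  rewrite subn0 (_ : tail_event _ _ _ _ = setT)//; apply/seteqP; split => // w _ i /andP[ki i_n].
  by move: (leq_ltn_trans ki i_n); rewrite ltnn.
rewrite tail_event_recl; last by lia.
apply: measurableI.
  by rewrite -[X in measurable X]setTI; exact: mY.
by rewrite subnSK//; apply: IH; lia.
Qed.

(** Independence of the partial sum from the next variable alone would not pass through the
    induction, so all later variables are kept in a tail event. *)
Lemma partial_sum_tail_law n (Y : nat -> Om -> R) :
  (forall i, measurable_fun setT (Y i)) -> independent_sequence n Y ->
  forall k, (k <= n)%N -> forall A B, measurable A -> (forall i, measurable (B i)) ->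
  P ([set w | A (\sum_(i < k) Y i w)] `&` tail_event n Y k B) =
  (P [set w | A (\sum_(i < k) Y i w)%R] * \prod_(k <= i < n) P (Y i @^-1` B i))%E.
Proof.
move=> mY hY; elim=> [_ A B mA mB|k IH kn A B mA mB].
  have -> : [set w : Om | A (\sum_(i < 0) Y i w)] = [set w | A 0].
    by apply/seteqP; split=> w /=; rewrite big_ord0.
  have [A0|nA0] := pselect (A 0).
    rewrite (_ : [set w | A 0] = setT); last by apply/seteqP; split.
    rewrite setTI (@probability_setT _ _ _ P) mul1e big_mkord -hY//.
  rewrite (_ : [set w | A 0] = set0); last by apply/seteqP; split.
  by rewrite set0I measure0 mul0e.
have mS : measurable_fun setT (fun w => \sum_(i < k) Y i w) by exact: measurable_sum.
have [S SE] := RV_of P mS; have [Yk YE] := RV_of P (mY k).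
pose E := tail_event n Y k.+1 B.
have mE : measurable E by exact: measurable_tail_event.
have IHS A' B' (B'' : nat -> set R) : measurable A' -> measurable B' ->
    (forall i, measurable (B'' i)) ->
    P ((S @^-1` A' `&` Yk @^-1` B') `&` tail_event n Y k.+1 B'') =
    (P (S @^-1` A') * P (Yk @^-1` B') * \prod_(k.+1 <= i < n) P (Y i @^-1` B'' i))%E.
  (* Choosing B' as the k-th set extracts the k-th variable from the tail of the induction
     hypothesis. *)
  move=> mA' mB' mB''; have := IH (ltnW kn) A' (fun i => if i == k then B' else B'' i) mA'.
  rewrite tail_event_recl// eqxx setIA SE YE.
  have -> : tail_event n Y k.+1 (fun i => if i == k then B' else B'' i) =
    tail_event n Y k.+1 B''.
    apply/seteqP; split=> w h i /andP[ki i_n].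
      by have := h i; rewrite ki i_n/= gtn_eqF//; apply.
    by rewrite gtn_eqF//; apply: h; rewrite ki.
  move=> -> => [|i]; last by case: ifP.
  rewrite big_ltn// eqxx muleA; congr (_ * _)%E.
  by apply: eq_big_nat => i /andP[ki _]; rewrite gtn_eqF.
have PE : P E = (\prod_(k.+1 <= i < n) P (Y i @^-1` B i))%E.
  have := IHS setT setT B measurableT measurableT mB.
  by rewrite !preimage_setT setTI setTI (@probability_setT _ _ _ P) !mul1e.
(* The event for the next partial sum is an event for the pair (S, Yk), whose joint law restricted
   to [E] is a product. *)
pose C : set (R * R) := [set p | A (p.1 + p.2)].
have mC : measurable C.
  rewrite -[X in measurable X]setTI.
  by apply: (measurable_funD (f := fst) (g := snd)) mA => //.
have CE : [set w | A (\sum_(i < k.+1) Y i w)] = [set w | C (S w, Yk w)].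
  by rewrite SE YE; apply/seteqP; split=> w /=; rewrite /C/= big_ord_recr.
rewrite CE -/E (pair_law mE _ mC); last first.
  by move=> A' B' mA' mB'; rewrite PE; exact: IHS.
rewrite PE; congr (_ * _)%E; rewrite -(independent_pair_law _ mC)//.
move=> A' B' mA' mB'; have := IHS A' B' (fun=> setT) mA' mB' (fun=> measurableT).
rewrite (_ : tail_event _ _ _ _ = setT); last by apply/seteqP; split.
rewrite setIT => ->.
rewrite [X in (_ * X)%E]big1_seq ?mule1// => i _.
by rewrite preimage_setT (@probability_setT _ _ _ P).
Qed.

Lemma partial_sum_independent n (Y : nat -> Om -> R) k :
  (forall i, measurable_fun setT (Y i)) -> independent_sequence n Y -> (k < n)%N ->
  independent_pair P (fun w => \sum_(i < k) Y i w) (Y k).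
Proof.
move=> mY hY kn A B mA mB.
have := @partial_sum_tail_law n Y mY hY k (ltnW kn) A (fun i => if i == k then B else setT) mA.
rewrite tail_event_recl// eqxx (_ : tail_event _ _ _ _ = setT); last first.
  by apply/seteqP; split=> // w _ i /andP[ki _]; rewrite gtn_eqF.
rewrite setIT => -> => [|i]; last by case: ifP.
rewrite big_ltn// eqxx big_nat_cond [X in (_ * (_ * X))%E]big1 ?mule1// => i /andP[/andP[ki _] _].
by rewrite gtn_eqF// preimage_setT (@probability_setT _ _ _ P).
Qed.

Definition op_sum n (op : nat -> (R -> R) -> (R -> R) -> R -> R) (h h' : R -> R) (x : R) :=
  \sum_(i < n) op i h h' x.

Lemma has_stein_op_sum n (Y : nat -> Om -> R)
    (op : nat -> (R -> R) -> (R -> R) -> R -> R) : independent_sequence n Y ->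
  (forall i, has_stein_op (Y i) (op i)) ->
  has_stein_op (fun w => \sum_(i < n) Y i w) (op_sum n op).
Proof.
move=> iY hY; have mY i : measurable_fun setT (Y i) by have [] := hY i.
suff H k : (k <= n)%N -> has_stein_op (fun w => \sum_(i < k) Y i w) (op_sum k op).
  exact: H.
elim: k => [_|k IH kn].
  rewrite (_ : (fun w => _) = (fun=> 0)); last by apply/funext => w; rewrite big_ord0.
  rewrite (_ : op_sum 0 op = op_zero); first exact: has_stein_op_zero.
  by apply/funext => h; apply/funext => h'; apply/funext => x; rewrite /op_sum big_ord0.
rewrite (_ : (fun w => _) = (fun w => \sum_(i < k) Y i w + Y k w)); last first.
  by apply/funext => w; rewrite big_ord_recr.
rewrite (_ : op_sum k.+1 op = op_add (op_sum k op) (op k)); last first.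
  by apply/funext => h; apply/funext => h'; apply/funext => x; rewrite /op_sum big_ord_recr.
apply: has_stein_op_add => //; first exact: partial_sum_independent kn.
by apply: IH; exact: ltnW.
Qed.

End stein_operators.

(** * Poisson and Gaussian variables *)

Section poisson_variable.
Context d (Om : measurableType d) (R : realType) (P : probability Om R).
Variables (N : Om -> \bar R) (r : R).
Hypothesis mN : measurable_fun setT N.
Hypothesis N0 : forall w, (0 <= N w)%E.
Hypothesis r0 : 0 <= r.
Hypothesis lawN : forall k, P [set w | N w = k%:R%:E] = poisson_prob r k [set k].

Let F k : set Om := [set w | N w = k%:R%:E].
Let p k : R := fine (P (F k)).

Lemma measurable_level k : measurable (F k).
Proof.
rewrite -[X in measurable X]setTI.
by apply: (mN measurableT (Y := [set k%:R%:E])); exact: emeasurable_set1.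
Qed.

Let PF k : P (F k) = (p k)%:E.
Proof. by rewrite fineK// fin_num_measure//; exact: measurable_level. Qed.

Let tF : trivIset setT F.
Proof.
move=> i j _ _ [w [h1 h2]]; have := etrans (esym h1) h2.
by case=> /eqP; rewrite eqr_nat => /eqP.
Qed.

(** The ratio of consecutive Poisson weights; summed against a function, it becomes the shift
    formula below. *)
Lemma poisson_recurrence k : k.+1%:R * p k.+1 = r * p k.
Proof.
rewrite /p /F !lawN /poisson_prob; have [rp|] := ltrP 0 r.
  rewrite !esum_set1 ?lee_fin ?poisson_pmf_ge0//= /poisson_pmf rp factS natrM exprS.
  have h1 : k`!%:R != 0 :> R by rewrite pnatr_eq0 -lt0n fact_gt0.
  have h2 : k.+1%:R != 0 :> R by rewrite pnatr_eq0.
  by field; rewrite h1 nat1r h2.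
(* [poisson_prob 0] is the Dirac measure at 0, so the weight at [k.+1] vanishes. *)
move=> r_le0; have -> : r = 0 by apply/eqP; rewrite eq_le r_le0 r0.
by rewrite mul0r diracE memNset//= mulr0.
Qed.

(** The Poisson weights sum to 1, so the extended-valued variable is almost surely a finite integer
    and [fine] alters it on a null set only. *)
Lemma poisson_support : P (\bigcup_k F k) = 1%E.
Proof.
rewrite measure_bigcup//; last by move=> k _; exact: measurable_level.
rewrite (@eq_eseriesr _ _ (fun k => poisson_prob r 0 [set k])) => [|k _]; last exact: lawN.
have := @measure_bigcup _ _ _ (poisson_prob r 0) setT (fun k => [set k]).
rewrite /= => <- //.
- rewrite (_ : \bigcup_k [set k] = setT); first exact: probability_setT.
  by apply/seteqP; split => // k _; exists k.
- by move=> i j _ _ [w [/= -> ->]].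
Qed.

Lemma poisson_ge0_expectation (G : R -> R) : measurable_fun setT G ->
  (forall x, 0 <= x -> 0 <= G x) ->
  (\int[P]_w (G (fine (N w)))%:E = \sum_(k <oo) (G k%:R * p k)%:E)%E.
Proof.
move=> mG G0.
have mGN : measurable_fun setT (fun w => (G (fine (N w)))%:E).
  apply/measurable_EFinP; apply: measurableT_comp => //.
  exact: measurableT_comp.
have GN0 w : (0 <= (G (fine (N w)))%:E)%E by rewrite lee_fin G0// fine_ge0.
have mU : measurable (\bigcup_k F k) by apply: bigcup_measurable => k _; exact: measurable_level.
rewrite (@ge0_negligible_integral _ _ _ P setT (~` \bigcup_k F k))//; first last.
- by have := @probability_setC _ _ _ P _ mU; rewrite poisson_support subee.
- exact: measurableC.
rewrite setTD setCK ge0_integral_bigcup//; first last.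
- exact: measurable_funTS.
- by move=> k; exact: measurable_level.
apply: eq_eseriesr => k _.
rewrite (eq_integral (fun=> (G k%:R)%:E)) => [|w /set_mem/= ->//].
rewrite integral_cst; last exact: measurable_level.
by rewrite [X in (_ * X)%E]PF.
Qed.

(** For nonnegative g this holds in the extended reals, without integrability, and so g = 1 and g =
    id yield finiteness of the first two moments. *)
Lemma poisson_shift (g : R -> R) : measurable_fun setT g ->
  (forall x, 0 <= x -> 0 <= g x) ->
  (\int[P]_w (fine (N w) * g (fine (N w)))%:E = r%:E * \int[P]_w (g (fine (N w) + 1))%:E)%E.
Proof.
move=> mg g0.
have p0 k : 0 <= p k by exact: fine_ge0.
rewrite (@poisson_ge0_expectation (fun x => x * g x)); first last.
- by move=> x x0; rewrite mulr_ge0// g0.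
- exact: measurable_funM.
rewrite (@poisson_ge0_expectation (fun x => g (x + 1))); first last.
- by move=> x x0; rewrite g0// addr_ge0.
- by apply: measurableT_comp => //; exact: measurable_funD.
rewrite nneseries_recl//; last first.
  by move=> k _; rewrite lee_fin !mulr_ge0// g0.
rewrite !mul0r add0e -nneseriesZl; last first.
  by move=> k _; rewrite lee_fin mulr_ge0// g0// addr_ge0.
rewrite -(@nneseries_addn _ _ 1%N); last first.
  by move=> k; rewrite lee_fin !mulr_ge0// g0.
apply: eq_eseriesr => k _; rewrite addn1 -EFinM natr1; congr EFin.
rewrite mulrAC poisson_recurrence; ring.
Qed.

Let K w := fine (N w).
Let mK : measurable_fun setT K.
Proof. exact: measurableT_comp. Qed.
Let K0 w : 0 <= K w. Proof. exact: fine_ge0. Qed.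

Lemma poisson_mean : P.-integrable setT (EFin \o K).
Proof.
apply: ge0_rintegrable => //.
rewrite (eq_integral (fun w => (fine (N w) * 1)%:E)) => [|w _]; last by rewrite mulr1.
rewrite (@poisson_shift (fun=> 1) (measurable_cst _) (fun _ _ => ler01)).
by rewrite -(EFin_Rintegral measurableT) -?EFinM ?ltry//; exact: rintegrable_cst.
Qed.

Lemma poisson_second_moment : P.-integrable setT (EFin \o (fun w => K w ^+ 2)).
Proof.
apply: ge0_rintegrable => //.
- exact: measurable_funX.
- by move=> w _; exact: sqr_ge0.
rewrite (eq_integral (fun w => (fine (N w) * id (fine (N w)))%:E)) => [|w _]; last by rewrite expr2.
rewrite (@poisson_shift id (@measurable_id _ _ _) (fun _ => id)).
rewrite -(EFin_Rintegral measurableT) -?EFinM ?ltry//.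
by apply: rintegrableD => //; [exact: poisson_mean|exact: rintegrable_cst].
Qed.

Lemma poisson_shift_bounded (g : R -> R) (M : R) : measurable_fun setT g ->
  (forall x, `|g x| <= M) ->
  \int[P]_w (K w * g (K w)) = r * \int[P]_w g (K w + 1).
Proof.
move=> mg gM.
have iK1 : P.-integrable setT (EFin \o (fun w => g (K w + 1))).
  apply: (@bounded_rintegrable _ _ _ _ _ M) => //.
  by apply: (measurableT_comp mg); exact: measurable_funD.
have iKg : P.-integrable setT (EFin \o (fun w => K w * g (K w))).
  apply: (le_rintegrable measurableT _ (rintegrableZ measurableT M poisson_mean)).
    by apply: measurable_funM => //; exact: measurableT_comp.
  by move=> w _; rewrite normrM (ger0_norm (K0 w)) mulrC ler_wpM2r.
have H (h : R -> R) : measurable_fun setT h -> (forall x, 0 <= h x) ->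
    P.-integrable setT (EFin \o (fun w => K w * h (K w))) ->
    P.-integrable setT (EFin \o (fun w => h (K w + 1))) ->
    \int[P]_w (K w * h (K w)) = r * \int[P]_w h (K w + 1).
  move=> mh h0 i1 i2; apply: EFin_inj; rewrite EFinM !(EFin_Rintegral measurableT)//.
  exact: poisson_shift.
have hM := H (fun=> `|M|) (measurable_cst _) (fun=> normr_ge0 _)
  (eq_rintegrable measurableT (fun w _ => mulrC _ _) (rintegrableZ measurableT `|M| poisson_mean))
  (rintegrable_cst P _).
have hgM := H (fun x => g x + `|M|) (measurable_funD mg (measurable_cst _)).
have iKM : P.-integrable setT (EFin \o (fun w => K w * `|M|)).
  exact: (eq_rintegrable measurableT (fun w _ => mulrC _ _) (rintegrableZ measurableT `|M| poisson_mean)).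
(* Adding |M| makes g nonnegative; the identity for the constant is then subtracted. *)
have : \int[P]_w (K w * (g (K w) + `|M|)) = r * \int[P]_w (g (K w + 1) + `|M|).
  apply: hgM.
  - move=> x; rewrite -lerBlDr sub0r; have := gM x; rewrite ler_norml => /andP[h _].
    by rewrite (le_trans _ h)// lerN2 ler_norm.
  - apply: eq_rintegrable (rintegrableD measurableT iKg iKM) => // w _.
    by rewrite mulrDr.
  - by apply: rintegrableD => //; exact: rintegrable_cst.
rewrite (RintegralD measurableT iK1 (rintegrable_cst P _)).
rewrite (@eq_Rintegral _ _ _ _ _ (fun w => K w * g (K w) + K w * `|M|)) => [|w _]; last first.
  by rewrite mulrDr.
rewrite RintegralD// hM; lra.
Qed.

(** The shift formula is applied to x |-> h (c (x - r)): raising the Poisson variable by 1 moves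
    [c * (K w - r)] by c, the jump of [op_jump]. *)
Lemma poisson_stein (c : R) :
  has_stein_op P (fun w => c * (K w - r)) (op_jump c r).
Proof.
have mY : measurable_fun setT (fun w => c * (K w - r)).
  by apply: measurable_funM => //; exact: measurable_funB.
split=> //; last 2 first.
- exact: stein_op_jump.
- move=> h h' hh; have [L L0 [hb hl _ _ _]] := test_pair_increment hh.
  have mh := lipschitz_measurable hl.
  have mg : measurable_fun setT (fun x : R => h (c * (x - r))).
    by apply: measurableT_comp => //; apply: measurable_funM => //; exact: measurable_funB.
  have e1 := poisson_shift_bounded mg (fun x => hb _).
  have i1 : P.-integrable setT (EFin \o (fun w => K w * h (c * (K w - r)))).
    apply: (le_rintegrable measurableT _ (rintegrableZ measurableT L poisson_mean)).
      by apply: measurable_funM => //; exact: measurableT_comp.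
    by move=> w _; rewrite normrM (ger0_norm (K0 w)) mulrC ler_wpM2r.
  have i2 : P.-integrable setT (EFin \o (fun w => h (c * (K w - r)))).
    by apply: (@bounded_rintegrable _ _ _ _ _ L) => //; exact: measurableT_comp mg mK.
  have i3 : P.-integrable setT (EFin \o (fun w => h (c * (K w + 1 - r)))).
    apply: (@bounded_rintegrable _ _ _ _ _ L) => //.
    by apply: (measurableT_comp mg); exact: measurable_funD.
  rewrite (@eq_Rintegral _ _ _ _ _ (fun w => c * (K w * h (c * (K w - r))) -
     c * r * h (c * (K w + 1 - r)))) => [|w _].
    rewrite RintegralB//; [|exact: rintegrableZ..].
    by rewrite !RintegralZl// e1; ring.
  rewrite /op_jump (_ : c * (K w - r) + c = c * (K w + 1 - r)); [ring|ring].
apply: (le_rintegrable measurableT (g := fun w => 2 * c ^+ 2 * K w ^+ 2 + 2 * c ^+ 2 * r ^+ 2)).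
- exact: measurable_funX.
- apply: rintegrableD => //; last exact: rintegrable_cst.
  by apply: rintegrableZ => //; exact: poisson_second_moment.
- move=> w _; rewrite ger0_norm ?sqr_ge0// exprMn -subr_ge0.
  have -> : 2 * c ^+ 2 * K w ^+ 2 + 2 * c ^+ 2 * r ^+ 2 - c ^+ 2 * (K w - r) ^+ 2 =
    (c * (K w + r)) ^+ 2 by ring.
  exact: sqr_ge0.
Qed.

End poisson_variable.

(** The Radon-Nikodym derivative of [normal_prob] agrees almost everywhere with the density, since
    both have the same integral over every measurable set. *)
Lemma ge0_integral_normal_prob (R : realType) (s : R) (F : measurableTypeR R -> R) :
  measurable_fun setT F -> (forall x, 0 <= F x) ->
  (\int[normal_prob 0 s]_x (F x)%:E =
   \int[lebesgue_measure]_x (F x * normal_pdf 0 s x)%:E)%E.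
Proof.
move=> mF F0.
have dom := normal_prob_dominates 0 s.
rewrite -(Radon_Nikodym_SigmaFinite.change_of_variables dom)//; last first.
  exact/measurable_EFinP.
under [RHS]eq_integral do rewrite EFinM.
apply: ae_eq_integral => //.
- apply: emeasurable_funM; first exact/measurable_EFinP.
  exact: measurable_int (Radon_Nikodym_SigmaFinite.f_integrable dom).
- apply: emeasurable_funM; apply/measurable_EFinP => //.
  exact: measurable_normal_pdf.
- apply: ae_eqe_mul2l => /=.
  apply: integral_ae_eq => //=.
  + exact: Radon_Nikodym_SigmaFinite.f_integrable dom.
  + by apply/measurable_EFinP; exact: measurable_normal_pdf.
  + by move=> E _ mE; rewrite -(Radon_Nikodym_SigmaFinite.f_integral dom).
Qed.

(** * Gaussian integration by parts *)

Section gaussian_variable.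
Context d (Om : measurableType d) (R : realType) (P : probability Om R).
Variables (G : {RV P >-> R}) (s : R).
Hypothesis s0 : 0 < s.
Hypothesis lawG : forall B, measurable B -> P (G @^-1` B) = normal_prob 0 s B.
Local Notation mu := (@lebesgue_measure R).
Let p (x : R) : R := normal_pdf 0 s x.
Let mp : measurable_fun setT p. Proof. exact: measurable_normal_pdf. Qed.
Let p0 x : 0 <= p x. Proof. exact: normal_pdf_ge0. Qed.
Let ip : mu.-integrable setT (EFin \o p). Proof. exact: integrable_normal_pdf. Qed.

Lemma ge0_gaussian_expectation (F : R -> R) : measurable_fun setT F ->
  (forall x, 0 <= F x) ->
  (\int[P]_w (F (G w))%:E = \int[mu]_x (F x * p x)%:E)%E.
Proof.
move=> mF F0; rewrite -(@ge0_integral_normal_prob _ s F)//.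
have mG' : measurable_fun setT (G : Om -> measurableTypeR R).
  by move=> _ B mB; have := @measurable_funPT _ _ _ _ G; exact.
pose G' : {mfun Om >-> measurableTypeR R} :=
  HB.pack (G : Om -> measurableTypeR R) (isMeasurableFun.Build _ _ _ _ (G : Om -> measurableTypeR R) mG').
transitivity (\int[distribution P G']_x (F x)%:E)%E.
  by rewrite ge0_integral_distribution//; exact/measurable_EFinP.
by apply: (@eq_measure_integral _ (measurableTypeR R)) => A mA _; exact: lawG.
Qed.

Lemma gaussian_expectation (F : R -> R) : measurable_fun setT F ->
  mu.-integrable setT (EFin \o (fun x => F x * p x)) ->
  P.-integrable setT (EFin \o (fun w => F (G w))) /\
  \int[P]_w F (G w) = \int[mu]_x (F x * p x).
Proof.
move=> mF iF.
have H (H : R -> R) : measurable_fun setT H -> (forall x, 0 <= H x) ->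
    mu.-integrable setT (EFin \o (fun x => H x * p x)) ->
    P.-integrable setT (EFin \o (fun w => H (G w))) /\
    \int[P]_w H (G w) = \int[mu]_x (H x * p x).
  move=> mH H0 iH; split; last by rewrite /Rintegral ge0_gaussian_expectation.
  apply: ge0_rintegrable => //; first exact: measurableT_comp.
  rewrite ge0_gaussian_expectation// -(EFin_Rintegral measurableT)// ltry//.
have iN : mu.-integrable setT (EFin \o (fun x => `|F x| * p x)).
  apply: eq_rintegrable (rintegrable_norm iF) => // x _.
  by rewrite normrM (ger0_norm (p0 x)).
(* F is the difference of the nonnegative functions F + |F| and |F|. *)
have iS : mu.-integrable setT (EFin \o (fun x => (F x + `|F x|) * p x)).
  by apply: eq_rintegrable (rintegrableD measurableT iF iN) => // x _; rewrite mulrDl.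
have mnF : measurable_fun setT (fun x => `|F x|) by exact: measurableT_comp.
have FF0 x : 0 <= F x + `|F x| by rewrite -lerBlDl sub0r -normrN ler_norm.
have [iP1 e1] := H _ mnF (fun x => normr_ge0 _) iN.
have [iP2 e2] := H _ (measurable_funD mF mnF) FF0 iS.
split.
  apply: eq_rintegrable (rintegrableB measurableT iP2 iP1) => // w _ /=.
  by rewrite addrK.
rewrite (@eq_Rintegral _ _ _ _ _ (fun w => (F (G w) + `|F (G w)|) - `|F (G w)|)) => [|w _].
  rewrite RintegralB// e1 e2 -RintegralB//.
  by apply: eq_Rintegral => x _; rewrite -mulrBl addrK.
by rewrite addrK.
Qed.

Let s2 : 0 < s ^+ 2. Proof. exact: exprn_gt0. Qed.

Lemma normal_pdf_center x : p x = normal_peak s * expR (- x ^+ 2 / (s ^+ 2 *+ 2)).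
Proof. by rewrite /p normal_pdfE ?gt_eqF// /normal_fun subr0. Qed.

(** Up to the factor - s^2, the product x p(x) is thus the derivative of p, which is what the
    integration by parts exploits. *)
Lemma derive_normal_pdf (x : R) : is_derive x 1 p (- (x / s ^+ 2) * p x).
Proof.
have de : is_derive x 1 (fun y : R => - y ^+ 2 / (s ^+ 2 *+ 2)) (- (x / s ^+ 2)).
  have dx := derive_exp 2 (@is_derive_id _ _ x (1 : R)).
  apply: (derive_ext (derive_mul (is_derive_cst (- (s ^+ 2 *+ 2)^-1) x 1) dx)) => [y|].
    by rewrite /=; ring.
  by rewrite mul0r add0r /=; field; rewrite gt_eqF.
have dx := @is_derive1_comp _ expR _ x _ _ (is_derive_expR _) de.
apply: (derive_ext (derive_mul (is_derive_cst (normal_peak s) x 1) dx)) => [y|].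
  by rewrite normal_pdf_center.
by rewrite mul0r add0r /= normal_pdf_center; ring.
Qed.

Lemma mul_expRN_le1 (y : R) : 0 <= y -> y * expR (- y) <= 1.
Proof.
move=> y0; rewrite expRN ler_pdivrMr ?expR_gt0// mul1r.
by apply: le_trans (expR_ge1Dx _); rewrite lerDr.
Qed.

(* [x^2 exp (- x^2 / (2 s^2))] is at most [4 s^2 exp (- x^2 / (4 s^2))], which is
   proportional to the density with deviation [sqrt 2 s] *)
Lemma sqr_normal_pdf_le : exists C : R, forall x,
  x ^+ 2 * p x <= C * normal_pdf 0 (Num.sqrt 2 * s) x.
Proof.
have t0 : 0 < Num.sqrt 2 * s by rewrite mulr_gt0// sqrtr_gt0.
exists (4 * s ^+ 2 * normal_peak s / normal_peak (Num.sqrt 2 * s)) => x.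
have pk0 : normal_peak (Num.sqrt 2 * s) != 0 by rewrite gt_eqF// normal_peak_gt0// gt_eqF.
rewrite normal_pdf_center (normal_pdfE 0 (lt0r_neq0 t0)) /normal_fun subr0.
rewrite exprMn sqr_sqrtr//.
set y := x ^+ 2 / (4 * s ^+ 2).
have y0 : 0 <= y by rewrite divr_ge0 ?sqr_ge0// mulr_ge0// ltW.
have -> : - x ^+ 2 / (s ^+ 2 *+ 2) = - y + - y by rewrite /y; field; rewrite gt_eqF.
have -> : - x ^+ 2 / (2 * s ^+ 2 *+ 2) = - y by rewrite /y; field; rewrite gt_eqF.
have -> : x ^+ 2 = 4 * s ^+ 2 * y by rewrite /y; field; rewrite gt_eqF.
rewrite expRD mulrA [leRHS]mulrA divfK//.
have e0 := expR_ge0 (- y); have := mul_expRN_le1 y0; have k0 := normal_peak_ge0 s.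
have c0 : 0 <= 4 * s ^+ 2 * normal_peak s * expR (- y) by rewrite !mulr_ge0// ltW.
move=> /(ler_wpM2l c0); rewrite mulr1; apply: le_trans.
by rewrite le_eqVlt; apply/orP; left; apply/eqP; ring.
Qed.

Lemma sqr_normal_pdf_integrable : mu.-integrable setT (EFin \o (fun x => x ^+ 2 * p x)).
Proof.
have [C hC] := sqr_normal_pdf_le.
apply: (le_rintegrable measurableT (g := fun x : measurableTypeR R => C * normal_pdf 0 (Num.sqrt 2 * s) x)).
- exact: measurable_funM.
- by apply: rintegrableZ => //; exact: integrable_normal_pdf.
- by move=> x _; rewrite ger0_norm ?hC// mulr_ge0 ?sqr_ge0.
Qed.

Section by_parts.
Variables (h h' : R -> R).
Hypothesis hh : test_pair h h'.
Local Notation mR := (measurableTypeR R).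

Let mh : measurable_fun setT (h : mR -> mR).
Proof. by case: hh => /bounded_lipschitz_measurable. Qed.
Let mh' : measurable_fun setT (h' : mR -> mR).
Proof. by case: hh => _ /bounded_lipschitz_measurable. Qed.

Lemma mul_test_normal_pdf_integrable :
  mu.-integrable setT (EFin \o (fun x => x * h x * p x)).
Proof.
have [L L0 [hb _ _ _ _]] := test_pair_increment hh.
apply: (le_rintegrable measurableT (g := fun x : mR => L * (p x + x ^+ 2 * p x))).
- by apply: measurable_funM => //; exact: measurable_funM.
- apply: rintegrableZ => //; apply: rintegrableD => //; exact: sqr_normal_pdf_integrable.
- move=> x _; rewrite !normrM (ger0_norm (p0 x)).
  have -> : L * (p x + x ^+ 2 * p x) = L * (1 + x ^+ 2) * p x by ring.
  rewrite ler_wpM2r// mulrC ler_pM//.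
  have := sqr_ge0 (x - 1); have := sqr_ge0 (x + 1).
  by rewrite ler_norml => *; apply/andP; split; nra.
Qed.

Lemma dtest_normal_pdf_integrable :
  mu.-integrable setT (EFin \o (fun x => h' x * p x)).
Proof.
have [L L0 [_ _ hb _ _]] := test_pair_increment hh.
apply: (le_rintegrable measurableT (g := fun x : mR => L * p x)).
- exact: measurable_funM.
- exact: rintegrableZ.
- by move=> x _; rewrite normrM (ger0_norm (p0 x)) ler_wpM2r.
Qed.

Lemma derive_continuous_within (g g' : R -> R) (a b : R) :
  (forall x : R, is_derive x 1 g (g' x)) -> {within `[a, b], continuous g}.
Proof.
by move=> dg; apply: derivable_within_continuous => z _; exact: ex_derive.
Qed.

Lemma derive_oo_LRcontinuous (g g' : R -> R) (a b : R) :
  (forall x : R, is_derive x 1 g (g' x)) -> derivable_oo_LRcontinuous g a b.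
Proof.
move=> dg; have cg x : {for x, continuous g}.
  apply: differentiable_continuous; apply/derivable1_diffP.
  by case: (dg x).
split.
- by move=> x _; case: (dg x).
- exact: cvg_at_right_filter (cg a).
- exact: cvg_at_left_filter (cg b).
Qed.

Let q (x : R) : R := - (x / s ^+ 2) * p x.

Lemma by_parts_interval (n : nat) :
  \int[mu]_(x in `[- n.+1%:R, n.+1%:R]) (h x * q x) =
  (h n.+1%:R * p n.+1%:R - h (- n.+1%:R) * p (- n.+1%:R)) -
  \int[mu]_(x in `[- n.+1%:R, n.+1%:R]) (h' x * p x).
Proof.
have [_ [K K0 [h'b h'l]] dh] := hh.
apply: Rintegration_by_parts.
- by rewrite (@lt_trans _ _ 0) ?oppr_lt0.
- apply: continuous_subspaceT => x.
  apply/cvgrPdist_le => /= e e0.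
  have K1 : 0 < K + 1 by rewrite ltr_wpDl.
  near=> y.
  rewrite (le_trans (h'l _ _))// (@le_trans _ _ ((K + 1) * `|x - y|))//.
    by rewrite ler_wpM2r// lerDl.
  rewrite mulrC -ler_pdivlMr//.
  near: y; apply: cvgr_dist_le; first exact: cvg_id.
  by rewrite divr_gt0.
- exact: derive_oo_LRcontinuous dh.
- by move=> x _; rewrite derive1E (@derive_val _ _ _ _ _ _ _ (dh x)).
- apply: (@derive_continuous_within q (fun x => - (1 / s ^+ 2) * p x + - (x / s ^+ 2) * q x)) => x.
  apply: derive_mul; last exact: derive_normal_pdf.
  apply: (derive_ext (derive_mul (is_derive_cst (- (s ^+ 2)^-1) x 1) (@is_derive_id _ _ x (1 : R)))) => [y|].
    by rewrite /= mulrC mulrN.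
  by rewrite mul0r add0r mulr1 mul1r.
- exact: derive_oo_LRcontinuous derive_normal_pdf.
- by move=> x _; rewrite derive1E (@derive_val _ _ _ _ _ _ _ (derive_normal_pdf x)).
Unshelve. all: by end_near. Qed.

Lemma cvg_symmetric_Rintegral (g : mR -> R) : mu.-integrable setT (EFin \o g) ->
  \int[mu]_(x in `[- n.+1%:R, n.+1%:R]) g x @[n --> \oo] --> \int[mu]_x g x.
Proof.
move=> ig; under eq_fun do rewrite Rintegral_mkcond.
have mg := rintegrable_measurable ig.
apply: (@dominated_cvg_Rintegral _ _ _ mu setT measurableT _ _ (fun x => `|g x|) _ _ _ _).2.
- move=> n; apply/(measurable_restrictT _ _).1; first exact: measurable_itv.
  exact: measurable_funTS.
- exact: rintegrable_norm.
- by move=> n x _; rewrite patchE; case: ifP => _; rewrite ?normr0.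
- move=> x _; apply: cvg_near_cst.
  near=> n; rewrite patchE mem_set//= in_itv/=.
  have : `|x| <= n.+1%:R.
    apply: (@le_trans _ _ n%:R); last by rewrite ler_nat.
    near: n; exact: nbhs_infty_ger.
  by rewrite ler_norml.
Unshelve. all: by end_near. Qed.

Lemma cvg_boundary :
  h n.+1%:R * p n.+1%:R - h (- n.+1%:R) * p (- n.+1%:R) @[n --> \oo] --> (0 : R).
Proof.
have [L L0 [hb _ _ _ _]] := test_pair_increment hh.
pose C := normal_peak s * (2 * s ^+ 2).
have C0 : 0 <= C by rewrite mulr_ge0 ?normal_peak_ge0// mulr_ge0// ltW.
(* y exp (- y) <= 1 bounds x^2 p(x) by C, and x^2 = (n + 1)^2 >= n + 1; decay of order 1 / n is
   enough for bounded [h]. *)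
have pC (x : R) n : x ^+ 2 = n.+1%:R ^+ 2 -> p x <= C * n.+1%:R^-1.
  move=> xn; have n0 : 0 < n.+1%:R :> R by [].
  rewrite ler_pdivlMr// normal_pdf_center.
  set y := x ^+ 2 / (s ^+ 2 *+ 2).
  have -> : - x ^+ 2 / (s ^+ 2 *+ 2) = - y by rewrite /y mulNr.
  have y0 : 0 <= y by rewrite divr_ge0 ?sqr_ge0// mulrn_wge0// ltW.
  apply: (@le_trans _ _ (normal_peak s * expR (- y) * x ^+ 2)).
    rewrite ler_wpM2l ?mulr_ge0 ?normal_peak_ge0 ?expR_ge0//.
    by rewrite xn expr2 -[leLHS]mulr1 ler_wpM2l// ler1n.
  have -> : x ^+ 2 = 2 * s ^+ 2 * y by rewrite /y; field; rewrite gt_eqF.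
  have := mul_expRN_le1 y0; have c0 : 0 <= C by [].
  move=> /(ler_wpM2l c0); rewrite mulr1; apply: le_trans.
  by rewrite le_eqVlt; apply/orP; left; apply/eqP; rewrite /C; ring.
apply: (@cvg_to_0_le _ _ (fun n => 2 * L * C * n.+1%:R^-1)); last first.
  rewrite -[X in _ --> X](mulr0 (2 * L * C)).
  by apply: cvgM; [exact: cvg_cst|exact: cvg_harmonic].
move=> n; rewrite subr0 (le_trans (ler_normB _ _))// !normrM !(ger0_norm (p0 _)).
have e1 : p n.+1%:R <= C * n.+1%:R^-1 by exact: pC.
have e2 : p (- n.+1%:R) <= C * n.+1%:R^-1 by apply: pC; rewrite sqrrN.
have -> : 2 * L * C * n.+1%:R^-1 = L * (C * n.+1%:R^-1) + L * (C * n.+1%:R^-1) by ring.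
by apply: lerD; apply: ler_pM.
Qed.

Lemma gaussian_by_parts :
  \int[mu]_x (x * h x * p x) = s ^+ 2 * \int[mu]_x (h' x * p x).
Proof.
have i1 := mul_test_normal_pdf_integrable; have i2 := dtest_normal_pdf_integrable.
have i3 : mu.-integrable setT (EFin \o (fun x => h x * q x)).
  apply: eq_rintegrable (rintegrableZ measurableT (- (s ^+ 2)^-1) i1) => // x _.
  by rewrite /q; ring.
have c1 := cvg_symmetric_Rintegral i3.
have c2 : (h n.+1%:R * p n.+1%:R - h (- n.+1%:R) * p (- n.+1%:R)) -
  \int[mu]_(x in `[- n.+1%:R, n.+1%:R]) (h' x * p x) @[n --> \oo] -->
  0 - \int[mu]_x (h' x * p x).
  by apply: cvgB; [exact: cvg_boundary|exact: cvg_symmetric_Rintegral].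
have : \int[mu]_x (h x * q x) = 0 - \int[mu]_x (h' x * p x).
  rewrite (_ : (fun n => _) = (fun n => (h n.+1%:R * p n.+1%:R - h (- n.+1%:R) * p (- n.+1%:R)) -
    \int[mu]_(x in `[- n.+1%:R, n.+1%:R]) (h' x * p x))) in c1.
    by rewrite -(cvg_lim _ c1)// (cvg_lim _ c2).
  by apply/funext => n; exact: by_parts_interval.
rewrite (@eq_Rintegral _ _ _ _ _ (fun x : mR => - (s ^+ 2)^-1 * (x * h x * p x))) => [|x _].
  rewrite RintegralZl// sub0r mulNr => /oppr_inj <-.
  by rewrite mulrA divff ?mul1r// gt_eqF.
by rewrite /q; ring.
Qed.

End by_parts.

Lemma gaussian_stein (c : R) :
  has_stein_op P (fun w => c * G w) (op_gauss (c ^+ 2 * s ^+ 2)).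
Proof.
have mG : measurable_fun setT (G : Om -> R) by [].
split.
- exact: measurable_funM.
- have [i _] := gaussian_expectation (measurable_funX 2 (@measurable_id _ _ _)) sqr_normal_pdf_integrable.
  apply: eq_rintegrable (rintegrableZ measurableT (c ^+ 2) i) => // w _.
  by rewrite exprMn.
- exact: stein_op_gauss.
move=> h h' hh.
(* The factor c is moved into the test function, so that only the unscaled variable has to be
   integrated by parts. *)
have hc : test_pair (fun x => h (c * x)) (fun x => c * h' (c * x)).
  have [[K K0 [hb hl]] [L L0 [h'b h'l]] dh] := hh.
  have cl (g : R -> R) M : 0 <= M -> (forall x, `|g x| <= M) ->
      (forall x y, `|g x - g y| <= M * `|x - y|) -> bounded_lipschitz (fun x => g (c * x)).
    move=> M0 gb gl; exists (M + M * `|c|); first by rewrite addr_ge0// mulr_ge0.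
    split=> [x|x y]; first by rewrite (le_trans (gb _))// lerDl mulr_ge0.
    rewrite (le_trans (gl _ _))// -mulrBr normrM mulrA ler_wpM2r//.
    by rewrite lerDr.
  split; first exact: (cl _ _ K0 hb hl).
    by apply: bounded_lipschitzM (bounded_lipschitz_cst c) _; exact: (cl _ _ L0 h'b h'l).
  move=> x; rewrite mulrC; apply: (@is_derive1_comp _ h (fun t => c * t)).
  apply: (derive_ext (derive_mul (is_derive_cst c x 1) (@is_derive_id _ _ x (1 : R)))) => //.
  by rewrite mul0r add0r mulr1.
have mh : measurable_fun setT (fun x => h (c * x)).
  by have [/bounded_lipschitz_measurable] := hc.
have mh' : measurable_fun setT (fun x => c * h' (c * x)).
  by have [_ /bounded_lipschitz_measurable] := hc.
have [i1 e1] := @gaussian_expectation (fun x => x * h (c * x)) (measurable_funM (@measurable_id _ _ _) mh)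
  (mul_test_normal_pdf_integrable hc).
have [i2 e2] := @gaussian_expectation (fun x => c * h' (c * x)) mh' (dtest_normal_pdf_integrable hc).
rewrite (@eq_Rintegral _ _ _ _ _ (fun w => c * (G w * h (c * G w)) -
   c * s ^+ 2 * (c * h' (c * G w)))) => [|w _]; last by rewrite /op_gauss; ring.
rewrite RintegralB//; [|exact: rintegrableZ..].
rewrite (RintegralZl c)// (RintegralZl (c * s ^+ 2))// e1 e2 (gaussian_by_parts hc).
ring.
Qed.

End gaussian_variable.

(** * Elementary integrals *)

Section endpoints.
Context {R : realType}.
Variables (T : R) (n : nat) (l r : 'I_n -> R).
Hypothesis bounds : forall i, 0 <= l i <= r i /\ r i <= T.
Hypothesis T0 : 0 <= T.

(** All left and right ends are kept with repetitions; a repeated value only creates an empty cell,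
    over which every increment is 0. *)
Definition endpoints : seq R :=
  sort <=%R ([seq l i | i <- enum 'I_n] ++ [seq r i | i <- enum 'I_n]).
(** The default T keeps the sequence nondecreasing and inside [0, T] past the end of the list. *)
Definition endpoint (k : nat) : R := nth T endpoints k.

Lemma endpoints_bounds x : x \in endpoints -> 0 <= x <= T.
Proof.
rewrite mem_sort mem_cat => /orP[|] /mapP[i _ ->].
  by have [/andP[l0 lr] rT] := bounds i; rewrite l0 (le_trans lr rT).
by have [/andP[l0 lr] rT] := bounds i; rewrite rT (le_trans l0 lr).
Qed.

Lemma endpoint_bounds k : 0 <= endpoint k <= T.
Proof.
rewrite /endpoint; have [ks|sk] := ltnP k (size endpoints).
  by apply: endpoints_bounds; exact: mem_nth.
by rewrite nth_default// T0 lexx.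
Qed.

Lemma endpoint_le i j : (i <= j)%N -> endpoint i <= endpoint j.
Proof.
move=> ij; have [js|sj] := ltnP j (size endpoints); last first.
  by rewrite [leRHS]nth_default//; have /andP[] := endpoint_bounds i.
apply: (sorted_leq_nth le_trans le_refl) => //; first exact: sort_le_sorted.
by rewrite inE (leq_ltn_trans ij).
Qed.

Definition weight (c : 'I_n -> R) (k : nat) : R :=
  \sum_(i < n | (l i <= endpoint k) && (endpoint k.+1 <= r i)) c i.

Lemma interval_increment (F : R -> R) (x y : R) :
  x \in endpoints -> y \in endpoints -> x <= y ->
  F y - F x = \sum_(k < size endpoints | (x <= endpoint k) && (endpoint k.+1 <= y))
    (F (endpoint k.+1) - F (endpoint k)).
Proof.
move=> xe ye xy; set a := index x endpoints; set b := index y endpoints.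
have ax : endpoint a = x by rewrite /endpoint nth_index.
have b_y : endpoint b = y by rewrite /endpoint nth_index.
have bs : (b < size endpoints)%N by rewrite index_mem.
have ab : (a <= b)%N.
  rewrite leqNgt; apply/negP => ba; have := endpoint_le (ltnW ba).
  rewrite ax b_y => yx; have xyE : x = y by apply/eqP; rewrite eq_le xy yx.
  by move: ba; rewrite /a /b xyE ltnn.
rewrite -[in LHS]ax -[in LHS]b_y -(telescope_sumr (fun k => F (endpoint k)) ab).
rewrite [RHS]big_mkcond/= -(big_mkord xpredT (fun k => if (x <= endpoint k) && (endpoint k.+1 <= y)
  then F (endpoint k.+1) - F (endpoint k) else 0)).
rewrite (big_cat_nat (leq0n a) (leq_trans ab (ltnW bs)))/= (big_cat_nat ab (ltnW bs))/=.
(* Before the first occurrence of x, the filter and monotonicity would force an entry equal to x. *)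
rewrite [X in _ = X + _]big_nat [X in _ = X + _]big1 ?add0r => [|k /andP[_ ka]]; last first.
  case: ifP => // /andP[xk _].
  have tk : endpoint k = x by apply/eqP; rewrite eq_le xk -ax endpoint_le// ltnW.
  have := index_ltn; have kn : nth T endpoints k = x by [].
  by have := @before_find _ T (pred1 x) endpoints k ka; rewrite /= kn eqxx.
(* From position b on, the filter selects only cells with equal ends. *)
rewrite [X in _ = _ + X]big_nat [X in _ = _ + X]big1 ?addr0 => [|k /andP[bk _]]; last first.
  case: ifP => // /andP[_ ky].
  have h1 := endpoint_le bk; have h2 := endpoint_le (leqnSn k).
  have -> : endpoint k.+1 = endpoint k; last by rewrite subrr.
  by apply/eqP; rewrite eq_le h2 andbT (le_trans ky)// -b_y.
apply: eq_big_nat => k /andP[ak kb].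
by rewrite -{1}ax -{1}b_y !endpoint_le.
Qed.

(** F is arbitrary so that one refinement serves twice: with a Brownian path for the integral, with
    the indicator of [s, +oo[ for the integrand. *)
Lemma weighted_increment (c : 'I_n -> R) (F : R -> R) :
  \sum_(i < n) c i * (F (r i) - F (l i)) =
  \sum_(k < size endpoints) weight c k * (F (endpoint k.+1) - F (endpoint k)).
Proof.
under eq_bigr => i _.
  rewrite (@interval_increment F (l i) (r i)); first last.
  - by have [/andP[]] := bounds i.
  - by rewrite mem_sort mem_cat map_f ?orbT// mem_enum.
  - by rewrite mem_sort mem_cat map_f// mem_enum.
  rewrite mulr_sumr big_mkcond/=.
  over.
rewrite exchange_big/=; apply: eq_bigr => k _.
by rewrite /weight mulr_suml [RHS]big_mkcond.
Qed.

Lemma interval_indicE (a b s : R) : a <= b ->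
  \1_(`]a, b]%classic) s = (s <= b)%R%:R - (s <= a)%R%:R :> R.
Proof.
move=> ab; rewrite indicE; have -> : (s \in `]a, b]%classic) = (a < s <= b).
  by apply/idP/idP => [/set_mem|h]; [rewrite /= in_itv|apply/mem_set; rewrite /= in_itv].
have [sa|sa] := leP s a; first by rewrite /= (le_trans sa ab) subrr.
by rewrite /= subr0.
Qed.

Lemma weighted_indic (c : 'I_n -> R) (s : R) :
  \sum_(i < n) c i * \1_(`]l i, r i]%classic) s =
  \sum_(k < size endpoints) weight c k * \1_(`]endpoint k, endpoint k.+1]%classic) s.
Proof.
under eq_bigr => i _.
  rewrite interval_indicE; last by have [/andP[]] := bounds i.
  over.
under [RHS]eq_bigr => k _ do rewrite interval_indicE ?endpoint_le//.
exact: (weighted_increment c (fun x => (s <= x)%R%:R)).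
Qed.

End endpoints.

Section disjoint_steps.
Context {R : realType} {Z : Type}.

(** At most one indicator is nonzero at z, so F acts on the coefficients; [F 0 = 0] covers the
    points outside all the sets. *)
Lemma disjoint_step_fun (m : nat) (b : nat -> R) (B : nat -> set Z) (F : R -> R) z :
  (forall i j, B i z -> B j z -> i = j) -> F 0 = 0 ->
  F (\sum_(k < m) b k * \1_(B k) z) = \sum_(k < m) F (b k) * \1_(B k) z.
Proof.
move=> tB F0; have [[k Bk]|nB] := pselect (exists k : 'I_m, B k z).
  have H (g : nat -> R) : \sum_(k < m) g k * \1_(B k) z = g k.
    rewrite (bigD1 k)//= indicE mem_set// mulr1 big1 ?addr0// => j jk.
    rewrite indicE memNset ?mulr0// => Bj; case/eqP: jk; apply: val_inj; exact: tB.
  by rewrite (H b) (H (F \o b)).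
have H (g : nat -> R) : \sum_(k < m) g k * \1_(B k) z = 0.
  by apply: big1 => j _; rewrite indicE memNset ?mulr0// => Bj; apply: nB; exists j.
by rewrite (H b) (H (F \o b)).
Qed.

End disjoint_steps.

Section transfer.
Context d (Om : measurableType d) (R : realType) (P : probability Om R).
Implicit Types X Y : Om -> R.

Lemma has_stein_op_ae X Y op : measurable_fun setT X -> {ae P, forall w, X w = Y w} ->
  has_stein_op P Y op -> has_stein_op P X op.
Proof.
move=> mX XY [mY Y2 so hY]; have [bo _] := so.
have aeE (F : R -> R) : measurable_fun setT F ->
    (\int[P]_w (F (X w))%:E = \int[P]_w (F (Y w))%:E)%E.
  move=> mF; apply: ae_eq_integral => //.
  - by apply/measurable_EFinP; exact: measurableT_comp.
  - by apply/measurable_EFinP; exact: measurableT_comp.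
  - by apply: filterS XY => w /= -> _.
split=> //.
  apply: ge0_rintegrable.
  - exact: measurable_funX.
  - by move=> w _; exact: sqr_ge0.
  rewrite (aeE (fun x => x ^+ 2)); last exact: measurable_funX.
  by rewrite -(EFin_Rintegral measurableT)// ltry.
move=> h h' hh; rewrite -[RHS](hY _ _ hh) /Rintegral; congr fine.
have [h1 _ _] := hh.
apply: (aeE (fun x => x * h x - op h h' x)).
apply: measurable_funB; last exact: bounded_lipschitz_measurable (bo _ _ hh).
by apply: measurable_funM => //; exact: bounded_lipschitz_measurable.
Qed.

Lemma has_stein_op_eq X op1 op2 :
  (forall h h' x, op1 h h' x = op2 h h' x :> R) -> has_stein_op P X op1 -> has_stein_op P X op2.
Proof.
move=> e; have -> : op1 = op2.
  by apply/funext => h; apply/funext => h'; apply/funext => x.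
by [].
Qed.

Lemma prode_fine n (A : nat -> set Om) : (forall i, measurable (A i)) ->
  (\prod_(i < n) P (A i) = (\prod_(i < n) fine (P (A i)))%:E)%E.
Proof.
move=> mA; elim/big_rec2: _ => // i x y _ ->.
by rewrite EFinM fineK// fin_num_measure.
Qed.

Lemma independent_sequence_of_family d' (S : measurableType d') (n : nat)
    (X : nat -> Om -> S) (F : nat -> S -> R) :
  (forall i, measurable_fun setT (X i)) -> (forall i, measurable_fun setT (F i)) ->
  independent_family P (fun (i : 'I_n) => X i) ->
  independent_sequence P n (fun i w => F i (X i w)).
Proof.
move=> mX mF hX B mB.
have mFB i : measurable (F i @^-1` B i) by rewrite -[X in measurable X]setTI; exact: mF.
have := hX (fun i => F i @^-1` B i) (fun i => mFB i).
rewrite -(@prode_fine n (fun i => X i @^-1` (F i @^-1` B i))); last first.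
  by move=> i; rewrite -[Y in measurable Y]setTI; exact: mX.
move=> <-; congr (P _); apply/seteqP; split=> w /= h; first by move=> i; exact: h.
by move=> i i_n; exact: (h (Ordinal i_n)).
Qed.

End transfer.

Section gaussian_part.
Context d (Om : measurableType d) (R : realType) (P : probability Om R).
Variables (W : R -> {RV P >-> R}) (sigma : R).
Hypothesis bmW : brownian_motion W.
Variables (t b : nat -> R) (m : nat).
Hypothesis t0 : forall k, 0 <= t k.
Hypothesis t_le : forall k, t k <= t k.+1.

Lemma gaussian_part_op : has_stein_op P
  (fun w => \sum_(k < m) sigma * b k * (W (t k.+1) w - W (t k) w))
  (op_gauss (sigma ^+ 2 * \sum_(k < m) b k ^+ 2 * (t k.+1 - t k))).
Proof.
have [_ inc law _] := bmW.
have mdW k : measurable_fun setT (fun w => W (t k.+1) w - W (t k) w) by exact: measurable_funB.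
apply: (@has_stein_op_eq _ _ _ _ _
  (op_sum m (fun k => op_gauss ((sigma * b k) ^+ 2 * (t k.+1 - t k))))).
  move=> h h' x; rewrite /op_sum /op_gauss -mulr_suml; congr (_ * _).
  by rewrite mulr_sumr; apply: eq_bigr => k _; rewrite exprMn mulrA.
apply: (@has_stein_op_sum _ _ _ P m
    (fun k w => sigma * b k * (W (t k.+1) w - W (t k) w))
    (fun k => op_gauss ((sigma * b k) ^+ 2 * (t k.+1 - t k)))).
  apply: (@independent_sequence_of_family _ _ _ _ _ _ m
    (fun k w => W (t k.+1) w - W (t k) w) (fun k x => sigma * b k * x)) => //.
    by move=> k; exact: measurable_funM.
  exact: (inc m t).
(* A cell with equal ends has zero increment and is treated apart, the Gaussian law being given for
   positive lengths. *)
move=> k; have := t_le k; rewrite le_eqVlt => /predU1P[tk|tk].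
  rewrite -tk; under [X in has_stein_op _ X]eq_fun do rewrite subrr mulr0.
  rewrite subrr mulr0; apply: has_stein_op_eq (has_stein_op_zero P) => h h' x.
  by rewrite /op_zero /op_gauss mul0r.
have [G GE] := RV_of P (mdW k).
have sk : 0 < Num.sqrt (t k.+1 - t k) by rewrite sqrtr_gt0 subr_gt0.
have lawG B : measurable B -> P (G @^-1` B) = normal_prob 0 (Num.sqrt (t k.+1 - t k)) B.
  by move=> mB; rewrite GE -(law _ _ _ (t0 k) tk mB).
have := gaussian_stein sk lawG (sigma * b k).
by rewrite GE sqr_sqrtr ?subr_ge0; last exact: ltW.
Qed.

End gaussian_part.

Section poisson_part.
Context d (Om : measurableType d) (R : realType) (P : probability Om R).
Variables (nu : {measure set (measurableTypeR R) -> \bar R}) (N : R.-ker Om ~> plane R).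
Hypothesis prmN : poisson_random_measure P nu N.
Variables (b : nat -> R) (B : nat -> set (plane R)) (m : nat).
Hypothesis mB : forall k, measurable (B k).
Hypothesis B_sub : forall k, B k `<=` time_jump_space (R := R).
Hypothesis tB : trivIset setT B.
Hypothesis finB : forall k, ((lebesgue_measure \x^ nu) (B k) < +oo)%E.

Let lambda k : R := fine ((lebesgue_measure \x^ nu)%E (B k)).
Let lambdaE k : ((lebesgue_measure \x^ nu) (B k))%E = (lambda k)%:E.
Proof. by rewrite fineK// ge0_fin_numE. Qed.

Lemma poisson_part_op : has_stein_op P
  (fun w => \sum_(k < m) b k * (fine (N w (B k)) - lambda k))
  (fun h h' x => \sum_(k < m) lambda k * (b k * (h (x + b k) - h x))).
Proof.
have [law _ ind] := prmN.
have mN k : measurable_fun setT (fun w => N w (B k)) by exact: measurable_kernel.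
apply: (@has_stein_op_eq _ _ _ _ _ (op_sum m (fun k => op_jump (b k) (lambda k)))).
  by move=> h h' x; apply: eq_bigr => k _; rewrite /op_jump mulrA.
apply: (@has_stein_op_sum _ _ _ P m
    (fun k w => b k * (fine (N w (B k)) - lambda k)) (fun k => op_jump (b k) (lambda k))).
  apply: (@independent_sequence_of_family _ _ _ _ _ _ m
    (fun k w => N w (B k)) (fun k y => b k * (fine y - lambda k))) => //.
    move=> k; apply: measurable_funM => //; apply: measurable_funB => //.
  apply: (ind m (fun k => B k)) => // i j _ _ ne.
  by apply: val_inj; exact: tB ne.
move=> k; apply: poisson_stein => //.
  exact: fine_ge0.
by move=> j; apply: law.
Qed.

End poisson_part.

(** * The intensity on and off the line of zero jumps *)

Section intensity.
Context (R : realType) (sigma : R).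
Variable nu : {measure set (measurableTypeR R) -> \bar R}.
Local Notation leb := (@lebesgue_measure R).

Lemma mmE (A : set (plane R)) : measurable A ->
  mm sigma nu A = ((sigma ^+ 2)%:E * leb (ysection A 0%R) + (leb \x^ nu) A)%E.
Proof.
move=> mA; rewrite /mm /= /product_measure2.
have mys : measurable_fun setT (leb \o ysection A) by exact: measurable_fun_ysection.
rewrite ge0_integral_measure_add//; congr (_ + _)%E.
rewrite ge0_integral_mscale//= integral_dirac//.
by rewrite diracT mul1e.
Qed.

Definition off_axis (T : R) : set (plane R) := `]0, T] `*` [set~ 0].
Definition on_axis (T : R) : set (plane R) := `]0, T] `*` [set 0].

Lemma measurable_off_axis T : measurable (off_axis T).
Proof. by apply: measurableX => //; exact: measurableC. Qed.

Lemma measurable_on_axis T : measurable (on_axis T).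
Proof. exact: measurableX. Qed.

Lemma mm_off_axis (A : set (plane R)) : measurable A -> (forall z, A z -> z.2 != 0) ->
  mm sigma nu A = (leb \x^ nu)%E A.
Proof.
move=> mA A0; rewrite mmE// (_ : ysection A 0 = set0) ?measure0 ?mule0 ?add0e//.
apply/seteqP; split=> // x; rewrite /ysection/= => /set_mem/A0.
by rewrite eqxx.
Qed.

(** As [nu] does not charge 0, its product with Lebesgue measure vanishes on the axis and only the
    Brownian part remains. *)
Lemma mm_on_axis (A : set (plane R)) : nu [set 0] = 0%E -> measurable A ->
  (forall z, A z -> z.2 = 0) ->
  mm sigma nu A = ((sigma ^+ 2)%:E * leb (ysection A 0%R))%E.
Proof.
move=> nu0 mA A0; rewrite mmE// [X in (_ + X)%E](_ : _ = 0%E) ?adde0//.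
rewrite /product_measure2.
have mys : measurable_fun setT (leb \o ysection A) by exact: measurable_fun_ysection.
rewrite (@ge0_negligible_integral _ _ _ nu setT [set (0 : R)])//.
rewrite (eq_integral (fun=> 0%E)) ?integral0// => x /set_mem[_ x0] /=.
rewrite (_ : ysection A x = set0) ?measure0//.
by apply/seteqP; split=> // y; rewrite /ysection/= => /set_mem/A0.
Qed.

End intensity.

Section step_integrals.
Context d (Z : measurableType d) (R : realType) (mu : {measure set Z -> \bar R}).

Lemma rintegrable_indic (A : set Z) (D : set Z) : measurable A -> measurable D ->
  (mu A < +oo)%E -> mu.-integrable D (EFin \o (\1_A : Z -> R)).
Proof.
move=> mA mD Aoo; apply: ge0_rintegrable => //.
rewrite integral_indic//; apply: le_lt_trans Aoo.
by apply: le_measure; rewrite ?inE//; exact: measurableI.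
Qed.

Lemma Rintegral_step (m : nat) (b : nat -> R) (B : nat -> set Z) (D : set Z) :
  measurable D -> (forall k, measurable (B k)) -> (forall k, (mu (B k) < +oo)%E) ->
  \int[mu]_(z in D) (\sum_(k < m) b k * \1_(B k) z) = \sum_(k < m) b k * fine (mu (B k `&` D)).
Proof.
move=> mD mB Boo; rewrite Rintegral_sum//; last first.
  by move=> k; apply: rintegrableZ => //; exact: rintegrable_indic.
apply: eq_bigr => k _; rewrite RintegralZl//; last exact: rintegrable_indic.
by rewrite /Rintegral integral_indic.
Qed.

Lemma step_integrable (m : nat) (b : nat -> R) (B : nat -> set Z) (D : set Z) :
  measurable D -> (forall k, measurable (B k)) -> (forall k, (mu (B k) < +oo)%E) ->
  mu.-integrable D (EFin \o (fun z => \sum_(k < m) b k * \1_(B k) z)).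
Proof.
move=> mD mB Boo; apply: rintegrable_sum => // k.
by apply: rintegrableZ => //; exact: rintegrable_indic.
Qed.

End step_integrals.

Section atoms.
Context d (Z : measurableType d) (R : realType).
Variables (n : nat) (A : 'I_n -> set Z) (a : 'I_n -> R).
Hypothesis mA : forall i, measurable (A i).

(* The jump sets of an elementary integrand may overlap; the Poisson measure is
   independent only on disjoint ones, whence the passage to atoms. *)
Definition signature (z : Z) : {set 'I_n} := finset (fun i => `[< A i z >]).
(** Dropping the empty signature discards the points outside all the sets, so every atom lies in
    some [A i] and inherits finite measure. *)
Definition nonempty_signatures : seq {set 'I_n} :=
  [seq S <- enum {set 'I_n} | S != finset.set0].
(** The bound on k matters: past the end, [nth] returns the empty signature, which would select the
    complement of all the sets. *)
Definition atom (k : nat) : set Z :=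
  [set z | (k < size nonempty_signatures)%N /\
           nth finset.set0 nonempty_signatures k = signature z].
Definition atom_coef (k : nat) : R :=
  \sum_(i in nth finset.set0 nonempty_signatures k) a i.

Lemma measurable_signature (S : {set 'I_n}) : measurable [set z | S = signature z].
Proof.
have -> : [set z | S = signature z] =
    \bigcap_(i in [set: 'I_n]) (if i \in S then A i else ~` A i).
  apply/seteqP; split=> z /=.
    move=> SE i _; case: ifPn; rewrite SE inE; first by move/asboolP.
    by move=> /asboolP.
  move=> h; apply/setP => i; rewrite inE; have := h i I.
  by case: ifPn => _ hi; apply/esym; [apply/asboolP|apply/asboolPn].
apply: fin_bigcap_measurable; first exact: finite_finset.
by move=> i _; case: ifP => _ //; exact: measurableC.
Qed.

Lemma measurable_atom k : measurable (atom k).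
Proof.
have [ks|ks] := boolP (k < size nonempty_signatures)%N; last first.
  rewrite (_ : atom k = set0)//; apply/seteqP; split=> // z [].
  by rewrite (negbTE ks).
rewrite (_ : atom k = [set z | nth finset.set0 nonempty_signatures k = signature z]).
  exact: measurable_signature.
by apply/seteqP; split=> z /=; [case|split].
Qed.

Lemma atom_inj i j z : atom i z -> atom j z -> i = j.
Proof.
move=> [i_s iS] [j_s jS]; apply/eqP.
rewrite -(@nth_uniq _ finset.set0 nonempty_signatures)//; first by rewrite iS jS.
by rewrite filter_uniq// enum_uniq.
Qed.

Lemma trivIset_atom : trivIset setT atom.
Proof. by move=> i j _ _ [z [zi zj]]; exact: atom_inj zi zj. Qed.

Lemma atom_sub k z : atom k z -> exists i, A i z.
Proof.
move=> [ks kS].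
have : nth finset.set0 nonempty_signatures k != finset.set0.
  by have := mem_nth finset.set0 ks; rewrite mem_filter => /andP[].
by rewrite kS => /set0Pn[i]; rewrite inE => /asboolP; exists i.
Qed.

Lemma atom_measure_lty (mu : {measure set Z -> \bar R}) k :
  (forall i, (mu (A i) < +oo)%E) -> (mu (atom k) < +oo)%E.
Proof.
move=> Aoo; have [->|/set0P[z zk]] := eqVneq (atom k) set0; first by rewrite measure0.
have [ks kS] := zk; have [i Ai] := atom_sub zk.
apply: le_lt_trans (Aoo i); apply: le_measure; rewrite ?inE//; first exact: measurable_atom.
move=> z' [_ kS'].
have : i \in signature z by rewrite inE; apply/asboolP.
by rewrite -kS kS' inE => /asboolP.
Qed.

Lemma atom_step z : \sum_(i < n) a i * \1_(A i) z =
  \sum_(k < size nonempty_signatures) atom_coef k * \1_(atom k) z.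
Proof.
have -> : \sum_(i < n) a i * \1_(A i) z = \sum_(i in signature z) a i.
  rewrite [RHS]big_mkcond/=; apply: eq_bigr => i _; rewrite inE indicE.
  case: (asboolP (A i z)) => Ai; first by rewrite mem_set// mulr1.
  by rewrite memNset// mulr0.
have [S0|S0] := eqVneq (signature z) finset.set0.
  rewrite S0 big_set0 big1// => k _; rewrite indicE memNset ?mulr0// => zk.
  have [i Ai] := atom_sub zk.
  have : i \in signature z by rewrite inE; apply/asboolP.
  by rewrite S0 inE.
have Sin : signature z \in nonempty_signatures by rewrite mem_filter S0 mem_enum.
pose k := index (signature z) nonempty_signatures.
have ks : (k < size nonempty_signatures)%N by rewrite index_mem.
have zk : atom k z by split => //; rewrite nth_index.
rewrite (bigD1 (Ordinal ks))//= indicE mem_set// mulr1 [X in _ = _ + X]big1 ?addr0 => [|j jk].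
  by rewrite /atom_coef /= /k nth_index.
rewrite indicE memNset ?mulr0// => zj; case/eqP: jk; apply: val_inj => /=.
exact: atom_inj zj zk.
Qed.

(** This is [atom_step] integrated. [mu] is arbitrary because the formula is applied to the
    intensity and, pathwise, to the random measure [N w]. *)
Lemma atom_measure (mu : {measure set Z -> \bar R}) :
  (forall i, (mu (A i) < +oo)%E) ->
  \sum_(i < n) a i * fine (mu (A i)) =
  \sum_(k < size nonempty_signatures) atom_coef k * fine (mu (atom k)).
Proof.
move=> Aoo; transitivity (\int[mu]_z (\sum_(i < n) a i * \1_(A i) z)).
  rewrite Rintegral_sum//; last by move=> i; apply: rintegrableZ => //; exact: rintegrable_indic.
  apply: eq_bigr => i _; rewrite RintegralZl//; last exact: rintegrable_indic.
  by rewrite /Rintegral integral_indic// setIT.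
rewrite (eq_Rintegral _ (fun z _ => atom_step z)) Rintegral_step//.
- by apply: eq_bigr => k _; rewrite setIT.
- exact: measurable_atom.
- by move=> k; exact: atom_measure_lty.
Qed.

End atoms.

(** * The Stein identity of an elementary integral *)

Section elementary_stein.
Context d (Om : measurableType d) (R : realType) (P : probability Om R).
Variables (sigma T : R) (nu : {measure set (measurableTypeR R) -> \bar R}).
Variables (W : R -> {RV P >-> R}) (N : R.-ker Om ~> plane R).
Hypothesis T0 : 0 <= T.
Hypothesis nu0 : nu [set 0] = 0%E.
Hypothesis bmW : brownian_motion W.
Hypothesis prmN : poisson_random_measure P nu N.
Hypothesis indWN : independent_of_measure W N.
Variable e : elementary T nu.
Local Notation leb := (@lebesgue_measure R).

Let t k := endpoint T (@leftW _ _ _ e) (@rightW _ _ _ e) k.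
Let b k := weight T (@leftW _ _ _ e) (@rightW _ _ _ e) (@coefW _ _ _ e) k.
Let mW := size (endpoints (@leftW _ _ _ e) (@rightW _ _ _ e)).
Let B k := atom (@setJ _ _ _ e) k.
Let c k := atom_coef (@coefJ _ _ _ e) k.
Let mJ := size (nonempty_signatures (nJ e)).
Let lambda k : R := fine ((leb \x^ nu)%E (B k)).

Let t_bounds k : 0 <= t k <= T.
Proof. exact: endpoint_bounds (@boundsW _ _ _ e) T0 k. Qed.

Let t_ge0 k : 0 <= t k.
Proof. by case/andP: (t_bounds k). Qed.

Let t_le k : t k <= t k.+1.
Proof. exact: endpoint_le (@boundsW _ _ _ e) T0 _ _ (leqnSn k). Qed.

Let mB k : measurable (B k).
Proof. exact: measurable_atom (@measurable_setJ _ _ _ e) k. Qed.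

Let B_sub k : B k `<=` off_axis T.
Proof. by move=> z /atom_sub[i]; exact: setJ_sub. Qed.

Let B_sub' k : B k `<=` time_jump_space (R := R).
Proof.
move=> z /B_sub[z1 z2]; split => //; move: z1.
by rewrite /= !in_itv/= => /andP[-> _].
Qed.

Let finB k : ((leb \x^ nu) (B k) < +oo)%E.
Proof. by apply: atom_measure_lty; [exact: measurable_setJ|exact: setJ_fin]. Qed.

Definition wiener_part (w : Om) : R :=
  \sum_(k < mW) sigma * b k * (W (t k.+1) w - W (t k) w).
Definition jump_part (w : Om) : R :=
  \sum_(k < mJ) c k * (fine (N w (B k)) - lambda k).
Definition elementary_variance : R :=
  sigma ^+ 2 * \sum_(k < mW) b k ^+ 2 * (t k.+1 - t k).
Definition elementary_jump_op (h h' : R -> R) (x : R) : R :=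
  \sum_(k < mJ) lambda k * (c k * (h (x + c k) - h x)).

Lemma wiener_part_op : has_stein_op P wiener_part (op_gauss elementary_variance).
Proof. by apply: gaussian_part_op => //. Qed.

Lemma jump_part_op : has_stein_op P jump_part elementary_jump_op.
Proof.
apply: (poisson_part_op prmN) => //.
exact: trivIset_atom.
Qed.

(** Independence of [W] and [N] is a statement about generated sigma-algebras, so each part must be
    measurable with respect to its own. *)
Lemma wiener_part_measurable (C : set R) : measurable C ->
  <<s [set E' | exists u (B : set R),
         [/\ 0 <= u, measurable B & E' = W u @^-1` B]] >> (wiener_part @^-1` C).
Proof.
set G := [set E' | _]; move=> mC.
have mWu u : 0 <= u -> measurable_fun [set: g_sigma_algebraType G] (W u : Om -> R).
  by move=> u0 _ D mD; rewrite setTI; apply: sub_sigma_algebra; exists u, D.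
have mw : measurable_fun [set: g_sigma_algebraType G] wiener_part.
  apply: measurable_sum => k; apply: measurable_funM => //.
  by apply: measurable_funB; apply: mWu.
by have := mw measurableT _ mC; rewrite setTI.
Qed.

Lemma jump_part_measurable (C : set R) : measurable C ->
  <<s [set F' | exists (A : set (plane R)) (B : set (\bar R)),
         [/\ measurable A, A `<=` time_jump_space (R := R), measurable B &
             F' = (N ^~ A) @^-1` B]] >> (jump_part @^-1` C).
Proof.
set G := [set F' | _]; move=> mC.
have mNB k : measurable_fun [set: g_sigma_algebraType G] (fun w : Om => N w (B k)).
  move=> _ D mD; rewrite setTI; apply: sub_sigma_algebra; exists (B k), D; split => //.
have mj : measurable_fun [set: g_sigma_algebraType G] jump_part.
  apply: measurable_sum => k; apply: measurable_funM => //; apply: measurable_funB => //.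
  exact: (measurableT_comp (f := fine) (fine_measurable measurableT) (mNB k)).
by have := mj measurableT _ mC; rewrite setTI.
Qed.

Lemma parts_independent : independent_pair P wiener_part jump_part.
Proof.
by move=> C D mC mD; apply: indWN; [exact: wiener_part_measurable|exact: jump_part_measurable].
Qed.

(** [fine] sends infinity to 0 and is additive only on finite values; this confines any failure of
    additivity over atoms to a null set. *)
Lemma prm_finite (A : set (plane R)) : measurable A -> A `<=` time_jump_space (R := R) ->
  ((leb \x^ nu) A < +oo)%E -> {ae P, forall w, (N w A < +oo)%E}.
Proof.
move=> mA A_sub Aoo; have [law _ _] := prmN.
have AE : ((leb \x^ nu) A)%E = (fine ((leb \x^ nu)%E A))%:E by rewrite fineK// ge0_fin_numE.
have mNA : measurable_fun setT (fun w => N w A) by exact: measurable_kernel.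
pose F k : set Om := [set w | N w A = k%:R%:E].
have mF k : measurable (F k) by exact: (measurable_level mNA).
have PF : P (\bigcup_k F k) = 1%E.
  by apply: (poisson_support mNA) => k; exact: law AE.
exists (~` \bigcup_k F k); split.
- by apply: measurableC; exact: bigcup_measurable.
- by rewrite probability_setC ?PF ?subee//; exact: bigcup_measurable.
- by move=> w; apply: contra_not => -[k _ /= ->]; rewrite ltry.
Qed.


Let mS i : measurable (@setJ _ _ _ e i).
Proof. exact: measurable_setJ. Qed.

Let S_sub i : @setJ _ _ _ e i `<=` time_jump_space (R := R).
Proof.
move=> z /setJ_sub[z1 z2]; split => //; move: z1.
by rewrite /= !in_itv/= => /andP[-> _].
Qed.

Lemma elementary_integral_measurable :
  measurable_fun setT (@elementary_integral _ Om R P sigma T nu W N e).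
Proof.
apply: measurable_funD.
  apply: measurable_funM => //; apply: measurable_sum => i; apply: measurable_funM => //.
  exact: measurable_funB.
apply: measurable_sum => i; apply: measurable_funM => //; apply: measurable_funB => //.
apply: (measurableT_comp (f := fine)) => //.
exact: measurable_kernel.
Qed.

Lemma elementary_integral_parts :
  {ae P, forall w, elementary_integral sigma W N e w = wiener_part w + jump_part w}.
Proof.
have fin : {ae P, forall w, forall i : 'I_(nJ e), (N w (@setJ _ _ _ e i) < +oo)%E}.
  by apply: filter_forall => i; apply: prm_finite => //; exact: setJ_fin.
apply: filterS fin => w Nfin; rewrite /elementary_integral /wiener_part /jump_part.
congr (_ + _).
  rewrite (@weighted_increment _ _ _ _ _ (@boundsW _ _ _ e) T0 (@coefW _ _ _ e) (fun u => W u w)).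
  by rewrite mulr_sumr; apply: eq_bigr => k _; rewrite mulrA.
under eq_bigr do rewrite mulrBr.
rewrite sumrB (@atom_measure _ _ _ _ (@setJ _ _ _ e) (@coefJ _ _ _ e) mS (N w))//.
rewrite (@atom_measure _ _ _ _ (@setJ _ _ _ e) (@coefJ _ _ _ e) mS (leb \x^ nu)%E); last exact: setJ_fin.
by rewrite -sumrB; apply: eq_bigr => k _; rewrite mulrBr.
Qed.

Lemma elementary_stein_op : has_stein_op P (elementary_integral sigma W N e)
  (op_add (op_gauss elementary_variance) elementary_jump_op).
Proof.
apply: has_stein_op_ae elementary_integral_measurable elementary_integral_parts _.
apply: has_stein_op_add parts_independent wiener_part_op jump_part_op.
Qed.


Let off_axis_neq0 z : off_axis T z -> z.2 != 0.
Proof. by move=> [_ /eqP]. Qed.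

Let mm_B k : mm sigma nu (B k) = (leb \x^ nu)%E (B k).
Proof. by apply: mm_off_axis => // z /B_sub; exact: off_axis_neq0. Qed.

Lemma elementary_fun_off_axis z : off_axis T z ->
  elementary_fun e z = \sum_(k < mJ) c k * \1_(B k) z.
Proof.
move=> zD; rewrite /elementary_fun big1 ?add0r => [|i _]; first exact: atom_step.
by rewrite indicE memNset ?mulr0// => -[_ /eqP]; exact/negP/off_axis_neq0.
Qed.

Lemma elementary_jump_increment h h' x :
  elementary_jump_op h h' x = jump_increment (mm sigma nu) (off_axis T) (elementary_fun e) h x.
Proof.
have E z : off_axis T z -> elementary_fun e z * (h (x + elementary_fun e z) - h x) =
    \sum_(k < mJ) (c k * (h (x + c k) - h x)) * \1_(B k) z.
  move=> zD; rewrite elementary_fun_off_axis//.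
  (* The function y (h (x + y) - h x) of y vanishes at 0, so on the disjoint atoms it can be applied
     to the coefficients. *)
  apply: (disjoint_step_fun mJ c (F := fun y => y * (h (x + y) - h x))); last by rewrite mul0r.
  by move=> i j; exact: atom_inj.
rewrite /jump_increment (@eq_Rintegral _ _ _ _ _ (fun z =>
    \sum_(k < mJ) (c k * (h (x + c k) - h x)) * \1_(B k) z)) => [|z /set_mem]; last exact: E.
rewrite (Rintegral_step mJ (fun k => c k * (h (x + c k) - h x)))//.
- apply: eq_bigr => k _; rewrite mulrC; congr (_ * fine _).
  by rewrite (setIidl (@B_sub k)) mm_B.
- exact: measurable_off_axis.
- by move=> k; rewrite mm_B.
Qed.

Lemma elementary_sqr_integrable : sqr_integrable (mm sigma nu) (off_axis T) (elementary_fun e).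
Proof.
have mD := measurable_off_axis (R := R) T; split.
  apply: (eq_measurable_fun (fun z => \sum_(k < mJ) c k * \1_(B k) z)).
    by move=> z /set_mem zD; rewrite elementary_fun_off_axis.
  by apply: measurable_sum => k; apply: measurable_funM.
apply: (@eq_rintegrable _ _ _ _ _ mD (fun z => \sum_(k < mJ) c k ^+ 2 * \1_(B k) z)).
  move=> z zD; rewrite elementary_fun_off_axis//; apply/esym.
  apply: (disjoint_step_fun mJ c (F := fun y => y ^+ 2)); last by rewrite expr0n.
  by move=> i j; exact: atom_inj.
apply: (step_integrable mJ (fun k => c k ^+ 2)) => // k.
by rewrite mm_B.
Qed.

Let I k : set (plane R) := `]t k, t k.+1] `*` [set 0].

Let mI k : measurable (I k). Proof. exact: measurableX. Qed.

Let I_sub k : I k `<=` on_axis T.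
Proof.
move=> z [z1 z2]; split => //; move: z1; rewrite /= !in_itv/= => /andP[tz zt].
by rewrite (le_lt_trans (t_ge0 k) tz) (le_trans zt)//; case/andP: (t_bounds k.+1).
Qed.

Let mm_I k : mm sigma nu (I k) = (sigma ^+ 2 * (t k.+1 - t k))%:E.
Proof.
rewrite mm_on_axis => // [|z []//].
rewrite (_ : ysection (I k) 0 = `]t k, t k.+1]%classic); last first.
  apply/seteqP; split=> y; rewrite /ysection/=; first by move/set_mem=> -[].
  by move=> h; apply/mem_set; split.
rewrite lebesgue_measure_itv/= lte_fin; case: ltP => h; first by rewrite -EFinD -EFinM.
have -> : t k.+1 = t k by apply/eqP; rewrite eq_le h t_le.
by rewrite subrr mulr0 mule0.
Qed.

Lemma elementary_fun_on_axis z : on_axis T z ->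
  elementary_fun e z = \sum_(k < mW) b k * \1_(I k) z.
Proof.
move=> [_ z0]; rewrite /elementary_fun [X in _ + X]big1 ?addr0 => [|i _]; last first.
  by rewrite indicE memNset ?mulr0// => /setJ_sub/off_axis_neq0; rewrite z0 eqxx.
have E (A : set R) : \1_(A `*` [set 0]) z = \1_A z.1 :> R.
  rewrite !indicE; congr (nat_of_bool _)%:R.
  by apply/idP/idP => /set_mem; [move=> [? _]; exact: mem_set|move=> ?; apply/mem_set; split].
under eq_bigr do rewrite E.
under [RHS]eq_bigr do rewrite E.
exact: (weighted_indic (@boundsW _ _ _ e) T0 (@coefW _ _ _ e)).
Qed.

Lemma elementary_varianceE :
  elementary_variance = \int[mm sigma nu]_(z in on_axis T) elementary_fun e z ^+ 2.
Proof.
rewrite (@eq_Rintegral _ _ _ _ _ (fun z => \sum_(k < mW) b k ^+ 2 * \1_(I k) z)) => [|z /set_mem zD].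
  rewrite (Rintegral_step mW (fun k => b k ^+ 2))//.
  - rewrite /elementary_variance mulr_sumr; apply: eq_bigr => k _.
    by rewrite (setIidl (@I_sub k)) mm_I /= mulrCA.
  - exact: measurable_on_axis.
  - by move=> k; rewrite mm_I ltry.
rewrite elementary_fun_on_axis//.
apply: (disjoint_step_fun mW b (F := fun y => y ^+ 2)); last by rewrite expr0n.
(* Half-open cells between consecutive entries of a nondecreasing sequence are disjoint. *)
move=> i j; rewrite /I /= => -[zi _] [zj _]; move: zi zj; rewrite !in_itv/=.
move=> /andP[i1 i2] /andP[j1 j2]; apply/eqP.
have H (k l : nat) : t k < z.1 -> z.1 <= t l.+1 -> ~~ (l < k)%N.
  move=> h1 h2; apply/negP => lk; have := endpoint_le (@boundsW _ _ _ e) T0 lk.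
  by move=> /(le_trans h2)/(lt_le_trans h1); rewrite ltxx.
by rewrite eqn_leq [(i <= j)%N]leqNgt [(j <= i)%N]leqNgt (H i j)// (H j i).
Qed.

Lemma elementary_stein_identity :
  stein_identity P (mm sigma nu) (off_axis T) (elementary_integral sigma W N e)
    (elementary_fun e) (\int[mm sigma nu]_(z in on_axis T) elementary_fun e z ^+ 2).
Proof.
have [mY Y2 [bo _] hY] := elementary_stein_op.
move=> h h' hh; have [h1 h2 _] := hh.
have mD := measurable_off_axis (R := R) T.
have bI (g : R -> R) : bounded_lipschitz g ->
    P.-integrable setT (EFin \o (fun w => g (elementary_integral sigma W N e w))).
  move=> bg; have [K _ [gK _]] := bg; apply: bounded_rintegrable => [|w]; last exact: gK.
  by apply: measurableT_comp => //; exact: bounded_lipschitz_measurable.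
have mh : measurable_fun setT h by exact: bounded_lipschitz_measurable.
have Yh : P.-integrable setT (EFin \o (fun w => elementary_integral sigma W N e w *
    h (elementary_integral sigma W N e w))).
  apply: rintegrableM_sqr => //; first exact: measurableT_comp.
  have [K _ [hK _]] := h1; apply: (@bounded_rintegrable _ _ _ _ _ (K ^+ 2)) => [|w].
    by apply: measurable_funX; exact: measurableT_comp.
  by rewrite normrX lerXn2r// nnegrE// (le_trans _ (hK 0)).
have op_h := bo _ _ hh.
have := hY _ _ hh; rewrite RintegralB//; last exact: bI.
move/eqP; rewrite subr_eq0 => /eqP ->.
rewrite /op_add /op_gauss -elementary_varianceE RintegralD//; last 2 first.
- by apply: rintegrableZ => //; exact: bI.
- by have [_ _ [bj _] _] := jump_part_op; exact: (bI _ (bj _ _ hh)).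
rewrite addrC RintegralZl//; last exact: bI.
by congr (_ + _); apply: eq_Rintegral => w _; rewrite elementary_jump_increment.
Qed.

End elementary_stein.

(** * Passage to the L2 limit *)

Section square_convergence.
Context d (Z : measurableType d) (R : realType) (m : {measure set Z -> \bar R}).
Implicit Types (D : set Z) (g e f : Z -> R).

Lemma sqr_integrable_of_diff D e f : measurable D ->
  measurable_fun D e -> measurable_fun D f ->
  m.-integrable D (EFin \o (fun z => (e z - f z) ^+ 2)) ->
  m.-integrable D (EFin \o (fun z => f z ^+ 2)) ->
  m.-integrable D (EFin \o (fun z => e z ^+ 2)).
Proof.
move=> mD me mf ef f2.
apply: (le_rintegrable mD (g := fun z => 2 * (e z - f z) ^+ 2 + 2 * f z ^+ 2)).
- exact: measurable_funX.
- by apply: rintegrableD => //; exact: rintegrableZ.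
- by move=> z _; rewrite ger0_norm ?sqr_ge0//; have := sqr_ge0 (e z - f z - f z); nra.
Qed.

Lemma cvg_Rintegral_sqr_sub D0 D (g : nat -> Z -> R) :
  measurable D0 -> measurable D -> D `<=` D0 -> (forall k, measurable_fun D0 (g k)) ->
  (forall k, \int[m]_(z in D0) (g k z ^+ 2)%:E < +oo)%E ->
  (\int[m]_(z in D0) (g k z ^+ 2)%:E @[k --> \oo] --> 0)%E ->
  (forall k, m.-integrable D (EFin \o (fun z => g k z ^+ 2))) /\
  \int[m]_(z in D) g k z ^+ 2 @[k --> \oo] --> 0.
Proof.
move=> mD0 mD DD0 mg goo g0.
have int0 k : m.-integrable D0 (EFin \o (fun z => g k z ^+ 2)).
  by apply: ge0_rintegrable => // [|z _]; [exact: measurable_funX|exact: sqr_ge0].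
have int k : m.-integrable D (EFin \o (fun z => g k z ^+ 2)).
  exact: integrableS (int0 k).
split=> //.
apply: (@cvg_to_0_le _ _ (fun k => fine (\int[m]_(z in D0) (g k z ^+ 2)%:E)%E)); last first.
  exact: fine_cvg.
move=> k; rewrite subr0 ger0_norm; last by apply: Rintegral_ge0 => z _; exact: sqr_ge0.
rewrite -lee_fin EFin_Rintegral// -[X in (_ <= X%:E)%E]/(\int[m]_(z in D0) g k z ^+ 2).
rewrite EFin_Rintegral//; apply: ge0_subset_integral => //.
- by apply/measurable_EFinP; exact: measurable_funX.
- by move=> z _; rewrite lee_fin sqr_ge0.
Qed.

(** e^2 - f^2 = (e - f)^2 + 2 (e - f) f, and Cauchy-Schwarz bounds the mixed term. *)
Lemma cvg_Rintegral_sqr D (e : nat -> Z -> R) f : measurable D ->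
  (forall k, measurable_fun D (e k)) -> measurable_fun D f ->
  (forall k, m.-integrable D (EFin \o (fun z => (e k z - f z) ^+ 2))) ->
  m.-integrable D (EFin \o (fun z => f z ^+ 2)) ->
  \int[m]_(z in D) (e k z - f z) ^+ 2 @[k --> \oo] --> 0 ->
  \int[m]_(z in D) e k z ^+ 2 @[k --> \oo] --> \int[m]_(z in D) f z ^+ 2.
Proof.
move=> mD me mf ef f2 ef0.
have mB k : measurable_fun D (fun z => e k z - f z) by exact: measurable_funB.
have efI k := rintegrableM_sqr mD (mB k) mf (ef k) f2.
have e2 k := sqr_integrable_of_diff mD (me k) mf (ef k) f2.
pose a k := \int[m]_(z in D) (e k z - f z) ^+ 2.
pose F := \int[m]_(z in D) f z ^+ 2.
apply: (@cvg_to_0_le _ _ (fun k => a k + 2 * (Num.sqrt (a k) * Num.sqrt F))); last first.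
  have sa : Num.sqrt (a k) @[k --> \oo] --> (0 : R).
    rewrite -[X in _ --> X]sqrtr0; apply: (cvg_comp a Num.sqrt ef0); exact: sqrt_continuous.
  rewrite [X in _ --> X](_ : 0 = 0 + 2 * (0 * Num.sqrt F)); last by rewrite mul0r mulr0 addr0.
  by apply: cvgD => //; apply: cvgM; [exact: cvg_cst|apply: cvgM => //; exact: cvg_cst].
move=> k; rewrite -RintegralB//.
rewrite (le_trans (normr_Rintegral_le mD (rintegrableB mD (e2 k) f2)
  (rintegrableD mD (ef k) (rintegrableZ mD 2 (rintegrable_norm (efI k)))) _))//.
  move=> z _ /=; rewrite (_ : _ - _ = (e k z - f z) ^+ 2 + 2 * ((e k z - f z) * f z)); last by ring.
  rewrite (le_trans (ler_normD _ _))// lerD//; first by rewrite ger0_norm// sqr_ge0.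
  by rewrite normrM (ger0_norm (ler0n R 2)).
rewrite RintegralD//; last by apply: rintegrableZ => //; exact: rintegrable_norm.
rewrite RintegralZl//; last exact: rintegrable_norm.
by rewrite lerD2l ler_pM2l//; exact: Rintegral_cauchy_schwarz.
Qed.

End square_convergence.

Section first_chaos.
Context d (Om : measurableType d) (R : realType) (P : probability Om R).
Variables (sigma T : R) (nu : {measure set (measurableTypeR R) -> \bar R}).
Variables (W : R -> {RV P >-> R}) (N : R.-ker Om ~> plane R).
Hypothesis T0 : 0 <= T.
Hypothesis nu0 : nu [set 0] = 0%E.
Hypothesis bmW : brownian_motion W.
Hypothesis prmN : poisson_random_measure P nu N.
Hypothesis indWN : independent_of_measure W N.

Lemma measurable_strip : measurable (strip T : set (plane R)).
Proof. by apply: measurableX. Qed.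

Lemma off_axis_strip : off_axis T `<=` strip T.
Proof. by move=> z [z1 _]; split => //; move: z1; rewrite /= !in_itv/= => /andP[/ltW-> ->]. Qed.

Lemma on_axis_strip : on_axis T `<=` strip T.
Proof. by move=> z [z1 _]; split => //; move: z1; rewrite /= !in_itv/= => /andP[/ltW-> ->]. Qed.

Lemma measurable_elementary_fun (e : elementary T nu) : measurable_fun setT (elementary_fun e).
Proof.
apply: measurable_funD; apply: measurable_sum => i; apply: measurable_funM => //.
- by apply: measurable_indic; exact: measurableX.
- by apply: measurable_indic; exact: measurable_setJ.
Qed.

Lemma in_Lp_integrable n f D : measurable D -> D `<=` strip T -> in_Lp sigma T nu n f ->
  (mm sigma nu).-integrable D (EFin \o (fun z => `|f z| ^+ n)).
Proof.
move=> mD DS [mf foo]; apply: (integrableS measurable_strip mD DS).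
apply: ge0_rintegrable => //.
by apply: measurable_funX; exact: measurableT_comp.
Qed.

Lemma in_L2_integrable f D : measurable D -> D `<=` strip T -> in_Lp sigma T nu 2 f ->
  (mm sigma nu).-integrable D (EFin \o (fun z => f z ^+ 2)).
Proof.
move=> mD DS /(in_Lp_integrable mD DS); apply: eq_rintegrable => // z _.
by rewrite real_normK// num_real.
Qed.

Lemma in_L2_sqr_integrable f : in_Lp sigma T nu 2 f ->
  sqr_integrable (mm sigma nu) (off_axis T) f.
Proof.
move=> f2; split; last exact: in_L2_integrable (measurable_off_axis T) off_axis_strip f2.
exact: measurable_funS measurable_strip off_axis_strip f2.1.
Qed.

Lemma stein_I1 f (X : {RV P >-> R}) : in_Lp sigma T nu 2 f -> is_I1 sigma T nu W N f X ->
  P.-integrable setT (EFin \o (fun w => X w ^+ 2)) /\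
  stein_identity P (mm sigma nu) (off_axis T) X f (\int[mm sigma nu]_(z in on_axis T) f z ^+ 2).
Proof.
move=> f2 [e [ef eX]].
have mS := measurable_strip.
have mON := measurable_on_axis (R := R) T.
have mOFF := measurable_off_axis (R := R) T.
(* Convergence of extended-valued errors to 0 makes them finite only from some rank K on, so the
   sequence is shifted by K. *)
have [K HK] : exists K, forall k, (K <= k)%N ->
    (\int[mm sigma nu]_(z in strip T) ((elementary_fun (e k) z - f z) ^+ 2)%:E < +oo)%E /\
    (\int[P]_w ((elementary_integral sigma W N (e k) w - X w) ^+ 2)%:E < +oo)%E.
  have h (u : nat -> \bar R) : (u k @[k --> \oo] --> 0)%E -> \forall k \near \oo, (u k < +oo)%E.
    by move=> u0; apply: (u0 [set x | (x < +oo)%E]); exact: open_ereal_lt' (ltry 0).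
  have [K _ HK] := filterI (h _ ef) (h _ eX).
  by exists K => k /HK.
pose e' k := e (k + K)%N.
have ef' : (\int[mm sigma nu]_(z in strip T) ((elementary_fun (e' k) z - f z) ^+ 2)%:E
    @[k --> \oo] --> 0)%E.
  by rewrite -(cvg_shiftn K) in ef.
have eX' : (\int[P]_w ((elementary_integral sigma W N (e' k) w - X w) ^+ 2)%:E
    @[k --> \oo] --> 0)%E.
  by rewrite -(cvg_shiftn K) in eX.
have mfS : measurable_fun (strip T) f by exact: f2.1.
have mef k : measurable_fun (strip T) (fun z => elementary_fun (e' k) z - f z).
  apply: measurable_funB => //; apply: measurable_funTS.
  exact: measurable_elementary_fun.
have meX k := elementary_integral_measurable sigma W N (e' k).
have mX : measurable_fun setT X by [].
have [efI_on ef_on] := cvg_Rintegral_sqr_sub mS mON on_axis_strip mef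
  (fun k => (HK _ (leq_addl k K)).1) ef'.
have [efI_off ef_off] := cvg_Rintegral_sqr_sub mS mOFF off_axis_strip mef
  (fun k => (HK _ (leq_addl k K)).1) ef'.
have [eXI eX0] := cvg_Rintegral_sqr_sub measurableT measurableT (@subset_refl _ setT)
  (fun k => measurable_funB (meX k) mX) (fun k => (HK _ (leq_addl k K)).2) eX'.
have Y2 k : P.-integrable setT (EFin \o (fun w => elementary_integral sigma W N (e' k) w ^+ 2)).
  by have [] := elementary_stein_op sigma T0 bmW prmN indWN (e' k).
(* One approximation at finite L^2 distance suffices, here the first of the shifted sequence. *)
have X2 : P.-integrable setT (EFin \o (fun w => X w ^+ 2)).
  apply: (sqr_integrable_of_diff measurableT mX (meX 0%N) _ (Y2 0%N)).
  by apply: eq_rintegrable (eXI 0%N) => // w _; rewrite -sqrrN opprB.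
split=> //.
apply: (stein_limit mOFF (X_ := fun k w => elementary_integral sigma W N (e' k) w)
  (e_ := fun k => elementary_fun (e' k))
  (v_ := fun k => \int[mm sigma nu]_(z in on_axis T) elementary_fun (e' k) z ^+ 2)) => //.
- by move=> k; exact: elementary_sqr_integrable.
- exact: in_L2_sqr_integrable.
- apply: cvg_Rintegral_sqr => //.
  + by move=> k; apply: measurable_funTS; exact: measurable_elementary_fun.
  + exact: measurable_funS mS on_axis_strip mfS.
  + exact: in_L2_integrable on_axis_strip f2.
- by move=> k; exact: elementary_stein_identity.
Qed.

End first_chaos.

Section axis_integrals.
Context (R : realType) (sigma T : R).
Variable nu : {measure set (measurableTypeR R) -> \bar R}.
Variable f : plane R -> R.
Hypothesis f2 : in_Lp sigma T nu 2 f.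
Local Notation mm := (mm sigma nu).

Lemma Rintegral_strip : \int[mm]_(z in `]0, T] `*` [set: R]) f z ^+ 2 =
  \int[mm]_(z in on_axis T) f z ^+ 2 + \int[mm]_(z in off_axis T) f z ^+ 2.
Proof.
have mON := measurable_on_axis (R := R) T.
have mOFF := measurable_off_axis (R := R) T.
have E : `]0, T] `*` [set: R] = on_axis T `|` off_axis T.
  apply/seteqP; split=> -[t x]; last by move=> [] [].
  by move=> [t0 _]; have [->|/eqP x0] := eqVneq x 0; [left|right].
rewrite E Rintegral_setU//.
- apply: in_L2_integrable f2; first exact: measurableU.
  by move=> z [/on_axis_strip|/off_axis_strip].
- by apply/disj_setPS => z [[_ z0] [_]].
Qed.

Lemma stein_cumulantE i : stein_cumulant mm (off_axis T) f
    (\int[mm]_(z in on_axis T) f z ^+ 2) i =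
  if i == 1%N then 0
  else if i == 2%N then \int[mm]_(z in `]0, T] `*` [set: R]) f z ^+ 2
  else \int[mm]_(z in `]0, T] `*` [set~ 0]) f z ^+ i.
Proof. by rewrite /stein_cumulant Rintegral_strip. Qed.

(** On the axis the intensity is the image of sigma^2 times Lebesgue measure under s |-> (s, 0). *)
Lemma Rintegral_on_axis : nu [set 0] = 0%E ->
  \int[mm]_(z in on_axis T) f z ^+ 2 =
  \int[lebesgue_measure]_(s in `]0, T]) (f (s, 0) ^+ 2 * sigma ^+ 2).
Proof.
move=> nu0; have mON := measurable_on_axis (R := R) T.
pose phi (s : measurableTypeR R) : plane R := (s, 0).
have mphi : measurable_fun setT phi by exact: measurable_fun_pair.
pose s2 : {nonneg R} := NngNum (sqr_ge0 sigma).
have mf : measurable_fun (on_axis T) f.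
  exact: measurable_funS (measurable_strip T) (@on_axis_strip _ T) f2.1.
have mf2 : measurable_fun (on_axis T) (fun z => (f z ^+ 2)%:E).
  by apply/measurable_EFinP; exact: measurable_funX.
have preE : phi @^-1` on_axis T = `]0, T]%classic.
  by apply/seteqP; split=> s; [case|split].
have mfphi : measurable_fun (`]0%R, T]%classic : set (measurableTypeR R))
    (fun s : measurableTypeR R => (f (s, 0) ^+ 2)%:E).
  refine (@measurable_comp _ _ _ (measurableTypeR R) (plane R) _ (on_axis T) (fun z => (f z ^+ 2)%:E) _ phi mON _ mf2 _).
    by move=> _ [s s0 <-]; split.
  exact: measurable_funTS.
rewrite /Rintegral; congr (fine _).
rewrite (@eq_measure_integral _ _ _ _ (pushforward (mscale s2 (@lebesgue_measure R)) phi)); last first.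
  move=> A mA AD.
  rewrite mm_on_axis//; last by move=> z /AD[].
  rewrite /pushforward /mscale /=; congr (_ * _)%E; congr (lebesgue_measure _).
  by apply/seteqP; split=> s; rewrite /ysection/=; [move/set_mem|move=> ?; exact/mem_set].
rewrite ge0_integral_pushforward//; last by move=> z _; rewrite lee_fin sqr_ge0.
rewrite preE ge0_integral_mscale//; last by move=> s _; rewrite /= lee_fin sqr_ge0.
rewrite -ge0_integralZl//; last by move=> s _; rewrite /= lee_fin sqr_ge0.
by apply: eq_integral => s _; rewrite /= mulrC EFinM.
Qed.

Lemma mm_off_axis_eq0 : (forall A : set R, measurable A -> nu A = 0%E) ->
  mm (off_axis T) = 0%E.
Proof.
move=> nu_eq0; rewrite mm_off_axis//; first last.
- by move=> z [_ /eqP].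
- exact: measurable_off_axis.
rewrite /product_measure2.
rewrite (@eq_measure_integral _ _ _ _ mzero) ?integral_measure_zero// => A mA _.
exact: nu_eq0.
Qed.

End axis_integrals.

Lemma expectationE d (Om : measurableType d) (R : realType) (P : probability Om R) (X : Om -> R) :
  P.-integrable setT (EFin \o X) -> 'E_P[X]%E = (\int[P]_w X w)%:E.
Proof. by move=> iX; rewrite unlock EFin_Rintegral. Qed.

(** For even n and v >= 0 the real power is an integer power; for odd n both sides vanish. *)
Lemma gaussian_moment_powR (R : realType) (v : R) n : 0 <= v -> gaussian_moment v n =
  (double_factorial n.-1)%:R * v `^ (n%:R / 2) * (~~ odd n)%:R.
Proof.
move=> v0; rewrite /gaussian_moment; case: ifPn => on /=; first by rewrite mulr0.
rewrite mulr1 (_ : n%:R / 2 = n./2%:R) ?powR_mulrn//.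
rewrite -{1}(even_halfK on) -mul2n natrM mulrAC mulfV ?mul1r//.
Qed.

Theorem proposition5p1 (d : measure_display) (Om : measurableType d)
    (R : realType) (P : probability Om R)
    (gamma sigma T : R) (nu : {measure set (measurableTypeR R) -> \bar R})
    (L W : R -> {RV P >-> R}) (N : R.-ker Om ~> plane R)
    (sigma_ge0 : 0 <= sigma) (T_gt0 : 0 < T)
    (levyL : levy_process L)
    (tripletL : characteristic_triplet gamma sigma nu L)
    (itoL : levy_ito_decomposition gamma sigma nu L W N)
    (f : plane R -> R) (f_L2 : in_Lp sigma T nu 2 f)
    (X : {RV P >-> R}) (XI1 : is_I1 sigma T nu W N f X) :
  (forall n : nat, (2 <= n)%N -> in_Lp sigma T nu n f ->
    'E_P[fun w => (X w ^+ n)%R]%E =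
      (bell n (fun i =>
        if i == 1%N then 0
        else if i == 2%N then
          \int[mm sigma nu]_(z in `]0, T] `*` [set: R]) f z ^+ 2
        else \int[mm sigma nu]_(z in `]0, T] `*` [set~ 0]) f z ^+ i))%:E
    /\
    'E_P[fun w => (X w ^+ n)%R]%E =
      (\sum_(1 <= q < n.+1)
        \sum_(j : (n - q).-tuple 'I_n.+1 |
            ((\sum_(2 <= i < (n - q).+2) mult (0%N :: entries j) i)%N == q)
            && ((\sum_(2 <= i < (n - q).+2)
                   i * mult (0%N :: entries j) i)%N == n))
          bell_coef n (0%N :: entries j)
          * (\int[mm sigma nu]_(z in `]0, T] `*` [set: R]) f z ^+ 2)
              ^+ mult (0%N :: entries j) 2
          * \prod_(3 <= i < (n - q).+2)
              (\int[mm sigma nu]_(z in `]0, T] `*` [set~ 0]) f z ^+ i)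
                ^+ mult (0%N :: entries j) i)%:E)
  /\
  (forall n : nat, (2 <= n)%N ->
    (forall A : set R, measurable A -> nu A = 0%E) ->
    'E_P[fun w => (X w ^+ n)%R]%E =
      (bell n (fun i =>
        if i == 2%N then
          \int[lebesgue_measure]_(s in `]0, T]) (f (s, 0) ^+ 2 * sigma ^+ 2)
        else 0))%:E
    /\
    'E_P[fun w => (X w ^+ n)%R]%E =
      ((double_factorial n.-1)%:R
       * (\int[lebesgue_measure]_(s in `]0, T])
            (f (s, 0) ^+ 2 * sigma ^+ 2)) `^ (n%:R / 2)
       * (~~ odd n)%:R)%:E)
  /\
  ((forall n : nat, (2 <= n)%N -> in_Lp sigma T nu n f) ->
    [/\ is_cumulant P X 1 0,
        is_cumulant P X 2
          (\int[mm sigma nu]_(z in `]0, T] `*` [set: R]) f z ^+ 2) &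
        forall n : nat, (3 <= n)%N ->
          is_cumulant P X n
            (\int[mm sigma nu]_(z in `]0, T] `*` [set~ 0]) f z ^+ n)]).
Proof.
have T0 : 0 <= T := ltW T_gt0.
have [[nu0 _] _] := tripletL.
have [bmW prmN indWN _ _] := itoL.
have mOFF := measurable_off_axis (R := R) T.
have [X2 steinX] := stein_I1 T0 nu0 bmW prmN indWN f_L2 XI1.
have sf := in_L2_sqr_integrable f_L2.
have mX : measurable_fun setT X by [].
pose kappa i := if i == 1%N then 0
  else if i == 2%N then \int[mm sigma nu]_(z in `]0, T] `*` [set: R]) f z ^+ 2
  else \int[mm sigma nu]_(z in `]0, T] `*` [set~ 0]) f z ^+ i.
have kappaE : stein_cumulant (mm sigma nu) (off_axis T) f
    (\int[mm sigma nu]_(z in on_axis T) f z ^+ 2) = kappa.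
  by apply/funext => i; exact: stein_cumulantE.
have moment n : (0 < n)%N -> abs_power_integrable (mm sigma nu) (off_axis T) f n ->
    'E_P[fun w => (X w ^+ n)%R]%E = (bell n kappa)%:E.
  move=> n0 fn; have [Xn XnE] := stein_moments mOFF sf mX X2 steinX n0 fn.
  by rewrite expectationE// XnE kappaE.
split; [|split].
- move=> n n2 fn.
  have E : 'E_P[fun w => (X w ^+ n)%R]%E = (bell n kappa)%:E.
    by apply: moment; [exact: ltnW|exact: in_Lp_integrable mOFF (@off_axis_strip _ T) fn].
  split; first exact: E.
  rewrite E (bell_x1_eq0 n (x := kappa))//; congr EFin.
  apply: eq_bigr => q _; apply: eq_bigr => j _; congr (_ * _).
  by apply: eq_big_nat => i /andP[i3 _]; rewrite /kappa; case: i i3 => [|[|[|i]]].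
- move=> n n2 nu_eq0.
  (* Without jumps the region off the axis is a null set: every power of f is integrable there with
     integral 0. The moment formula thus applies at every order, and only the second cumulant
     survives. *)
  have off0 := mm_off_axis_eq0 sigma T nu_eq0.
  have mf := sf.1.
  have fn : abs_power_integrable (mm sigma nu) (off_axis T) f n.
    apply: ge0_rintegrable => //.
      by apply: measurable_funX; exact: measurableT_comp.
    rewrite null_set_integral//; apply/measurable_EFinP.
    by apply: measurable_funX; exact: measurableT_comp.
  have f0 i : \int[mm sigma nu]_(z in off_axis T) f z ^+ i = 0.
    rewrite /Rintegral null_set_integral//; apply/measurable_EFinP.
    exact: measurable_funX.
  have kE : kappa = (fun i => if i == 2%N then
      \int[lebesgue_measure]_(s in `]0, T]) (f (s, 0) ^+ 2 * sigma ^+ 2) else 0).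
    apply/funext => i; rewrite -kappaE /stein_cumulant f0 Rintegral_on_axis// f0 addr0.
    by case: eqP => // ->.
  have E := moment n (ltnW n2) fn; split; first by rewrite E kE.
  rewrite E kE bell_gaussian// gaussian_moment_powR//.
  by apply: Rintegral_ge0 => s _; rewrite mulr_ge0// sqr_ge0.
- move=> fN.
  have fN' n : (1 < n)%N -> (mm sigma nu).-integrable (off_axis T) (EFin \o (fun z => `|f z| ^+ n)).
    by move=> /fN; apply: in_Lp_integrable => //; exact: off_axis_strip.
  have C n : (0 < n)%N -> is_cumulant P X n (kappa n).
    by move=> n0; rewrite -kappaE; exact: stein_cumulants.
  split; [exact: (C 1%N)|exact: (C 2%N)|move=> n n3].
  have := C n (ltnW (ltnW n3)); rewrite /kappa.
  by case: n n3 => [|[|[|n]]].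
Qed.
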